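(* Let $f,g:\mathbb R^d\to\mathbb R$, $\mathcal B=\{x\in\mathbb R^d:\|x\|\le 1\}$ and $\mathcal C=\{x\in\mathbb R^d:g(x)\le 0\}$. Assume: (i) $\mathcal C$ is nonempty, closed and contained in $\mathcal B$, and a point $x_0\in\mathcal C$ is supplied. (ii) On an open convex neighborhood $U$ of $\mathcal B$, $f$ is $\ell$-weakly convex and $G_f$-Lipschitz, with $\ell,G_f>0$. There is a stochastic oracle $\widetilde v(x;\xi)$, queried with fresh randomness $\xi$ at each call, such that for every query point $x$ measurable with respect to the past history $\mathcal F$, $\mathbb E[\widetilde v(x;\xi)\mid\mathcal F]=v(x)\in\partial f(x)$ and $\|\widetilde v(x;\xi)\|\le G_f$ almost surely. (iii) $g$ is convex and continuously differentiable on $U$, and for constants $G_g,\sigma>0$, $\|\nabla g(x)\|\le G_g$ for all $x\in\mathcal B$ and $\|\nabla g(z)\|\ge\sigma$ for all $z\in\mathcal B$ with $g(z)=0$. Values $g(x)$ and gradients $\nabla g(x)$ can be evaluated exactly. Let $\Delta_f=f(x_0)-\min_{x\in\mathcal B}f(x)$ and let $0<\epsilon\le 1$. Run the Penalized Proximal Subgradient Method with One Projection (described in the context) with penalty $p=p_\gamma$, $p_\gamma(u)=\gamma\log(1+\exp(\lambda_0u/\gamma))$, $\lambda_0=2(G_f+4\ell)/\sigma$, $\gamma=1/K$, $\beta=2\ell$, $m=\ell$, and index set $\mathcal I=\{1,\dots,T\}$. Choose $$T=\max\Big\{2,\Big\lceil\frac{1000\,\ell\Delta_f}{\epsilon^2}\Big\rceil\Big\},$$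 and $K\ge2$ an integer with $e_K(1/(6T))\le e_*$, where $e_K(\cdot)$ and $e_*$ are defined in the context. Then $T=O(1+\ell\Delta_f/\epsilon^2)$, $K$ can be chosen with $K=\widetilde O(\epsilon^{-2})$ for fixed problem parameters, and with these choices the output $\hat x$ satisfies $$\hat x\in\mathcal C,\qquad \Pr\{\mathcal S_\ell(\hat x)\le\epsilon\}\ge\tfrac23,$$ where $\mathcal S_\ell(x)=\|\nabla\Phi_\ell(x)\|=2\ell\|x-Q_\ell(x)\|$, $\Phi_\ell(x)=\min_{y\in\mathcal C}\{f(y)+\ell\|y-x\|^2\}$ and $Q_\ell(x)=\operatorname{argmin}_{y\in\mathcal C}\{f(y)+\ell\|y-x\|^2\}$ (a unique point). For fixed problem parameters, the algorithm uses $TK=\widetilde O(\epsilon^{-4})$ stochastic subgradient calls and exactly one projection onto $\mathcal C$.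
   Context: All norms are Euclidean; $[u]_+=\max\{u,0\}$; $\mathcal P_D(x)=\operatorname{argmin}_{y\in D}\|y-x\|$. $\partial$ denotes the limiting subdifferential. A function is $\ell$-weakly convex if adding $\frac{\ell}{2}\|\cdot\|^2$ makes it convex. $\widetilde O$ hides polylogarithmic factors in $1/\epsilon$; ''fixed problem parameters'' means $\ell,G_f,G_g,\sigma,\Delta_f$ are held fixed. Algorithm (Penalized Proximal Subgradient Method with One Projection). Inputs: $x_0\in\mathcal B$, integers $T,K\ge2$, penalty $p$, index set $\mathcal I$, and $\beta,m>0$ such that each $H_t$ below is $m$-strongly convex on $\mathcal B$. For $t=0,\dots,T-1$: form $H_t(z)=f(z)+p(g(z))+\frac{\beta}{2}\|z-x_t\|^2$ and set $x_{t+1}=\mathrm{PSM}(H_t,x_t)$. Then sample $J$ uniformly from $\mathcal I$ (independently of everything else) and return $\hat x\in\mathcal P_{\mathcal C}(x_J)$. Subroutine $\mathrm{PSM}(H_t,x_t)$: set $z_1=x_t$. For $s=1,\dots,K$: set $\eta_s=2/[m(s+1)]$, query $\widetilde v(z_s;\xi_s)$ with fresh $\xi_s$, set $h_s=\widetilde v(z_s;\xi_s)+\beta(z_s-x_t)+\nabla(p\circ g)(z_s)$, and $z_{s+1}=\mathcal P_{\mathcal B}(z_s-\eta_sh_s)$. Return $K^{-1}\sum_{s=1}^Kz_s$. Constants: $G_F=G_f+4\ell$, $G_H=G_F+\lambda_0G_g$, $$U_K(m,G,\delta)=\frac{m+(G^2/m)\{\log(K+1)+2\log(1/\delta)\}}{K},\qquad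 e_K(\delta)=U_K(\ell,G_H,\delta)+\frac{\log 2}{K},$$ $$e_*=\min\Big\{\frac{\epsilon^2}{4000\,\ell},\ \frac{G_F\epsilon}{60\,\ell}\Big\}.$$ *)

(* Defs.v *)
From HB Require Import structures.
From mathcomp Require Import all_boot all_order all_algebra.
From mathcomp Require Import all_classical all_reals all_analysis.

Set Implicit Arguments.
Unset Strict Implicit.
Unset Printing Implicit Defensive.

Import Order.TTheory GRing.Theory Num.Theory.
Import numFieldNormedType.Exports.

Local Open Scope classical_set_scope.
Local Open Scope ring_scope.

Section Euclidean.
Context {R : realType} {d : nat}.
Implicit Types (x y z w : 'rV[R]_d) (D : set 'rV[R]_d) (h : 'rV[R]_d -> R).

Definition edot x y : R := \sum_(i < d) x 0 i * y 0 i.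

(* The library norm on ['rV[R]_d] is the sup norm; it only serves for the
   topology, which is the Euclidean one. *)
Definition enorm x : R := Num.sqrt (edot x x).

Definition unit_ball : set 'rV[R]_d := [set x | enorm x <= 1].

(* For a differentiable [h] this is the vector representing ['d h x] for the
   Euclidean inner product. *)
Definition grad h x : 'rV[R]_d := \row_(i < d) 'D_(delta_mx 0 i) h x.

Definition argmin D h : set 'rV[R]_d :=
  [set y | D y /\ forall z, D z -> h y <= h z].

(* Only used where the infimum is attained. *)
Definition minval D h : R := inf [set h y | y in D].

Definition projection_set D x : set 'rV[R]_d := argmin D (fun y => enorm (y - x)).

Definition projB x : 'rV[R]_d := get (projection_set unit_ball x).

Definition euclidean_lipschitz D (L : R) h : Prop :=
  forall x y, D x -> D y -> `|h x - h y| <= L * enorm (x - y).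

Definition weakly_convex_on D (l : R) h : Prop :=
  convex_function D (fun z => h z + l / 2 * enorm z ^+ 2).

Definition strongly_convex_on D (m : R) h : Prop :=
  convex_function D (fun z => h z - m / 2 * enorm z ^+ 2).

Definition C1_on D h : Prop :=
  forall x, D x -> differentiable h x /\ {for x, continuous (grad h)}.

Definition frechet_subdiff h x : set 'rV[R]_d :=
  [set w | forall e : R, 0 < e ->
     \forall y \near x, h y >= h x + edot w (y - x) - e * enorm (y - x)].

Definition limiting_subdiff h x : set 'rV[R]_d :=
  [set w | exists (xs ws : nat -> 'rV[R]_d),
     [/\ forall n, frechet_subdiff h (xs n) (ws n),
         xs @ \oo --> x, h (xs n) @[n --> \oo] --> h x & ws @ \oo --> w]].

Section Envelope.
Variables (f : 'rV[R]_d -> R) (C : set 'rV[R]_d) (l : R).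

Definition prox_objective x y : R := f y + l * enorm (y - x) ^+ 2.

Definition envelope x : R := minval C (prox_objective x).

Definition prox_point x : 'rV[R]_d := get (argmin C (prox_objective x)).

Definition stationarity x : R := enorm (grad envelope x).

End Envelope.

End Euclidean.

Section Probability.
Context {R : realType} {d : nat} {dO dX : measure_display}
  {Omega : measurableType dO} {Xi : measurableType dX}.
Implicit Types (P : probability Omega R) (xi : nat -> Omega -> Xi).

Local Notation borel_rV := (g_sigma_algebraType (@open 'rV[R]_d)).

(* [Y] is a version of the conditional expectation of [X] given the
   sigma-algebra [<<s G >>]; such versions are determined up to null sets. *)
Definition is_cond_exp P (G : set (set Omega)) (X Y : Omega -> R) : Prop :=
  P.-integrable setT (EFin \o X) /\
  exists Z : Omega -> R,
    [/\ measurable_fun [set: g_sigma_algebraType G] Z,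
        P.-integrable setT (EFin \o Z),
        forall A, <<s G >> A ->
          (\int[P]_(w in A) (X w)%:E = \int[P]_(w in A) (Z w)%:E)%E
      & {ae P, forall w, Y w = Z w}].

(* Generators of the sigma-algebra of what is known before call number [n],
   the calls being numbered from 0 in order of time. *)
Definition past xi (n : nat) : set (set Omega) :=
  [set A | exists i, (i < n)%N /\ preimage_set_system setT (xi i) measurable A].

Definition whole_history xi : set (set Omega) :=
  [set A | exists i, preimage_set_system setT (xi i) measurable A].

(* [xi n] is the fresh randomness of call number [n], and the answer to that
   call at the point [x] is [vt x (xi n)]. *)
Definition stochastic_oracle P (D : set 'rV[R]_d) (f : 'rV[R]_d -> R) (Gf : R)
    (vt : 'rV[R]_d -> Xi -> 'rV[R]_d) (v : 'rV[R]_d -> 'rV[R]_d) xi : Prop :=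
  [/\ measurable_fun [set: borel_rV * Xi]
        (fun q : borel_rV * Xi => vt q.1 q.2 : borel_rV),
      forall n, measurable_fun setT (xi n),
      forall z, D z -> limiting_subdiff f z (v z)
    & forall n (x : Omega -> 'rV[R]_d),
        measurable_fun [set: g_sigma_algebraType (past xi n)]
          (x : g_sigma_algebraType (past xi n) -> borel_rV) ->
        (forall w, D (x w)) ->
        (forall i, is_cond_exp P (past xi n)
           (fun w => vt (x w) (xi n w) 0 i) (fun w => v (x w) 0 i)) /\
        {ae P, forall w, enorm (vt (x w) (xi n w)) <= Gf}].

Definition uniform_index P (I : seq nat) (J : Omega -> nat) : Prop :=
  measurable_fun setT J /\
  forall j, j \in I -> P (J @^-1` [set j]) = ((size I)%:R^-1)%:E.

Definition independent_index P xi (J : Omega -> nat) : Prop :=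
  forall A (E : set nat), <<s whole_history xi >> A ->
    (P (A `&` J @^-1` E) = P A * P (J @^-1` E))%E.

End Probability.

(* The algorithm is a computation that meters its stochastic subgradient calls
   and its projections onto C. *)
Record usage := Usage { calls : nat; projections : nat }.

Definition comp (A : Type) : Type := usage -> A * usage.

Definition ret {A} (a : A) : comp A := fun u => (a, u).

Definition bind {A B} (c : comp A) (k : A -> comp B) : comp B :=
  fun u => let: (a, u') := c u in k a u'.

Section Algorithm.
Context {R : realType} {d : nat} {Xi : Type}.
Variables (g : 'rV[R]_d -> R) (p : R -> R) (beta m : R) (T K : nat).
Variables (vt : 'rV[R]_d -> Xi -> 'rV[R]_d) (tape : nat -> Xi).
Variable projC : 'rV[R]_d -> 'rV[R]_d.
Implicit Types x z : 'rV[R]_d.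

Definition query z : comp 'rV[R]_d :=
  fun u => (vt z (tape (calls u)), Usage (calls u).+1 (projections u)).

Definition projectC z : comp 'rV[R]_d :=
  fun u => (projC z, Usage (calls u) (projections u).+1).

(* [n] further steps for the objective centred at [x], the next one being step
   number [s] from the point [z]; the result is the list of query points. *)
Fixpoint psm_loop x (n s : nat) z : comp (seq 'rV[R]_d) :=
  if n is n'.+1 then
    bind (query z) (fun w =>
      let eta := 2 / (m * s.+1%:R) in
      let h := w + beta *: (z - x) + grad (p \o g) z in
      bind (psm_loop x n' s.+1 (projB (z - eta *: h)))
           (fun zs => ret (z :: zs)))
  else ret [::].

Definition psm x : comp 'rV[R]_d :=
  bind (psm_loop x K 1 x) (fun zs => ret (K%:R^-1 *: \sum_(z <- zs) z)).

(* The [n] points that follow [x]. *)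
Fixpoint outer_loop (n : nat) x : comp (seq 'rV[R]_d) :=
  if n is n'.+1 then
    bind (psm x) (fun y => bind (outer_loop n' y) (fun xs => ret (y :: xs)))
  else ret [::].

(* [j] is the sampled index. *)
Definition penalized_psm x0 (j : nat) : comp 'rV[R]_d :=
  bind (outer_loop T x0) (fun xs => projectC (nth x0 (x0 :: xs) j)).

End Algorithm.

Definition penalized_objective {R : realType} {d : nat}
    (f g : 'rV[R]_d -> R) (p : R -> R) (beta : R) (x z : 'rV[R]_d) : R :=
  f z + p (g z) + beta / 2 * enorm (z - x) ^+ 2.

Section Constants.
Context {R : realType}.
Implicit Types l Gf Gg sigma Delta eps delta : R.

Definition softplus (gamma lambda u : R) : R :=
  gamma * ln (1 + expR (lambda * u / gamma)).

Definition lambda0 l Gf sigma : R := 2 * (Gf + 4 * l) / sigma.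

Definition G_F l Gf : R := Gf + 4 * l.

Definition G_H l Gf Gg sigma : R := G_F l Gf + lambda0 l Gf sigma * Gg.

Definition U_ (K : nat) (m G delta : R) : R :=
  (m + G ^+ 2 / m * (ln K.+1%:R + 2 * ln (1 / delta))) / K%:R.

Definition e_ l Gf Gg sigma (K : nat) delta : R :=
  U_ K l (G_H l Gf Gg sigma) delta + ln 2 / K%:R.

Definition e_star l Gf eps : R :=
  Num.min (eps ^+ 2 / (4000 * l)) (G_F l Gf * eps / (60 * l)).

(* The ceiling is nonnegative when [l] and [Delta] are, so that [absz] only
   turns it into a natural number. *)
Definition outer_steps l Delta eps : nat :=
  maxn 2 `|Num.ceil (1000 * l * Delta / eps ^+ 2)|%N.

Definition admissible l Gf Gg sigma Delta eps (K : nat) : Prop :=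
  (2 <= K)%N /\
  e_ l Gf Gg sigma K (1 / (6 * (outer_steps l Delta eps)%:R)) <= e_star l Gf eps.

(* [u] is bounded by [w] up to a factor polylogarithmic in [1 / eps], on the
   whole range [0 < eps <= 1]. *)
Definition soft_O (u w : R -> R) : Prop :=
  exists (A : R) (k : nat), forall eps, 0 < eps <= 1 ->
    `|u eps| <= A * (1 + ln (1 / eps)) ^+ k * w eps.

End Constants.

(* Main.v *)
Require Import Defs.
From HB Require Import structures.
From mathcomp Require Import all_boot all_order all_algebra.
From mathcomp Require Import ring lra.
From mathcomp Require Import all_classical all_reals all_analysis.
From mathcomp Require Import measurable_realfun.

Set Implicit Arguments.
Unset Strict Implicit.
Unset Printing Implicit Defensive.

Import Order.TTheory GRing.Theory Num.Theory.
Import numFieldNormedType.Exports.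

Local Open Scope classical_set_scope.
Local Open Scope ring_scope.

(** Why the method works.

    Exact penalization. The active gradients of [g] have length at least [sigma],
    so by convexity [g] grows at least like [sigma] times the distance to
    [C = {g <= 0}] ([error_bound]). With the slope [lambda0] the penalty thus
    outweighs the decrease of the proximal objective [f + l |. - x|^2] that can be
    gained by leaving [C] ([penalized_ge]), and the softplus costs at most
    [gamma ln 2] on [C]. Hence an approximate minimizer [z] of the penalized
    objective centred at [x], with error [u] relative to the exact constrained
    proximal point [Q x], is within a multiple of [u + gamma ln 2] of [C], and the
    penalized value [F = f + p o g] drops from [x] to [z] by
    [l / 2 |P_C x - Q x|^2] up to this error ([inexact_step]).

    Descent. Summing over the outer iterations bounds the sum of the
    [|P_C x_t - Q x_t|^2] ([descent_sum]). The stationarity measure of [P_C x_t] is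
    controlled by this distance and by the distance of [x_t] to [C]
    ([stationarity_proj_le]), so at most one sixth of the iterates have a projection
    that is not [eps]-stationary ([few_nonstationary]). This argument is
    deterministic; it applies to all runs in which every inner loop is accurate.

    Accuracy of an inner loop. The loop is compared with the point [Q x] itself, which is
    determined by its starting point [x], so that each direction [z_k - Q x] is
    known before the corresponding answer of the oracle. The usual telescoping for strongly convex objectives
    ([psm_regret]) spends half of the strong-convexity gain; the other half,
    [l / 4 |z_k - Q x|^2] per step, is weighed against the noise
    [<v_k - vt_k, z_k - Q x>]. Given the past, the noise is centred and of size at
    most [G_f |z_k - Q x|], so that Hoeffding's lemma makes the exponential of
    noise minus gain, suitably scaled, a supermartingale ([hoeffding_step]), and
    Markov's inequality bounds the accumulated difference by a multiple of
    [ln (1 / delta)] with probability at least [1 - delta] ([hoeffding_tail],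
    [psm_accuracy], [psm_tail]). Conditional expectations enter only through the
    vanishing of integrals against functions of the past ([cond_centred]).

    Sampling. With [delta = 1 / (6 T)] all inner loops are accurate with
    probability at least 5/6. The uniform index is independent of the run, hence the output
    fails to be [eps]-stationary with probability at most 1/6 + 1/6
    ([expected_nonstationary], [sampled_stationary]).

    The differentiability of the envelope and the formula for its gradient come
    from a two-sided quadratic bound on its increments, a consequence of the
    Lipschitz continuity of [Q] ([envelope_remainder]). The orders of [T] and [K]
    follow from the domination of logarithms by linear functions
    ([inner_steps_order]). *)

(** * Euclidean geometry of row vectors *)

Section NormedSpaces.
Context {R : realType} {V W : normedModType R}.

Lemma near_lipschitz_cvg (c : R) (F : V -> W) x :
  (\forall y \near x, `|F x - F y| <= c * `|x - y|) -> F y @[y --> x] --> F x.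
Proof.
move=> H; apply/cvgrPdist_lt => e e0.
have c0 : 0 < `|c| + 1 by rewrite ltr_wpDl.
near=> y; apply: (@le_lt_trans _ _ ((`|c| + 1) * `|x - y|)).
  apply: (@le_trans _ _ (c * `|x - y|)); first by near: y.
  by rewrite ler_wpM2r//; apply: ler_wpDr => //; exact: ler_norm.
rewrite mulrC -ltr_pdivlMr//; near: y.
by apply: cvgr_dist_lt => //; rewrite divr_gt0.
Unshelve. all: by end_near.
Qed.

Lemma quadratic_remainder_diff (h : V -> W) (L : {linear V -> W}) c x :
  continuous L ->
  (forall y, `|h (x + y) - h x - L y| <= c * `|y| ^+ 2) ->
  differentiable h x /\ 'd h x = L :> (V -> W).
Proof.
move=> cL H.
have e2 : h \o shift x = cst (h x) + L +o_ 0 id.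
  apply/eqaddoP => e e0 /=.
  have : \forall y \near (0 : V), `|c| * `|y| < e.
    have: `|c| * `|y| @[y --> (0 : V)] --> `|c| * `|0 : V|.
      by apply: cvgM; [exact: cvg_cst|exact: norm_continuous].
    by rewrite normr0 mulr0 => /cvgr_lt; apply.
  apply: filterS => y hy.
  rewrite -[X in `|X|]/(h (y + x) - (h x + L y)) opprD addrA [y + x]addrC.
  apply: le_trans (H y) _; rewrite expr2 mulrA ler_wpM2r//.
  by apply: ltW; apply: le_lt_trans hy; rewrite ler_wpM2r// ler_norm.
have e1 := diff_unique cL e2.
by split=> //; apply/diff_locallyP; rewrite e1; split.
Qed.

End NormedSpaces.

Section EuclideanGeometry.
Context {R : realType} {d : nat}.
Implicit Types (x y z w : 'rV[R]_d) (a b t : R).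

(** [edot] is made opaque below; this is the way back to coordinates. *)
Lemma edot_sumE x y : edot x y = \sum_(i < d) x 0 i * y 0 i.
Proof. by []. Qed.

Lemma edotC x y : edot x y = edot y x.
Proof. by apply: eq_bigr => i _; rewrite mulrC. Qed.

Lemma edotDl x y z : edot (x + y) z = edot x z + edot y z.
Proof.
by rewrite /edot -big_split /=; apply: eq_bigr => i _; rewrite mxE mulrDl.
Qed.

Lemma edotDr x y z : edot z (x + y) = edot z x + edot z y.
Proof. by rewrite edotC edotDl !(edotC z). Qed.

Lemma edotZl a x y : edot (a *: x) y = a * edot x y.
Proof. by rewrite /edot mulr_sumr; apply: eq_bigr => i _; rewrite mxE mulrA. Qed.

Lemma edotZr a x y : edot x (a *: y) = a * edot x y.
Proof. by rewrite edotC edotZl edotC. Qed.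

Lemma edotNl x y : edot (- x) y = - edot x y.
Proof. by rewrite -scaleN1r edotZl mulN1r. Qed.

Lemma edotNr x y : edot x (- y) = - edot x y.
Proof. by rewrite edotC edotNl edotC. Qed.

Lemma edot0l x : edot 0 x = 0.
Proof. by rewrite -(scale0r 0) edotZl mul0r. Qed.

Lemma edot0r x : edot x 0 = 0.
Proof. by rewrite edotC edot0l. Qed.

Definition edotE :=
  (edotDl, edotDr, edotNl, edotNr, edotZl, edotZr, edot0l, edot0r).

Lemma edot_ge0 x : 0 <= edot x x.
Proof. by apply: sumr_ge0 => i _; rewrite -expr2 sqr_ge0. Qed.

Lemma enorm_ge0 x : 0 <= enorm x.
Proof. exact: sqrtr_ge0. Qed.

Lemma sqr_enorm x : enorm x ^+ 2 = edot x x.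
Proof. by rewrite sqr_sqrtr// edot_ge0. Qed.

Lemma edot_eq0 x : edot x x = 0 -> x = 0.
Proof.
move=> /eqP; rewrite psumr_eq0; last by move=> i _; rewrite -expr2 sqr_ge0.
move=> /allP h; apply/rowP => i; rewrite mxE.
have := h i (mem_index_enum _); rewrite /= -expr2 sqrf_eq0.
by move/eqP.
Qed.

Lemma enorm_eq0 x : enorm x = 0 -> x = 0.
Proof. by move=> h; apply: edot_eq0; rewrite -sqr_enorm h expr0n. Qed.

Lemma enorm_gt0 x : x != 0 -> 0 < enorm x.
Proof.
by move=> x0; rewrite lt_neqAle enorm_ge0 andbT; apply: contra x0 => /eqP/esym/enorm_eq0 ->.
Qed.

Lemma enorm0 : enorm (0 : 'rV[R]_d) = 0.
Proof. by rewrite /enorm edot0l sqrtr0. Qed.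

Lemma enormZ a x : enorm (a *: x) = `|a| * enorm x.
Proof.
by rewrite /enorm !edotE mulrA -expr2 sqrtrM ?sqr_ge0// sqrtr_sqr.
Qed.

Lemma enormN x : enorm (- x) = enorm x.
Proof. by rewrite -scaleN1r enormZ normrN1 mul1r. Qed.

Lemma enormB x y : enorm (x - y) = enorm (y - x).
Proof. by rewrite -enormN opprB. Qed.

Lemma sqr_enorm_le x a : 0 <= a -> edot x x <= a ^+ 2 -> enorm x <= a.
Proof.
by move=> a0 h; rewrite -(@ler_pXn2r _ 2)// ?nnegrE ?enorm_ge0// sqr_enorm.
Qed.

(** Cauchy-Schwarz, from the nonnegativity of |b x - a y|^2 for a = |x| and
    b = |y|. *)
Lemma edot_le x y : edot x y <= enorm x * enorm y.
Proof.
have [->|x0] := eqVneq x 0; first by rewrite edot0l enorm0 mul0r.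
have [->|y0] := eqVneq y 0; first by rewrite edot0r enorm0 mulr0.
have := edot_ge0 (enorm y *: x - enorm x *: y).
rewrite !edotE -!sqr_enorm (edotC y x).
have := enorm_gt0 x0; have := enorm_gt0 y0.
set a := enorm x; set b := enorm y; set c := edot x y => b0 a0 h.
have ab0 : 0 < a * b by rewrite mulr_gt0.
have : 0 <= (a * b) * (a * b - c) by nra.
by rewrite pmulr_rge0// subr_ge0.
Qed.

Lemma normr_edot_le x y : `|edot x y| <= enorm x * enorm y.
Proof. by rewrite ler_norml lerNl -edotNl edot_le andbT -(enormN x) edot_le. Qed.

Lemma ler_enormD x y : enorm (x + y) <= enorm x + enorm y.
Proof.
apply: sqr_enorm_le; first by rewrite addr_ge0 ?enorm_ge0.
have := edot_le x y; rewrite !edotE (edotC y x) -!sqr_enorm => h.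
nra.
Qed.

Lemma ler_enorm_dist z x y : enorm (x - y) <= enorm (x - z) + enorm (z - y).
Proof. by rewrite -[x - y](subrKA z); exact: ler_enormD. Qed.

Lemma unit_ball_dist x y : unit_ball x -> unit_ball y -> enorm (x - y) <= 2.
Proof.
rewrite /unit_ball /= => hx hy; have := ler_enormD x (- y); rewrite enormN; lra.
Qed.

Lemma convex_functionP (D : set 'rV[R]_d) (h : 'rV[R]_d -> R) :
  convex_function D h <->
  (forall t x y, 0 <= t <= 1 -> D x -> D y ->
     h (t *: x + (1 - t) *: y) <= t * h x + (1 - t) * h y).
Proof.
split=> [H t x y /andP[t0 t1] Dx Dy|H t x y Dx Dy].
  exact: (H (Itv01 t0 t1) x y (mem_set Dx) (mem_set Dy)).
by apply: H; [rewrite ge0 le1|exact: set_mem|exact: set_mem].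
Qed.

Lemma convex_setP (D : set 'rV[R]_d) :
  convex_set D <->
  (forall t x y, 0 <= t <= 1 -> D x -> D y -> D (t *: x + (1 - t) *: y)).
Proof.
split=> [H t x y /andP[t0 t1] Dx Dy|H x y t Dx Dy].
  exact: (set_mem (H x y (Itv01 t0 t1) (mem_set Dx) (mem_set Dy))).
by apply/mem_set; apply: H; [rewrite ge0 le1|exact: set_mem|exact: set_mem].
Qed.

Lemma unit_ball_convex : convex_set (@unit_ball R d).
Proof.
apply/convex_setP => t x y /andP[t0 t1]; rewrite /unit_ball /= => hx hy.
apply: le_trans (ler_enormD _ _) _; rewrite !enormZ !ger0_norm ?subr_ge0//.
nra.
Qed.

Lemma sqr_enorm_conv t x y :
  enorm (t *: x + (1 - t) *: y) ^+ 2 =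
  t * enorm x ^+ 2 + (1 - t) * enorm y ^+ 2 - t * (1 - t) * enorm (x - y) ^+ 2.
Proof. rewrite !sqr_enorm !edotE (edotC y x); ring. Qed.

Lemma conv_dist t x y z :
  t *: x + (1 - t) *: y - z = t *: (x - z) + (1 - t) *: (y - z).
Proof. by apply/rowP => i; rewrite !mxE; ring. Qed.

(** * The Euclidean topology *)

Lemma coord_le_enorm x i : `|x 0 i| <= enorm x.
Proof.
rewrite -sqrtr_sqr ler_sqrt ?edot_ge0// /edot (bigD1 i)//= -expr2 lerDl.
by apply: sumr_ge0 => j _; rewrite -expr2 sqr_ge0.
Qed.

Lemma coord_le_norm x i : `|x 0 i| <= `|x|.
Proof.
by rewrite [leRHS]/Num.norm /= mx_normrE; apply/bigmax_geP; right => /=; exists (0, i).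
Qed.

(** The Euclidean norm is equivalent to the sup norm, which carries the topology;
    this is what transfers the Lipschitz and second-order bounds below. *)
Lemma norm_le_enorm x : `|x| <= enorm x.
Proof.
rewrite [leLHS]/Num.norm /= mx_normrE; apply/bigmax_leP; split; first exact: enorm_ge0.
by case=> i j _ /=; rewrite (ord1 i); exact: coord_le_enorm.
Qed.

Lemma enorm_le_norm x : enorm x <= Num.sqrt d%:R * `|x|.
Proof.
apply: sqr_enorm_le; first by rewrite mulr_ge0// sqrtr_ge0.
rewrite exprMn sqr_sqrtr// -[d in d%:R]card_ord -sumr_const mulr_suml.
apply: ler_sum => i _; rewrite mul1r -expr2 -real_normK ?num_real//.
by rewrite lerXn2r ?nnegrE// coord_le_norm.
Qed.

Lemma edot_cvg (T : Type) (F : set_system T) (FF : Filter F)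
    (u v : T -> 'rV[R]_d) x y :
  u @ F --> x -> v @ F --> y -> edot (u t) (v t) @[t --> F] --> edot x y.
Proof.
move=> ux vy; rewrite /edot; apply: cvg_big => [|i _]; first exact: add_continuous.
apply: cvgM.
  by apply: (@cvg_comp _ _ _ u (fun z => z 0 i) F (nbhs x)) => //; exact: coord_continuous.
by apply: (@cvg_comp _ _ _ v (fun z => z 0 i) F (nbhs y)) => //; exact: coord_continuous.
Qed.

Lemma enorm_cvg (T : Type) (F : set_system T) (FF : Filter F)
    (u : T -> 'rV[R]_d) x :
  u @ F --> x -> enorm (u t) @[t --> F] --> enorm x.
Proof.
move=> ux; rewrite /enorm.
have h := edot_cvg FF ux ux.
have := @continuous_cvg _ _ _ F FF _ (@Num.sqrt R) _ (@sqrt_continuous R _) h.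
exact.
Qed.

Lemma enorm_continuous : continuous (@enorm R d).
Proof. by move=> x; apply: (enorm_cvg (nbhs_filter x)); exact: cvg_id. Qed.

Lemma lipschitz_continuous (c : R) (F : 'rV[R]_d -> 'rV[R]_d) :
  (forall x y, enorm (F x - F y) <= c * enorm (x - y)) -> continuous F.
Proof.
move=> H x; apply: (@near_lipschitz_cvg _ _ _ (`|c| * Num.sqrt d%:R)).
apply: (@filterE _ (nbhs x) (nbhs_filter x)) => y; apply: le_trans (norm_le_enorm _) _; apply: le_trans (H _ _) _.
apply: (@le_trans _ _ (`|c| * enorm (x - y))).
  by rewrite ler_wpM2r ?enorm_ge0// ler_norm.
by rewrite -mulrA ler_wpM2l// enorm_le_norm.
Qed.

Lemma euclidean_lipschitz_continuous (D : set 'rV[R]_d) (L : R) h x :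
  open D -> D x -> euclidean_lipschitz D L h -> {for x, continuous h}.
Proof.
move=> oD Dx H; apply: (@near_lipschitz_cvg _ _ _ (`|L| * Num.sqrt d%:R)).
have : nbhs x D by exact: open_nbhs_nbhs.
apply: filterS => y Dy; apply: le_trans (H x y Dx Dy) _.
apply: (@le_trans _ _ (`|L| * enorm (x - y))).
  by rewrite ler_wpM2r ?enorm_ge0// ler_norm.
by rewrite -mulrA ler_wpM2l// enorm_le_norm.
Qed.

Lemma unit_ball_closed : closed (@unit_ball R d).
Proof.
by apply: (@preimage_closed _ _ (@enorm R d) [set t | t <= 1]) => [x _|]; [exact: enorm_continuous|exact: closed_le].
Qed.

Lemma closed_sub_ball_compact (C : set 'rV[R]_d) :
  closed C -> C `<=` unit_ball -> compact C.
Proof.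
move=> cC CB; apply: bounded_closed_compact => //.
exists 1; split; first exact: num_real.
move=> M M1 x /CB; rewrite /unit_ball /= => hx.
by apply: le_trans (norm_le_enorm _) _; apply: le_trans hx _; exact: ltW.
Qed.

Lemma edot_linear w : linear (edot w).
Proof. by move=> a x y; rewrite edotDr edotZr. Qed.

HB.instance Definition _ w := GRing.isLinear.Build R 'rV[R]_d R *%R (edot w) (edot_linear w).

Lemma edot_continuous w : continuous (edot w).
Proof. by move=> x; apply: (edot_cvg (nbhs_filter x)); [exact: cvg_cst|exact: cvg_id]. Qed.

Lemma edot_delta w i : edot w (delta_mx 0 i) = w 0 i.
Proof.
rewrite /edot (bigD1 i)//= big1 ?addr0 ?mxE ?eqxx ?mulr1// => j ji.
by rewrite mxE (negbTE ji) mulr0.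
Qed.

Lemma grad_diff (h : 'rV[R]_d -> R) x v :
  differentiable h x -> 'd h x v = edot (grad h x) v.
Proof.
move=> dh; rewrite {1}(row_sum_delta v) linear_sum /edot.
by apply: eq_bigr => i _; rewrite linearZ /= mxE deriveE// mulrC.
Qed.

(** A two-sided second-order bound on the remainder identifies the
    differential. *)
Lemma quadratic_remainder (h : 'rV[R]_d -> R) x w c :
  (forall y, `|h (x + y) - h x - edot w y| <= c * enorm y ^+ 2) ->
  differentiable h x /\ grad h x = w.
Proof.
move=> H.
have [] := @quadratic_remainder_diff _ _ _ h (edot w) (`|c| * Num.sqrt d%:R ^+ 2) x (@edot_continuous w).
  move=> y; apply: le_trans (H y) _.
  apply: (@le_trans _ _ (`|c| * enorm y ^+ 2)).
    by rewrite ler_wpM2r ?sqr_ge0// ler_norm.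
  rewrite -mulrA -exprMn ler_wpM2l// lerXn2r// ?nnegrE ?enorm_ge0 ?enorm_le_norm//.
move=> dh e1.
split=> //; apply/rowP => i.
by rewrite mxE deriveE// e1; exact: edot_delta.
Qed.

End EuclideanGeometry.

Local Opaque edot enorm.

(** * Proximal points of weakly convex functions *)

Section RealLemmas.
Context {R : realType}.
Implicit Types u v : R.

(** Removes the factor [1 - t] that convexity along a segment leaves behind, by
    letting [t] tend to 0. *)
Lemma le_of_onem u v : (forall t, 0 < t < 1 -> u * (1 - t) <= v) -> u <= v.
Proof.
move=> H; rewrite leNgt; apply/negP => vu.
have h2 : u * (1 - 2^-1) <= v by apply: H; lra.
have u0 : 0 < u by nra.
have := H ((u - v) / (2 * u)).
have e : u * (1 - (u - v) / (2 * u)) = (u + v) / 2 by field; rewrite gt_eqF.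
rewrite e => /(_ _) h; have : (u + v) / 2 <= v; last lra.
apply: h; rewrite divr_gt0 ?subr_gt0 ?mulr_gt0//=.
by rewrite ltr_pdivrMr ?mulr_gt0//; lra.
Qed.

(** The arithmetic of [envelope_remainder]: [o] and [o'] are the values of the
    objective at the two minimizers, [u] and [u'] the linear terms and [r] the
    squared length of the displacement. *)
Fact two_sided_remainder b : 0 < b -> forall k u u' r o o' : R,
  0 <= k -> o <= o' -> 0 <= r ->
  o' + 2 * b * u' + b * r <= o + 2 * b * u + b * r ->
  `|u - u'| <= k * r ->
  `|o' + 2 * b * u' + b * r - o - 2 * b * u| <= (2 * b * k + b) * r.
Proof.
move=> b0 k u u' r o o' k0 oo r0 h; rewrite !ler_norml => /andP[h1 h2].
have h3 : b * (u - u') <= b * (k * r) by rewrite ler_pM2l.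
have h4 : 0 <= b * (k * r) by apply: mulr_ge0; [exact: ltW|exact: mulr_ge0].
have h5 : 0 <= b * r by apply: mulr_ge0 => //; exact: ltW.
have -> : (2 * b * k + b) * r = 2 * (b * (k * r)) + b * r by ring.
rewrite mulrBr in h3; rewrite -!mulrA in h *.
move: oo h h3 h4 h5; move: (b * (k * r)) (b * u) (b * u') (b * r) => A B B' D.
clear => oo h h3 h4 h5.
by apply/andP; split; lra.
Qed.

Lemma minval_argmin (d : nat) (D : set 'rV[R]_d) (h : 'rV[R]_d -> R) y :
  argmin D h y -> minval D h = h y.
Proof.
move=> [Dy hy]; apply/eqP; rewrite eq_le; apply/andP; split.
  apply: ge_inf; last by exists y.
  by exists (h y) => _ [z Dz <-]; exact: hy.
apply: lb_le_inf; first by exists (h y), y.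
by move=> _ [z Dz <-]; exact: hy.
Qed.

End RealLemmas.

Lemma weakly_convexP (R : realType) (d : nat) (D : set 'rV[R]_d) (l : R)
    (h : 'rV[R]_d -> R) :
  weakly_convex_on D l h <->
  (forall t x y, 0 <= t <= 1 -> D x -> D y ->
     h (t *: x + (1 - t) *: y) <=
     t * h x + (1 - t) * h y + l / 2 * (t * (1 - t) * enorm (x - y) ^+ 2)).
Proof.
rewrite /weakly_convex_on convex_functionP.
by split=> H t x y t01 Dx Dy; have := H t x y t01 Dx Dy; rewrite sqr_enorm_conv;
  set A := enorm x ^+ 2; set B := enorm y ^+ 2; set E := enorm (x - y) ^+ 2; lra.
Qed.

Section Prox.
Context {R : realType} {d : nat}.
Variables (f : 'rV[R]_d -> R) (C : set 'rV[R]_d) (a b : R).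
Hypothesis b0 : 0 < b.
Hypothesis ab : a < 2 * b.
Hypothesis cvxC : convex_set C.
Hypothesis compC : compact C.
Hypothesis C0 : C !=set0.
Hypothesis fcont : forall x, C x -> {for x, continuous f}.
Hypothesis fwc : weakly_convex_on C a f.
Implicit Types x y z h : 'rV[R]_d.

Let c := b - a / 2.
Let c0 : 0 < c. Proof. by rewrite subr_gt0 ltr_pdivrMr// mulrC. Qed.
Local Notation obj := (prox_objective f b).
Local Notation Q := (prox_point f C b).

(** Compare the minimizer with the points of the segment that leads to [z], and
    let these tend to the minimizer. *)
Lemma prox_growth x y z : argmin C (obj x) y -> C z ->
  obj x y + (b - a / 2) * enorm (z - y) ^+ 2 <= obj x z.
Proof.
move=> [Cy miny] Cz; rewrite -lerBrDl; apply: le_of_onem => t /andP[t0 t1].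
have t01 : 0 <= t <= 1 by rewrite !ltW.
have Cw : C (t *: z + (1 - t) *: y) by exact: (convex_setP C).1.
have := miny _ Cw; have := (weakly_convexP C a f).1 fwc t z y t01 Cz Cy.
rewrite /prox_objective conv_dist sqr_enorm_conv.
rewrite (_ : z - x - (y - x) = z - y); last by rewrite opprB addrA subrK.
set A := enorm _ ^+ 2; set B := enorm (z - x) ^+ 2; set E := enorm (y - x) ^+ 2.
set F := f _ => h1 h2.
rewrite -(ler_pM2l t0); move: h1 h2; nra.
Qed.

Lemma prox_objective_continuous x y : C y -> {for y, continuous (obj x)}.
Proof.
move=> Cy; have h := fcont Cy; rewrite /prox_objective.
apply: (@cvgD _ _ _ (nbhs y) (nbhs_filter y) f) => //.
apply: cvgM; first exact: cvg_cst.
rewrite (_ : (fun z => _) = fun z => edot (z - x) (z - x)); last first.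
  by apply/funext => z; rewrite sqr_enorm.
rewrite sqr_enorm; apply: (edot_cvg (nbhs_filter y));
  by apply: cvgB; [exact: cvg_id|exact: cvg_cst].
Qed.

Lemma prox_pointP x : argmin C (obj x) (Q x).
Proof.
have [|y /set_mem Cy miny] := @compact_EVT_min _ R (obj x) C C0 compC.
  by apply: continuous_in_subspaceT => y /set_mem; exact: prox_objective_continuous.
apply: (@getPex _ (argmin C (obj x))); exists y; split=> // z Cz.
by apply: miny; exact: mem_set.
Qed.

Lemma prox_point_in x : C (Q x). Proof. by have [] := prox_pointP x. Qed.

Lemma prox_point_growth x z : C z ->
  obj x (Q x) + (b - a / 2) * enorm (z - Q x) ^+ 2 <= obj x z.
Proof. by apply: prox_growth; exact: prox_pointP. Qed.

Lemma prox_point_unique x y : argmin C (obj x) y -> y = Q x.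
Proof.
move=> [Cy miny]; apply/eqP; rewrite -subr_eq0; apply/eqP/enorm_eq0/eqP.
rewrite -sqrf_eq0 eq_le sqr_ge0 andbT -(ler_pM2l c0) mulr0.
have := prox_point_growth x Cy; have := miny _ (prox_point_in x).
rewrite -/c; lra.
Qed.

(** Add the growth inequalities of the two proximal points, each tested at the
    other one. *)
Lemma prox_point_lipschitz x y :
  enorm (Q x - Q y) <= b / (b - a / 2) * enorm (x - y).
Proof.
have := prox_point_growth x (prox_point_in y).
have := prox_point_growth y (prox_point_in x).
rewrite /prox_objective -/c; move: (Q x) (Q y) => X Y; rewrite (enormB Y X) => h1 h2.
have h3 : b * edot (X - Y) (x - y) >= c * enorm (X - Y) ^+ 2.
  move: h1 h2; rewrite !sqr_enorm !edotE.
  rewrite ?(edotC Y X) ?(edotC Y x) ?(edotC Y y) ?(edotC X x) ?(edotC X y) ?(edotC y x).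
  lra.
have [->|q0] := eqVneq (X - Y) 0.
  by rewrite enorm0 mulr_ge0 ?enorm_ge0// divr_ge0 ?ltW.
have := edot_le (X - Y) (x - y); have := enorm_gt0 q0.
rewrite mulrAC ler_pdivlMr//; move: h3.
set D := enorm _; set E := enorm _ => h3 D0 h4.
rewrite -(ler_pM2l D0) mulrA -expr2 mulrC (le_trans h3)//.
by rewrite [leRHS]mulrCA ler_pM2l.
Qed.

Lemma prox_point_continuous : continuous Q.
Proof. exact: lipschitz_continuous prox_point_lipschitz. Qed.

Lemma envelopeE x : envelope f C b x = obj x (Q x).
Proof. exact: minval_argmin (prox_pointP x). Qed.

(** The envelope at [x + h] is bounded above by the value at [Q x], and the one
    at [x] by the value at [Q (x + h)]; the two quadratics differ by an affine
    function of [h] up to a second-order term since [Q] is Lipschitz. *)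
Lemma envelope_remainder x h :
  `|envelope f C b (x + h) - envelope f C b x - edot ((2 * b) *: (x - Q x)) h| <=
  (2 * b * (b / (b - a / 2)) + b) * enorm h ^+ 2.
Proof.
rewrite !envelopeE; set q := Q x; set q' := Q (x + h).
have h1 : obj (x + h) q' <= obj (x + h) q.
  by have [_] := prox_pointP (x + h); apply; exact: prox_point_in.
have h2 : obj x q <= obj x q'.
  by have [_] := prox_pointP x; apply; exact: prox_point_in.
have h3 : enorm (q' - q) <= b / c * enorm h.
  have := prox_point_lipschitz (x + h) x.
  by rewrite (_ : x + h - x = h)// addrAC subrr add0r.
clearbody q q'.
have h4 := normr_edot_le (q' - q) h.
have h5 : `|edot (q' - q) h| <= b / c * enorm h ^+ 2.
  apply: le_trans h4 _; rewrite expr2 mulrA.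
  by apply: ler_wpM2r h3; exact: enorm_ge0.
have e u : obj (x + h) u = obj x u + 2 * b * edot (x - u) h + b * enorm h ^+ 2.
  rewrite /prox_objective !sqr_enorm !edotE (edotC h) (edotC x u) (edotC h x).
  ring.
move: h1 h5; rewrite !e edotZl.
have -> : edot (q' - q) h = edot (x - q) h - edot (x - q') h.
  by rewrite -edotNl -edotDl opprB [x - q + _]addrC subrKA.
have := sqr_ge0 (enorm h); move: h2; rewrite -/c.
have : 0 <= b / c by rewrite divr_ge0 ?ltW.
move: (b / c) (edot _ h) (edot _ h) (enorm h ^+ 2) (obj x q) (obj x q').
move: b b0; clear; exact: two_sided_remainder.
Qed.

Lemma stationarityE x :
  differentiable (envelope f C b) x /\
  stationarity f C b x = 2 * b * enorm (x - Q x).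
Proof.
have [dE gE] := quadratic_remainder (envelope_remainder x).
by split=> //; rewrite /stationarity gE enormZ gtr0_norm// mulr_gt0.
Qed.

End Prox.

(** * Euclidean projections as proximal points of the zero function *)

Section Projection.
Context {R : realType} {d : nat}.
Variable C : set 'rV[R]_d.
Hypothesis cvxC : convex_set C.
Hypothesis compC : compact C.
Hypothesis C0 : C !=set0.
Implicit Types x y z : 'rV[R]_d.

Definition eproj x : 'rV[R]_d := prox_point (fun=> 0) C 1 x.

Let lt02 : 0 < 2 * 1 :> R. Proof. by rewrite mulr1. Qed.

Let wc0 : weakly_convex_on C 0 (fun=> 0).
Proof. apply/weakly_convexP => t x y _ _ _; lra. Qed.

Let cont0 x : C x -> {for x, continuous (fun=> 0 : R)}.
Proof. by move=> _; exact: cst_continuous. Qed.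

Lemma projection_setE x :
  projection_set C x = argmin C (prox_objective (fun=> 0) 1 x).
Proof.
apply/seteqP; split => y [Cy miny]; split=> // z Cz; have := miny z Cz.
  by rewrite /prox_objective !add0r !mul1r ler_pXn2r ?nnegrE ?enorm_ge0.
by rewrite /prox_objective !add0r !mul1r ler_pXn2r ?nnegrE ?enorm_ge0.
Qed.

Lemma eproj_in x : C (eproj x).
Proof. exact: prox_point_in. Qed.

Lemma eproj_unique x y : projection_set C x y -> y = eproj x.
Proof.
by rewrite projection_setE; exact: (prox_point_unique lt02 cvxC compC C0 cont0 wc0).
Qed.

(** Pythagoras' inequality. *)
Lemma eproj_growth x z : C z ->
  enorm (eproj x - x) ^+ 2 + enorm (z - eproj x) ^+ 2 <= enorm (z - x) ^+ 2.
Proof.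
move=> Cz; have := prox_point_growth 1 cvxC compC C0 cont0 wc0 x Cz.
by rewrite /prox_objective -/(eproj x); lra.
Qed.

Lemma eproj_closest x z : C z -> enorm (eproj x - x) <= enorm (z - x).
Proof.
move=> Cz; rewrite -(@ler_pXn2r _ 2)// ?nnegrE ?enorm_ge0//.
by have := eproj_growth x Cz; have := sqr_ge0 (enorm (z - eproj x)); lra.
Qed.

Lemma eproj_id x : C x -> eproj x = x.
Proof.
move=> Cx; have := eproj_closest x Cx; rewrite subrr enorm0 => h.
by apply/eqP; rewrite -subr_eq0; apply/eqP/enorm_eq0/eqP; rewrite eq_le h enorm_ge0.
Qed.

Lemma eproj_continuous : continuous eproj.
Proof. exact: (prox_point_continuous ltr01 lt02 cvxC compC C0 cont0 wc0). Qed.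

End Projection.

Lemma projBE (R : realType) (d : nat) : @projB R d = eproj unit_ball.
Proof. by apply/funext => x; rewrite /projB projection_setE. Qed.

(** * Subgradients *)

Section Subgradients.
Context {R : realType} {d : nat}.
Implicit Types (x y z u v w : 'rV[R]_d) (h : 'rV[R]_d -> R) (U : set 'rV[R]_d).

Lemma ray_cvg x u : x + t *: u @[t --> 0^'+] --> x.
Proof.
rewrite -[X in _ --> X]addr0 -(scale0r u); apply: cvgD; first exact: cvg_cst.
by apply: cvgZr_tmp; apply: cvg_within_filter; exact: cvg_id.
Qed.

Lemma ray_near x u (A : set 'rV[R]_d) :
  (\forall y \near x, A y) -> exists t, [/\ 0 < t, t < 1 & A (x + t *: u)].
Proof.
move=> /(ray_cvg u) nA.
have [t [[t0 At] t1]] : exists t, ((0 < t) /\ A (x + t *: u)) /\ (t < 1).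
  apply: (@filter_ex _ (0 : R)^'+); near=> t; split; first split.
  - by near: t; exact: nbhs_right_gt.
  - by near: t; exact: nA.
  - by near: t; exact: nbhs_right_lt.
by exists t.
Unshelve. all: by end_near.
Qed.

(** On the segment from [x] towards [y], the Frechet inequality bounds [h] from
    below near [x] while weak convexity bounds it from above through [h y]; divide
    by the step. *)
Lemma frechet_subdiff_ineq U (l : R) h x y w :
  0 <= l -> weakly_convex_on U l h -> U x -> U y -> frechet_subdiff h x w ->
  h x + edot w (y - x) - l / 2 * enorm (y - x) ^+ 2 <= h y.
Proof.
move=> l0 /weakly_convexP wc Ux Uy hw; apply/ler_addgt0Pr => e e0.
have e'0 : 0 < e / (enorm (y - x) + 1).
  by rewrite divr_gt0// ltr_wpDl ?enorm_ge0.
have [t [t0 t1]] := ray_near (y - x) (hw _ e'0).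
have t01 : 0 <= t <= 1 by rewrite !ltW.
have := wc t y x t01 Uy Ux.
have -> : t *: y + (1 - t) *: x = x + t *: (y - x).
  by apply/rowP => i; rewrite !mxE; ring.
rewrite /= [x + _ - x]addrAC subrr add0r edotZr enormZ gtr0_norm//.
have : e / (enorm (y - x) + 1) * enorm (y - x) <= e.
  rewrite mulrAC ler_pdivrMr ?ltr_wpDl ?enorm_ge0//.
  by rewrite ler_pM2l// lerDl.
have := sqr_ge0 (enorm (y - x)).
move: (h (x + _)) (edot _ _) (enorm _ ^+ 2) => H D N N0.
rewrite [_ * (t * _)]mulrCA; move: (e / _ * _) => E hE h1 h2.
have h3 : t * (h x + D - l / 2 * N) <= t * (h y + e).
  have h4 : t * (l / 2 * (t * N)) >= 0.
    by rewrite !mulr_ge0// ?divr_ge0 ?ltW.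
  have h5 : t * E <= t * e by rewrite ler_pM2l.
  have h6 : l / 2 * (t * (1 - t) * N) = t * (l / 2 * N) - t * (l / 2 * (t * N)).
    by ring.
  rewrite {}h6 in h1; move: h1 h2 h4 h5; clear.
  rewrite !(mulrBl, mulrDr, mulrBr, mulrN, mul1r).
  move: (t * _ ) (t * _) (t * _) (t * _) => *; lra.
by rewrite ler_pM2l in h3.
Qed.

(** A short step in the direction [w] itself raises [h] at the rate [enorm w], up
    to an arbitrarily small error. *)
Lemma frechet_subdiff_le U (G : R) h x w :
  0 <= G -> open U -> U x -> euclidean_lipschitz U G h ->
  frechet_subdiff h x w -> enorm w <= G.
Proof.
move=> G0 oU Ux lip hw; apply/ler_addgt0Pr => e e0.
have [->|/enorm_gt0 w0] := eqVneq w 0; first by rewrite enorm0; exact: addr_ge0 G0 (ltW e0).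
have nU : \forall y \near x, U y by exact: open_nbhs_nbhs.
have [t [t0 t1]] := ray_near w (filterI nU (hw e e0)).
move=> [Uy] /=; have := lip _ _ Uy Ux; have := ler_norm (h (x + t *: w) - h x).
rewrite [x + _ - x]addrAC subrr add0r edotZr enormZ (gtr0_norm t0).
move=> h1 h2; rewrite -sqr_enorm => h3; rewrite -(ler_pM2l (mulr_gt0 t0 w0)).
move: h1 h2 h3; rewrite expr2 mulrA mulrDr [G * _]mulrC [e * _]mulrC.
move: (t * _) (h _) => *; lra.
Qed.

(** The inequality of [frechet_subdiff_ineq] passes to the limit, because the
    limiting subdifferential asks for convergence of the values too. *)
Lemma limiting_subdiff_ineq U (l : R) h x y v :
  0 <= l -> weakly_convex_on U l h -> open U -> U x -> U y ->
  limiting_subdiff h x v ->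
  h x + edot v (y - x) - l / 2 * enorm (y - x) ^+ 2 <= h y.
Proof.
move=> l0 wc oU Ux Uy [xs [ws [hf cx ch cw]]].
have nU : \forall n \near \oo, U (xs n) by apply: cx; exact: open_nbhs_nbhs.
have cd : y - xs n @[n --> \oo] --> y - x by apply: cvgB => //; exact: cvg_cst.
have cl : h (xs n) + edot (ws n) (y - xs n) -
      l / 2 * edot (y - xs n) (y - xs n) @[n --> \oo] -->
    h x + edot v (y - x) - l / 2 * edot (y - x) (y - x).
  apply: cvgB; first by apply: cvgD => //; exact: edot_cvg.
  by apply: cvgM; [exact: cvg_cst|exact: edot_cvg].
rewrite sqr_enorm; apply: (cvgr_to_le cl).
apply: filterS nU => n Un; rewrite -sqr_enorm.
exact: frechet_subdiff_ineq wc Un Uy (hf n).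
Qed.

Lemma limiting_subdiff_le U (G : R) h x v :
  0 <= G -> open U -> U x -> euclidean_lipschitz U G h ->
  limiting_subdiff h x v -> enorm v <= G.
Proof.
move=> G0 oU Ux lip [xs [ws [hf cx ch cw]]].
have nU : \forall n \near \oo, U (xs n) by apply: cx; exact: open_nbhs_nbhs.
have cl : enorm (ws n) @[n --> \oo] --> enorm v by exact: enorm_cvg.
apply: (cvgr_to_le cl); apply: filterS nU => n Un.
exact: frechet_subdiff_le G0 oU Un lip (hf n).
Qed.

Lemma diff_remainder h x (e : R) : differentiable h x -> 0 < e ->
  \forall y \near x, `|h y - h x - edot (grad h x) (y - x)| <= e * enorm (y - x).
Proof.
move=> dh e0; have /diff_locallyP[_ /eqaddoP/(_ e e0)] := dh.
move=> H; rewrite (near_shift 0 x) /=; apply: filterS H => y.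
rewrite subr0 /= addrK => hy.
apply: le_trans (_ : e * `|y| <= _); last by rewrite ler_pM2l// norm_le_enorm.
apply: le_trans hy; rewrite -grad_diff// le_eqVlt; apply/orP; left; apply/eqP.
congr (`|_|); rewrite -[RHS]/(h (y + x) - (h x + 'd h x y)).
by rewrite opprD addrA.
Qed.

Lemma grad_frechet_subdiff h x : differentiable h x -> frechet_subdiff h x (grad h x).
Proof.
move=> dh e e0; apply: filterS (diff_remainder dh e0) => y.
by rewrite ler_norml => /andP[h1 _]; lra.
Qed.

Lemma convex_grad_ineq U h x y :
  convex_function U h -> differentiable h x -> U x -> U y ->
  h x + edot (grad h x) (y - x) <= h y.
Proof.
move=> cvx dh Ux Uy.
have wc : weakly_convex_on U 0 h.
  apply/weakly_convexP => t u v t01 Uu Uv.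
  by have := (convex_functionP U h).1 cvx t u v t01 Uu Uv; lra.
have := frechet_subdiff_ineq (lexx 0) wc Ux Uy (grad_frechet_subdiff dh).
by rewrite !mul0r subr0.
Qed.

End Subgradients.

(** * The softplus penalty *)

Section Softplus.
Context {R : realType}.
Variables gam lam : R.
Hypothesis gam0 : 0 < gam.
Hypothesis lam0 : 0 < lam.
Implicit Types u v t : R.
Local Notation p := (softplus gam lam).

Let den u : R := 1 + expR (lam * u / gam).
Let den_gt0 u : 0 < den u. Proof. by rewrite addr_gt0// expR_gt0. Qed.

(** The derivative of the penalty, a rescaled logistic function. *)
Definition softplus_slope u : R :=
  lam * (expR (lam * u / gam) / (1 + expR (lam * u / gam))).
Local Notation q := softplus_slope.

Lemma softplus_slope_ge0 u : 0 <= q u.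
Proof. by rewrite mulr_ge0 ?divr_ge0 ?expR_ge0// ltW// den_gt0. Qed.

Lemma softplus_slope_le u : q u <= lam.
Proof.
rewrite ger_pMr// ler_pdivrMr ?den_gt0// mul1r lerDr//.
Qed.

Lemma softplus_slope_continuous : continuous q.
Proof.
have ce : continuous (fun u => expR (lam * u / gam)).
  move=> u; apply: (@continuous_comp _ _ _ (fun u => lam * u / gam) expR); last exact: continuous_expR.
  by apply: cvgM; [apply: cvgM; [exact: cvg_cst|exact: cvg_id]|exact: cvg_cst].
move=> u; apply: cvgM; first exact: cvg_cst.
apply: cvgM; first exact: ce.
by apply: cvgV; [rewrite gt_eqF ?den_gt0|apply: cvgD; [exact: cvg_cst|exact: ce]].
Qed.

Lemma is_derive_softplus u : is_derive u 1 p (q u).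
Proof.
have d1 : is_derive u 1 (fun v => lam * v / gam) (lam / gam).
  rewrite (_ : (fun v => _) = (lam / gam) \*: id); last first.
    by apply/funext => v /=; rewrite mulrAC.
  by apply: is_derive_eq; rewrite /GRing.scale /= mulr1.
have d2 : is_derive u 1 (fun v => expR (lam * v / gam)) ((lam / gam) * expR (lam * u / gam)).
  rewrite [X in is_derive _ _ _ X]mulrC.
  exact: (@is_derive1_comp _ expR (fun v => lam * v / gam)).
have d3 : is_derive u 1 (fun v => 1 + expR (lam * v / gam)) ((lam / gam) * expR (lam * u / gam)).
  rewrite (_ : (fun v => _) = cst 1 + (fun v => expR (lam * v / gam)))//.
  by apply: is_derive_eq; rewrite add0r.
have d4 : is_derive u 1 (@ln R \o den) ((den u)^-1 * ((lam / gam) * expR (lam * u / gam))).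
  by apply: is_derive1_comp; exact: is_derive1_ln.
rewrite (_ : p = gam \*: (@ln R \o den))//.
apply: is_derive_eq; rewrite /GRing.scale /= /softplus_slope -/(den u).
by field; rewrite !gt_eqF ?den_gt0.
Qed.

Lemma softplus_ge0 u : 0 <= p u.
Proof.
by apply: mulr_ge0; [exact: ltW|rewrite ln_ge0// lerDl expR_ge0].
Qed.

Lemma softplus_ge u : lam * u <= p u.
Proof.
rewrite -ler_pdivrMl// mulrC -[leLHS]expRK ler_ln ?posrE ?expR_gt0 ?den_gt0//.
by rewrite lerDr.
Qed.

Lemma softplus_le u : u <= 0 -> p u <= gam * ln 2.
Proof.
move=> u0; rewrite ler_pM2l// ler_ln ?posrE ?den_gt0//.
have : expR (lam * u / gam) <= 1.
  by rewrite -expR0 ler_expR pmulr_lle0 ?invr_gt0// pmulr_rle0.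
lra.
Qed.

Lemma softplus_nondecreasing u v : u <= v -> p u <= p v.
Proof.
move=> uv; rewrite ler_pM2l// ler_ln ?posrE ?den_gt0//.
by rewrite lerD2l ler_expR ler_pM2r ?invr_gt0// ler_pM2l.
Qed.

(** Concavity of the logarithm, for the weights 1 / (1 + e^s) and
    e^s / (1 + e^s) that the slope is made of. *)
Lemma softplus_tangent u v : p u + q u * (v - u) <= p v.
Proof.
set s := lam * u / gam; set s' := lam * v / gam.
have w01 : 0 <= expR s / den u <= 1.
  rewrite divr_ge0 ?expR_ge0 ?(ltW (den_gt0 u))//=.
  by rewrite ler_pdivrMr ?den_gt0// mul1r lerDr.
have /andP[w0 w1] := w01.
have := @concave_ln R (Itv01 w0 w1) (expR (s' - s)) 1 (expR_gt0 _) ltr01.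
rewrite !convRE /= expRK ln1 mulr0 addr0 mulr1.
have -> : expR s / den u * expR (s' - s) + (1 - expR s / den u) = den v / den u.
  rewrite mulrAC -expRD [s + _]addrC subrK /den -/s -/s'.
  by field; rewrite gt_eqF// (den_gt0 u).
rewrite ln_div ?posrE ?den_gt0// -(ler_pM2l gam0) mulrBr => h.
have -> : q u * (v - u) = gam * (expR s / den u * (s' - s)).
  by rewrite /s' /softplus_slope -/s -/(den u) /s; field; rewrite !gt_eqF ?den_gt0.
by move: h; rewrite /softplus -/(den v) -/(den u); lra.
Qed.

Lemma softplus_convex t u v : 0 <= t <= 1 ->
  p (t * u + (1 - t) * v) <= t * p u + (1 - t) * p v.
Proof.
move=> /andP[t0 t1]; set w := t * u + _.
have h1 : t * (p w + q w * (u - w)) <= t * p u by rewrite ler_wpM2l// softplus_tangent.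
have h2 : (1 - t) * (p w + q w * (v - w)) <= (1 - t) * p v.
  by rewrite ler_wpM2l ?subr_ge0// softplus_tangent.
have -> : p w = t * (p w + q w * (u - w)) + (1 - t) * (p w + q w * (v - w)).
  have : t * (u - w) + (1 - t) * (v - w) = 0 by rewrite /w; ring.
  move: (p w) (q w) => a b; clearbody w => h.
  by rewrite -[LHS]addr0 -(mulr0 b) -h; ring.
exact: lerD.
Qed.

Lemma softplus_comp_convex (d : nat) (U : set 'rV[R]_d) (g : 'rV[R]_d -> R) :
  convex_function U g -> convex_function U (p \o g).
Proof.
move=> /convex_functionP cg; apply/convex_functionP => t x y t01 Ux Uy /=.
apply: le_trans (softplus_convex _ _ t01).
by apply: softplus_nondecreasing; exact: cg.
Qed.

Lemma softplus_comp_diff (d : nat) (g : 'rV[R]_d -> R) z : differentiable g z ->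
  differentiable (p \o g) z /\ grad (p \o g) z = q (g z) *: grad g z.
Proof.
move=> dg; have dpu := is_derive_softplus (g z).
have dp : differentiable p (g z) by apply/derivable1_diffP; exact: ex_derive.
split; first exact: differentiable_comp.
apply/rowP => i; rewrite !mxE !deriveE//; last exact: differentiable_comp.
rewrite diff_comp//= diff1E// derive1E derive_val /GRing.scale /=.
by rewrite mulrC.
Qed.

Lemma softplus_comp_grad_le (d : nat) (g : 'rV[R]_d -> R) z G :
  differentiable g z -> enorm (grad g z) <= G ->
  enorm (grad (p \o g) z) <= lam * G.
Proof.
move=> dg hG; rewrite (softplus_comp_diff dg).2 enormZ ger0_norm ?softplus_slope_ge0//.
by apply: ler_pM => //; [exact: softplus_slope_ge0|exact: enorm_ge0|exact: softplus_slope_le].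
Qed.

Lemma softplus_comp_grad_continuous (d : nat) (U : set 'rV[R]_d)
    (g : 'rV[R]_d -> R) z :
  open U -> C1_on U g -> U z -> {for z, continuous (grad (p \o g))}.
Proof.
move=> oU cg Uz; have [dg cgz] := cg z Uz.
have e : \forall y \near z, q (g y) *: grad g y = grad (p \o g) y.
  have : nbhs z U by exact: open_nbhs_nbhs.
  by apply: filterS => y Uy; rewrite (softplus_comp_diff (cg y Uy).1).2.
suff : grad (p \o g) y @[y --> z] --> q (g z) *: grad g z.
  by rewrite -(softplus_comp_diff dg).2.
apply: cvg_trans (near_eq_cvg e) _; apply: cvgZ; last exact: cgz.
have cgz' : g y @[y --> z] --> g z by exact: differentiable_continuous.
have := @continuous_cvg _ _ _ _ (nbhs_filter z) g q _ (@softplus_slope_continuous _) cgz'.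
exact.
Qed.

End Softplus.

(** * Linear growth of the constraint outside the feasible set *)

Section ErrorBound.
Context {R : realType} {d : nat}.
Variables (g : 'rV[R]_d -> R) (U : set 'rV[R]_d) (sigma : R).
Let C : set 'rV[R]_d := [set x | g x <= 0].
Hypothesis cvxC : convex_set C.
Hypothesis compC : compact C.
Hypothesis C0 : C !=set0.
Hypothesis CU : C `<=` U.
Hypothesis cvxg : convex_function U g.
Hypothesis diffg : forall x, U x -> differentiable g x.
Hypothesis sigma0 : 0 < sigma.
Hypothesis slater : forall x, C x -> g x = 0 -> sigma <= enorm (grad g x).
Implicit Types x y z : 'rV[R]_d.

(** Were [g] negative at the projection, the segment towards [z] would start
    inside [C], hence closer points would be feasible. *)
Lemma eproj_active z : U z -> 0 < g z -> g (eproj C z) = 0.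
Proof.
move=> Uz gz; have Cy := eproj_in compC C0 z; set y := eproj C z in Cy *.
apply/eqP; rewrite eq_le Cy leNgt; apply/negP => gy.
have yz : y != z by apply: contraTneq gz => <-; rewrite -leNgt.
set t := - g y / (g z - g y).
have D0 : 0 < g z - g y by lra.
have t0 : 0 < t by rewrite divr_gt0// oppr_gt0.
have t1 : t < 1 by rewrite ltr_pdivrMr// mul1r; lra.
have Cw : C (t *: z + (1 - t) *: y).
  have t01 : 0 <= t <= 1 by rewrite !ltW.
  have := (convex_functionP U g).1 cvxg t z y t01 Uz (CU Cy) => h.
  apply: le_trans h _; rewrite (_ : _ + _ = 0)// /t; field.
  by rewrite gt_eqF.
have := eproj_closest cvxC compC C0 z Cw; rewrite -/y.
have -> : t *: z + (1 - t) *: y - z = (1 - t) *: (y - z).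
  by apply/rowP => i; rewrite !mxE; ring.
have N0 : 0 < enorm (y - z) by rewrite enorm_gt0 ?subr_eq0.
rewrite enormZ ger0_norm; last by rewrite subr_ge0 ltW.
by rewrite ler_pMl// lerBrDr gerDl leNgt t0.
Qed.

(** Were the angle between [z - y] and the gradient at [y = eproj C z] positive,
    a small step from [y] along [w] below would decrease [g], hence stay
    feasible, and come closer to [z]. *)
Lemma eproj_normal z : U z -> 0 < g z ->
  enorm (grad g (eproj C z)) * enorm (z - eproj C z) <=
  edot (grad g (eproj C z)) (z - eproj C z).
Proof.
move=> Uz gz; have gy := eproj_active Uz gz; have Cy := eproj_in compC C0 z.
have closest := eproj_closest cvxC compC C0 z.
move: (eproj C z) gy Cy closest => y gy Cy closest.
have n0 : 0 < enorm (grad g y) by exact: lt_le_trans sigma0 (slater Cy gy).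
have yz : z - y != 0.
  by rewrite subr_eq0; apply: contraTneq gz => ->; rewrite gy ltxx.
have dy := diffg (CU Cy).
move: (enorm_gt0 yz) => u0.
set n := grad g y in n0 *; set u := z - y in yz u0 *.
have eu v : y + v - z = v - u by rewrite /u opprB addrCA addrA.
have eyz : enorm (y - z) = enorm u by rewrite enormB.
clearbody u.
rewrite leNgt; apply/negP => lt.
set w := enorm n *: u - enorm u *: n.
have nw : edot n w < 0.
  rewrite /w edotDr edotNr !edotZr -!sqr_enorm.
  by rewrite (_ : _ - _ = enorm n * (edot n u - enorm n * enorm u)); [rewrite pmulr_rlt0// subr_lt0|ring].
have wu : 0 < edot w u.
  rewrite /w edotDl edotNl !edotZl -!sqr_enorm.
  by rewrite (_ : _ - _ = enorm u * (enorm n * enorm u - edot n u)); [rewrite pmulr_rgt0// subr_gt0|ring].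
have w0 : 0 < enorm w.
  by apply: enorm_gt0; apply: contraTneq nw => ->; rewrite edot0r ltxx.
clearbody w.
set e := - edot n w / (2 * enorm w).
have e0 : 0 < e by rewrite divr_gt0 ?oppr_gt0 ?mulr_gt0.
set s := edot w u / (enorm w ^+ 2).
have s0 : 0 < s by rewrite divr_gt0 ?exprn_gt0.
(* the step is taken along s w, so that every length t < 1 comes closer *)
have [t [t0 t1]] := ray_near (s *: w) (diff_remainder dy e0).
rewrite scalerA [y + _ - y]addrAC subrr add0r gy edotZr enormZ (gtr0_norm (mulr_gt0 t0 s0)).
rewrite -/n subr0 ler_norml => /andP[_ h].
have Cw : C (y + (t * s) *: w).
  have h2 : e * enorm w = - edot n w / 2 by rewrite /e; field; rewrite gt_eqF.
  rewrite /C /=; rewrite [e * _]mulrCA h2 in h.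
  have ts : 0 < t * s by rewrite mulr_gt0.
  have : (t * s) * edot n w < 0 by rewrite pmulr_rlt0.
  move: h; rewrite [_ / 2 in X in X -> _]mulNr mulrN mulrA; lra.
have := closest _ Cw; rewrite -(@ler_pXn2r _ 2)// ?nnegrE ?enorm_ge0//.
rewrite eu eyz !sqr_enorm !edotE (edotC u w) -(sqr_enorm w).
have h3 : s * enorm w ^+ 2 = edot w u by rewrite /s divfK// gt_eqF ?exprn_gt0.
have h4 : t * s * (t * s * enorm w ^+ 2) = t * s * (t * edot w u) by rewrite -h3; ring.
rewrite h4.
have h5 : 0 < t * s * ((2 - t) * edot w u).
  apply: mulr_gt0; first exact: mulr_gt0.
  by apply: mulr_gt0 => //; rewrite subr_gt0; lra.
by move: h5; move: (edot w u) (edot u u) => a b; lra.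
Qed.

(** The tangent of [g] at [eproj C z] bounds [g z] from below. There [g]
    vanishes, so its gradient has length at least [sigma], and by [eproj_normal]
    this gradient points towards [z]. *)
Lemma error_bound z : U z -> 0 < g z -> sigma * enorm (z - eproj C z) <= g z.
Proof.
move=> Uz gz; have gy := eproj_active Uz gz; have Cy := eproj_in compC C0 z.
have h1 := convex_grad_ineq cvxg (diffg (CU Cy)) (CU Cy) Uz.
rewrite gy add0r in h1; apply: le_trans h1; apply: le_trans (eproj_normal Uz gz).
by rewrite ler_wpM2r ?enorm_ge0// slater.
Qed.

End ErrorBound.

(** * Borel measurability of random vectors *)

Section RandomVectors.
Context {R : realType} {d : nat}.
Local Notation borel := (g_sigma_algebraType (@open 'rV[R]_d)).

Lemma borel_open (O : set 'rV[R]_d) : open O -> measurable (O : set borel).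
Proof. by move=> oO; exact: sub_sigma_algebra. Qed.

Lemma measurable_open_preimage (dT : measure_display) (T : measurableType dT)
    (F : T -> 'rV[R]_d) :
  (forall O, open O -> measurable (F @^-1` O)) ->
  measurable_fun setT (F : T -> borel).
Proof.
move=> H; apply: (@measurability _ _ T borel setT F (@open 'rV[R]_d) erefl) => _ [V oV <-].
by rewrite setTI; exact: H.
Qed.

Lemma measurable_real_open_preimage (dT : measure_display)
    (T : measurableType dT) (F : T -> R) :
  (forall O : set R, open O -> measurable (F @^-1` O)) ->
  measurable_fun setT F.
Proof.
move=> H; apply: (measurability _ (RGenOpens.measurableE R)) => _ [_ [a [b ->] <-]].
by rewrite setTI; apply: H; exact: interval_open.
Qed.

Definition rational_box (ab : 'rV[rat]_d * 'rV[rat]_d) : set 'rV[R]_d :=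
  [set x | forall i, ratr (ab.1 0 i) < x 0 i < ratr (ab.2 0 i)].

(** The boxes with rational corners are a countable base of the topology. *)
Lemma open_rational_boxes (V : set 'rV[R]_d) : open V ->
  V = \bigcup_(ab in [set ab | rational_box ab `<=` V]) rational_box ab.
Proof.
move=> oV; apply/seteqP; split=> [x Vx|x [ab /= sV hx]]; last exact: sV.
have : nbhs x V by exact: open_nbhs_nbhs.
move=> /nbhs_ballP[e /= e0 be].
have /choice[a ha] : forall i, exists q : rat, x 0 i - e < ratr q < x 0 i.
  move=> i; have /rat_in_itvoo[q] : x 0 i - e < x 0 i by rewrite ltrBlDr ltrDl.
  by rewrite in_itv /= => hq; exists q.
have /choice[b hb] : forall i, exists q : rat, x 0 i < ratr q < x 0 i + e.
  move=> i; have /rat_in_itvoo[q] : x 0 i < x 0 i + e by rewrite ltrDl.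
  by rewrite in_itv /= => hq; exists q.
exists (\row_i a i, \row_i b i) => /=; last first.
  by move=> i; rewrite !mxE; have /andP[_ ->] := ha i; have /andP[-> _] := hb i.
move=> y hy; apply: be; split=> // i j; rewrite (ord1 i).
have := hy j; rewrite !mxE => /andP[h1 h2].
have /andP[h3 h4] := ha j; have /andP[h5 h6] := hb j.
by rewrite /ball /= ltr_distlC; apply/andP; split; lra.
Qed.

Lemma measurable_coordinates (dT : measure_display) (T : measurableType dT)
    (F : T -> 'rV[R]_d) :
  (forall i, measurable_fun setT (fun w => F w 0 i)) ->
  measurable_fun setT (F : T -> borel).
Proof.
move=> H; apply: measurable_open_preimage => O oO.
rewrite (open_rational_boxes oO) preimage_bigcup.
rewrite bigcup_mkcond; apply: countable_bigcupT_measurable; first exact: countableP.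
move=> [a b]; case: ifP => // _.
have -> : F @^-1` rational_box (a, b) =
    \bigcap_(i in [set: 'I_d]) ((fun w => F w 0 i) @^-1` `]ratr (a 0 i), ratr (b 0 i)[%classic).
  apply/seteqP; split=> w /= h i; have := h i; rewrite /= in_itv //=.
  by apply.
apply: fin_bigcap_measurable; first exact: finite_finset.
by move=> i _; rewrite -[X in measurable X]setTI; apply: H => //; exact: measurable_itv.
Qed.

Lemma measurable_comp_cont (dT : measure_display) (T : measurableType dT)
    (F : T -> 'rV[R]_d) (phi : 'rV[R]_d -> R) :
  continuous phi -> measurable_fun setT (F : T -> borel) ->
  measurable_fun setT (fun w => phi (F w)).
Proof.
move=> cphi mF; apply: measurable_real_open_preimage => O oO.
rewrite -[X in measurable X]setTI; apply: (mF measurableT (phi @^-1` O)).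
by apply: borel_open; apply: open_comp => // x _; exact: cphi.
Qed.

Lemma measurable_coord (dT : measure_display) (T : measurableType dT)
    (F : T -> 'rV[R]_d) i :
  measurable_fun setT (F : T -> borel) -> measurable_fun setT (fun w => F w 0 i).
Proof.
by apply: (measurable_comp_cont (phi := fun x => x 0 i)); exact: coord_continuous.
Qed.

Lemma measurable_vec_cont (dT : measure_display) (T : measurableType dT)
    (F : T -> 'rV[R]_d) (phi : 'rV[R]_d -> 'rV[R]_d) :
  continuous phi -> measurable_fun setT (F : T -> borel) ->
  measurable_fun setT (phi \o F : T -> borel).
Proof.
move=> cphi mF; apply: measurable_open_preimage => O oO.
rewrite -[X in measurable X]setTI; apply: (mF measurableT (phi @^-1` O)).
by apply: borel_open; apply: open_comp => // x _; exact: cphi.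
Qed.

Section Operations.
Context {dT : measure_display} {T : measurableType dT}.
Implicit Types F G : T -> 'rV[R]_d.

Lemma measurable_vecD F G :
  measurable_fun setT (F : T -> borel) -> measurable_fun setT (G : T -> borel) ->
  measurable_fun setT ((fun w => F w + G w) : T -> borel).
Proof.
move=> mF mG; apply: measurable_coordinates => i.
under eq_fun do rewrite mxE.
by apply: measurable_funD; exact: measurable_coord.
Qed.

Lemma measurable_vecZ (a : R) F : measurable_fun setT (F : T -> borel) ->
  measurable_fun setT ((fun w => a *: F w) : T -> borel).
Proof.
move=> mF; apply: measurable_coordinates => i.
under eq_fun do rewrite mxE.
by apply: measurable_funM => //; exact: measurable_coord.
Qed.

Lemma measurable_vecB F G :
  measurable_fun setT (F : T -> borel) -> measurable_fun setT (G : T -> borel) ->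
  measurable_fun setT ((fun w => F w - G w) : T -> borel).
Proof.
move=> mF mG; under eq_fun do rewrite -scaleN1r.
by apply: measurable_vecD => //; exact: measurable_vecZ.
Qed.

Lemma measurable_vec_sum n (F : nat -> T -> 'rV[R]_d) :
  (forall k, (k < n)%N -> measurable_fun setT (F k : T -> borel)) ->
  measurable_fun setT ((fun w => \sum_(k < n) F k w) : T -> borel).
Proof.
elim: n => [|n IH] mF.
  by under eq_fun do rewrite big_ord0; exact: measurable_cst.
under eq_fun do rewrite big_ord_recr /=.
by apply: measurable_vecD; [apply: IH => k kn; apply: mF; exact: ltnW|exact: mF].
Qed.

Lemma measurable_edot F G :
  measurable_fun setT (F : T -> borel) -> measurable_fun setT (G : T -> borel) ->
  measurable_fun setT (fun w => edot (F w) (G w)).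
Proof.
move=> mF mG; under eq_fun do rewrite edot_sumE; apply: measurable_sum => i.
by apply: measurable_funM; exact: measurable_coord.
Qed.

Lemma measurable_enorm F : measurable_fun setT (F : T -> borel) ->
  measurable_fun setT (fun w => enorm (F w)).
Proof. exact: (measurable_comp_cont (@enorm_continuous R d)). Qed.

End Operations.

End RandomVectors.

(** * Hoeffding's lemma *)

Section ScalarHoeffding.
Context {R : realType}.
Implicit Types u b t : R.

(** The first two derivatives in [u] of the difference of the logarithms are
    nonnegative on the half-line, and both the difference and its derivative
    vanish at 0. *)
Lemma exp_mixture_le b u : - 1 <= b <= 1 -> 0 <= u ->
  (1 + b) / 2 * expR u + (1 - b) / 2 * expR (- u) <= expR (b * u + u ^+ 2 / 2).
Proof.
move=> b1 u0.
pose D v : R := (1 + b) / 2 * expR v + (1 - b) / 2 * expR (- v).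
pose N v : R := (1 + b) / 2 * expR v - (1 - b) / 2 * expR (- v).
have D0 (v : R) : 0 < D v.
  have := expR_gt0 v; have := expR_gt0 (- v); rewrite /D.
  move: (expR v) (expR (- v)) => x y; nra.
have dN (v : R) : is_derive v 1 (fun v : R => expR (- v)) (- expR (- v)).
  have := @is_derive1_comp R expR -%R v _ _ (is_derive_expR _) (is_deriveNid v 1).
  by rewrite mulrN1.
have dD (v : R) : is_derive v 1 D (N v).
  rewrite (_ : D = ((1 + b) / 2) \*: expR + ((1 - b) / 2) \*: (fun v => expR (- v)))//.
  by apply: is_derive_eq; rewrite /GRing.scale /= mulrN.
have dNN (v : R) : is_derive v 1 N (D v).
  rewrite (_ : N = ((1 + b) / 2) \*: expR - ((1 - b) / 2) \*: (fun v => expR (- v)))//.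
  by apply: is_derive_eq; rewrite /GRing.scale /= mulrN opprK.
(* psi is the derivative of chi, and psi' is the square of N / D since N' = D *)
pose psi v : R := b + v - N v / D v.
have dpsi (v : R) : is_derive v 1 psi ((N v / D v) ^+ 2).
  have dV := @is_deriveV R D v (N v) 1 (lt0r_neq0 (D0 v)) (dD v).
  rewrite (_ : psi = (cst b + id) - N * (fun v => (D v)^-1))//.
  apply: is_derive_eq; rewrite /GRing.scale /=.
  by field; exact: lt0r_neq0.
pose chi v : R := b * v + v ^+ 2 / 2 - ln (D v).
have dchi (v : R) : is_derive v 1 chi (psi v).
  have dl := @is_derive1_comp R (@ln R) D v _ _ (is_derive1_ln (D0 v)) (dD v).
  rewrite (_ : chi = (b \*: id + 2^-1 \*: (id ^+ 2)) - (@ln R \o D)); last first.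
    by apply/funext => y; rewrite /chi [_ / 2]mulrC.
  apply: is_derive_eq; rewrite /GRing.scale /= /psi.
  by field; exact: lt0r_neq0.
have half (h dh : R -> R) : (forall v : R, is_derive v 1 h (dh v)) ->
    (forall v, 0 <= v -> 0 <= dh v) -> h 0 = 0 -> forall v, 0 <= v -> 0 <= h v.
  move=> hd dh0 h0 v v0; rewrite -h0.
  apply: (@ger0_derive1_ndecry R h 0) => //.
  - by move=> x; rewrite in_itv /= andbT => /ltW x0; rewrite derive1E derive_val dh0.
  - apply: continuous_subspaceT => x.
    by apply: differentiable_continuous; apply/derivable1_diffP.
have D00 : D 0 = 1 by rewrite /D oppr0 expR0; field.
have psi0 v : 0 <= v -> 0 <= psi v.
  apply: (half psi (fun v => (N v / D v) ^+ 2)) => // [y _|]; first exact: sqr_ge0.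
  by rewrite /psi D00 divr1 /N oppr0 expR0; field.
have chi0 : 0 <= chi u.
  by apply: (half chi psi) => //; rewrite /chi D00 ln1; ring.
have -> : (1 + b) / 2 * expR u + (1 - b) / 2 * expR (- u) = expR (ln (D u)).
  by rewrite lnK// posrE.
by rewrite ler_expR; move: chi0; rewrite /chi subr_ge0.
Qed.

(** [expR (t * (m - n))] is bounded by the chord of the exponential over the
    interval [-r, r] of [n]; it is affine in [n], and its value at [n = m] is
    controlled by [exp_mixture_le]. *)
Definition chord_slope (t r : R) : R := (expR (t * r) - expR (- (t * r))) / (2 * r).

Lemma exp_chord_le (t r m n : R) : 0 < t -> `|m| <= r -> `|n| <= r ->
  expR (t * (m - n) - t ^+ 2 * r ^+ 2 / 2) <=
  1 + expR (t * m - t ^+ 2 * r ^+ 2 / 2) * chord_slope t r * (m - n).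
Proof.
move=> t0 mr nr; have r0 : 0 <= r by exact: le_trans (normr_ge0 _) mr.
have [r00|rn0] := eqVneq r 0.
  move: mr nr; rewrite r00 !normr_le0 => /eqP -> /eqP ->.
  by rewrite !(subr0, mulr0, expr0n, mul0r, addr0) expR0.
have rp : 0 < r by rewrite lt_neqAle eq_sym rn0.
move: mr nr; rewrite !ler_norml => /andP[m1 m2] /andP[n1 n2].
have w01 : 0 <= (r - n) / (2 * r) <= 1.
  rewrite divr_ge0 ?subr_ge0 ?mulr_ge0//= ler_pdivrMr ?mulr_gt0//; lra.
have /andP[w0 w1] := w01.
have := @convex_expR R (Itv01 w0 w1) (t * r) (- (t * r)).
rewrite !convRE /= /unstable.onem.
have -> : (r - n) / (2 * r) * (t * r) + (1 - (r - n) / (2 * r)) * - (t * r) = - (t * n).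
  by field.
move=> h1.
have b1 : - 1 <= - m / r <= 1.
  by rewrite ler_pdivlMr// ler_pdivrMr//; apply/andP; split; lra.
have tr0 : 0 <= t * r by rewrite mulr_ge0// ltW.
have := exp_mixture_le b1 tr0.
have -> : - m / r * (t * r) + (t * r) ^+ 2 / 2 = - (t * m - t ^+ 2 * r ^+ 2 / 2) by field.
rewrite (expRN (t * m - _)).
set E := expR (t * m - _); have E0 : 0 < E by exact: expR_gt0.
move=> h2.
have -> : expR (t * (m - n) - t ^+ 2 * r ^+ 2 / 2) = E * expR (- (t * n)).
  by rewrite -expRD; congr expR; ring.
have h3 := ler_wpM2l (ltW E0) h1; apply: le_trans h3 _.
have := ler_wpM2l (ltW E0) h2; rewrite mulfV ?gt_eqF// => h4.
rewrite -lerBlDr; apply: le_trans h4; rewrite le_eqVlt; apply/orP; left; apply/eqP.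
by rewrite /chord_slope; field.
Qed.

Lemma chord_slope_bound (t r : R) : 0 < t -> 0 <= r ->
  0 <= chord_slope t r <= t * expR (t * r).
Proof.
move=> t0; rewrite le_eqVlt => /predU1P[<-|r0].
  by rewrite /chord_slope mulr0 oppr0 subrr mul0r expR0 lexx/= mulr1 ltW.
have tr0 : 0 < t * r by rewrite mulr_gt0.
rewrite /chord_slope divr_ge0 ?subr_ge0 ?ler_expR ?mulr_ge0//=; last 2 first.
  - lra.
  - exact: ltW.
rewrite ler_pdivrMr ?mulr_gt0//.
have h := expR_ge1Dx (- (2 * (t * r))).
have -> : expR (- (t * r)) = expR (t * r) * expR (- (2 * (t * r))).
  by rewrite -expRD; congr expR; ring.
have h2 := ler_wpM2l (expR_ge0 (t * r)) h; move: h2.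
move: (expR (t * r)) (expR _) => x y h2; lra.
Qed.

End ScalarHoeffding.

(** * Conditionally centred variables *)

Section CondCentred.
Context {R : realType} {dO : measure_display} {Omega : measurableType dO}.
Variable P : probability Omega R.
Implicit Types (G : set (set Omega)) (X Y Z B W mu r : Omega -> R).

(** The conditional expectation given [<<s G >>] is 0. Tested against indicators,
    this is a property of [X] alone: no version has to be chosen. *)
Definition cond_centred G X : Prop :=
  P.-integrable setT (EFin \o X) /\
  forall A, <<s G >> A -> \int[P]_w (\1_A w * X w) = 0.

Definition sub_measurable G : Prop := <<s G >> `<=` @measurable _ Omega.

Lemma bounded_itv (M : R) X : (forall w, `|X w| <= M) -> [bounded X w | w in setT].
Proof.
move=> H; exists M; split; first exact: num_real.
by move=> x Mx w _ /=; apply: le_trans (H w) (ltW Mx).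
Qed.

Lemma bounded_integrable (M : R) X : measurable_fun setT X ->
  (forall w, `|X w| <= M) -> P.-integrable setT (EFin \o X).
Proof.
move=> mX H; apply: measurable_bounded_integrable => //; last exact: bounded_itv H.
exact: le_lt_trans (probability_le1 P measurableT) (ltry 1).
Qed.

Lemma integrable_boundedM (M : R) B X : measurable_fun setT B ->
  (forall w, `|B w| <= M) -> P.-integrable setT (EFin \o X) ->
  P.-integrable setT (EFin \o (fun w => B w * X w)).
Proof.
move=> mB HB iX; have := integrableMr measurableT mB (bounded_itv HB) iX.
by apply: eq_integrable.
Qed.

Lemma measurable_sub G X : sub_measurable G ->
  measurable_fun [set: g_sigma_algebraType G] X -> measurable_fun setT X.
Proof. by move=> sG mX _ A mA; apply: sG; exact: mX. Qed.

(** [x] rounded down to a multiple of [n^-1], for [0 <= x] and [n * x <= N]. *)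
Let round (n N : nat) (x : R) : R :=
  n%:R^-1 * \sum_(k < N) ((k.+1%:R <= n%:R * x)%R)%:R.

Let sum_lt (N m : nat) : (\sum_(k < N) (k < m))%N = minn N m.
Proof.
elim: N => [|N IH]; first by rewrite big_ord0 min0n.
rewrite big_ord_recr /= IH; case: (ltnP N m) => h.
  by rewrite (minn_idPl h) addn1.
by rewrite addn0 (minn_idPr (leqW h)).
Qed.

Let round_close (n N : nat) (x : R) : (0 < n)%N -> 0 <= x -> n%:R * x <= N%:R ->
  `|x - round n N x| <= n%:R^-1.
Proof.
move=> n0 x0 xN; have np : (0 : R) < n%:R by rewrite ltr0n.
have nx0 : 0 <= n%:R * x by rewrite mulr_ge0.
have /andP[h1 h2] := truncn_itv nx0; set m := Num.truncn (n%:R * x) in h1 h2.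
have e k : (k.+1%:R <= n%:R * x) = (k < m)%N.
  apply/idP/idP => h; last by apply: le_trans h1; rewrite ler_nat.
  by rewrite ltnNge; apply/negP => mk; move: (le_lt_trans h h2); rewrite ltr_nat ltnS leqNgt ltnS mk.
have -> : round n N x = n%:R^-1 * m%:R.
  rewrite /round; under eq_bigr do rewrite e.
  rewrite -natr_sum sum_lt (minn_idPr _)//.
  by rewrite -(ler_nat R); exact: le_trans h1 xN.
rewrite ger0_norm; last by rewrite subr_ge0 ler_pdivrMl.
rewrite lerBlDr -(ler_pM2l np) mulrDr mulfV ?gt_eqF// mulVKf ?gt_eqF//.
by rewrite addrC natr1 ltW.
Qed.

Let indic_bound (A : set Omega) w : `|\1_A w : R| <= 1.
Proof. by rewrite indicE ger0_norm ?ler0n// lern1 leq_b1. Qed.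

Lemma cond_centred_indic G X (A : set Omega) : sub_measurable G ->
  cond_centred G X -> <<s G >> A ->
  P.-integrable setT (EFin \o (fun w => \1_A w * X w)).
Proof.
move=> sG [iX _] GA; apply: (integrable_boundedM (M := 1)) => //.
by apply: measurable_indic; exact: sG.
Qed.

Let cond_centred_step G X (n N : nat) B : sub_measurable G -> cond_centred G X ->
  measurable_fun [set: g_sigma_algebraType G] B ->
  P.-integrable setT (EFin \o (fun w => round n N (B w) * X w)) /\
  \int[P]_w (round n N (B w) * X w) = 0.
Proof.
move=> sG cX mB; have [iX hX] := cX.
pose A k : set Omega := [set w | k.+1%:R <= n%:R * B w].
have GA k : <<s G >> (A k).
  have : measurable_fun [set: g_sigma_algebraType G] (fun w => n%:R * B w).
    by apply: measurable_funM => //; exact: measurable_cst.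
  move=> /(_ measurableT `[k.+1%:R, +oo[%classic (measurable_itv _)).
  rewrite setTI; congr (<<s G >> _); apply/seteqP.
  by split=> w /=; rewrite in_itv /= andbT.
have e w : round n N (B w) * X w =
    n%:R^-1 * \sum_(k < N) (\1_(A k) w * X w).
  rewrite /round -mulrA mulr_suml; congr (_ * _).
  apply: eq_bigr => k _; rewrite indicE; congr (_%:R * _).
  have -> : (w \in A k) = (k.+1%:R <= n%:R * B w) by apply/idP/idP => [/set_mem|/mem_set].
  by [].
have [i0 h0] : P.-integrable setT (EFin \o (fun w => \sum_(k < N) (\1_(A k) w * X w))) /\
    \int[P]_w (\sum_(k < N) (\1_(A k) w * X w)) = 0.
  elim: N {e} => [|N [iN hN]].
    under eq_fun do rewrite big_ord0.
    by split; [exact: integrable0|rewrite Rintegral_cst// mul0r].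
  have iA := cond_centred_indic sG cX (GA N).
  under eq_fun do rewrite big_ord_recr /=.
  split; first by have := integrableD measurableT iN iA; apply: eq_integrable.
  by rewrite RintegralD// hN add0r; exact: hX.
under eq_fun do rewrite e; split.
  by have := integrableZl measurableT n%:R^-1 i0; apply: eq_integrable.
by rewrite RintegralZl// h0 mulr0.
Qed.

Let cond_centred_ge0 G X B (M : R) : sub_measurable G -> cond_centred G X ->
  measurable_fun [set: g_sigma_algebraType G] B ->
  (forall w, 0 <= B w <= M) -> \int[P]_w (B w * X w) = 0.
Proof.
move=> sG cX mB HB; have [iX hX] := cX.
have HB' w : `|B w| <= M by have /andP[h1 h2] := HB w; rewrite ger0_norm.
have iBX := integrable_boundedM (measurable_sub sG mB) HB' iX.
have inX := integrable_norm iX.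
set I := \int[P]_w `|X w|.
have I0 : 0 <= I by apply: Rintegral_ge0.
have key n : (0 < n)%N -> `|\int[P]_w (B w * X w)| <= n%:R^-1 * I.
  move=> n0; pose N := (Num.truncn (n%:R * M)).+1.
  have [iS hS] := cond_centred_step n N sG cX mB.
  rewrite -[\int[P]_w (B w * X w)]subr0 -hS -RintegralB//.
  apply: le_trans (le_normr_Rintegral _ _) _ => //.
    by have := integrableB measurableT iBX iS; apply: eq_integrable.
  rewrite -RintegralZl//; apply: le_Rintegral => //.
  - by apply: (@integrable_norm _ _ _ P setT (fun w => B w * X w - round n N (B w) * X w));
      have := integrableB measurableT iBX iS; apply: eq_integrable.
  - by have := integrableZl measurableT n%:R^-1 inX; apply: eq_integrable.
  move=> w _; rewrite -mulrBl normrM; apply: ler_wpM2r => //.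
  have /andP[B0 BM] := HB w; apply: round_close => //.
  apply: (@le_trans _ _ (n%:R * M)); first by rewrite ler_wpM2l.
  by rewrite /N; apply: ltW; apply: truncnS_gt.
apply/eqP; rewrite -normr_eq0 eq_le normr_ge0 andbT.
apply/ler_addgt0Pr => e e0; rewrite add0r.
pose n := (Num.truncn (I / e)).+1.
apply: le_trans (key n _) _ => //; rewrite ler_pdivrMl ?ltr0n//.
by rewrite -ler_pdivrMr//; apply: ltW; exact: truncnS_gt.
Qed.

(** Take out what is known. A test function is the uniform limit of step
    functions, on which the integral vanishes by definition. *)
Lemma cond_centred_bounded G X B (M : R) : sub_measurable G -> cond_centred G X ->
  measurable_fun [set: g_sigma_algebraType G] B ->
  (forall w, `|B w| <= M) -> \int[P]_w (B w * X w) = 0.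
Proof.
move=> sG cX mB HB; have [iX hX] := cX.
have h w : 0 <= B w + M <= M + M.
  by have := HB w; rewrite ler_norml => /andP[h1 h2]; apply/andP; split; lra.
have mBM : measurable_fun [set: g_sigma_algebraType G] (fun w => B w + M).
  by apply: measurable_funD => //; exact: measurable_cst.
have := cond_centred_ge0 sG cX mBM h.
under eq_Rintegral do rewrite mulrDl.
have iBX := integrable_boundedM (measurable_sub sG mB) HB iX.
have iMX : P.-integrable setT (EFin \o (fun w => M * X w)).
  by have := integrableZl measurableT M iX; apply: eq_integrable.
rewrite RintegralD// RintegralZl//.
have := hX setT; under eq_Rintegral do rewrite indicT mul1r.
by move=> -> //; [rewrite mulr0 addr0|exact: (@measurableT _ (g_sigma_algebraType G))].
Qed.

(** The multiplier may depend on the past only, so this is where adaptedness of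
    the directions enters. *)
Lemma cond_centredM G X B (M : R) : sub_measurable G -> cond_centred G X ->
  measurable_fun [set: g_sigma_algebraType G] B ->
  (forall w, `|B w| <= M) -> cond_centred G (fun w => B w * X w).
Proof.
move=> sG cX mB HB; have [iX hX] := cX; split.
  exact: integrable_boundedM (measurable_sub sG mB) HB iX.
move=> A GA; under eq_Rintegral do rewrite mulrA.
apply: (cond_centred_bounded (M := M)) cX _ _ => //.
  by apply: measurable_funM => //; exact: measurable_indic.
move=> w; rewrite normrM -[M]mul1r; apply: ler_pM => //; exact: indic_bound.
Qed.

Lemma cond_centred_sum G (n : nat) (X : 'I_n -> Omega -> R) : sub_measurable G ->
  (forall i, cond_centred G (X i)) -> cond_centred G (fun w => \sum_(i < n) X i w).
Proof.
move=> sG; elim: n X => [|n IH] X cX.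
  under eq_fun do rewrite big_ord0; split; first exact: integrable0.
  by move=> A _; under eq_Rintegral do rewrite mulr0; rewrite Rintegral_cst// mul0r.
under eq_fun do rewrite big_ord_recr /=.
have c1 := IH (fun i => X (widen_ord (leqnSn n) i)) (fun i => cX _).
have c2 := cX ord_max; have [i1 h1] := c1; have [i2 h2] := c2; split.
  by have := integrableD measurableT i1 i2; apply: eq_integrable.
move=> A GA; under eq_Rintegral do rewrite mulrDr.
rewrite RintegralD//; [|exact: cond_centred_indic c1 GA|exact: cond_centred_indic c2 GA].
by rewrite h1// h2// addr0.
Qed.

Lemma cond_centred_ae G X Y : sub_measurable G -> cond_centred G X ->
  measurable_fun setT Y -> {ae P, forall w, X w = Y w} -> cond_centred G Y.
Proof.
move=> sG [iX hX] mY aeXY.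
have mX : measurable_fun setT X by apply/measurable_EFinP; exact: measurable_int iX.
split.
  apply/integrableP; split; first exact/measurable_EFinP.
  have /integrableP[_] := iX; congr (_ < _)%E.
  apply: ae_eq_integral => //; [| |by apply: filterS aeXY => w /= -> _];
    by apply: measurableT_comp => //; exact/measurable_EFinP.
move=> A GA; rewrite -(hX A GA); congr fine; apply: ae_eq_integral => //.
- by apply/measurable_EFinP; apply: measurable_funM => //; apply: measurable_indic; exact: sG.
- by apply/measurable_EFinP; apply: measurable_funM => //; apply: measurable_indic; exact: sG.
- by apply: filterS aeXY => w /= -> _.
Qed.

(** The given conditional mean [Y] need not itself be measurable with respect to
    [<<s G >>], as the tail bound requires; a version of it is. *)
Lemma cond_exp_centred G X Y : sub_measurable G -> is_cond_exp P G X Y ->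
  exists Z, [/\ measurable_fun [set: g_sigma_algebraType G] Z,
    {ae P, forall w, Y w = Z w} & cond_centred G (fun w => Z w - X w)].
Proof.
move=> sG [iX [Z [mZ iZ hZ aeZ]]]; exists Z; split=> //; split.
  by have := integrableB measurableT iZ iX; apply: eq_integrable.
move=> A GA; under eq_Rintegral do rewrite mulrBr.
have mA : measurable (A : set Omega) by exact: sG.
have mI : measurable_fun setT (\1_A : Omega -> R) by exact: measurable_indic.
rewrite RintegralB//; [|exact: integrable_boundedM mI (indic_bound A) iZ|exact: integrable_boundedM mI (indic_bound A) iX].
have e X' : \int[P]_w (\1_A w * X' w) = fine (\int[P]_(w in A) (X' w)%:E)%E.
  rewrite -[RHS]/(\int[P]_(w in A) X' w) [RHS]Rintegral_mkcond.
  apply: eq_Rintegral => w _; rewrite patchE indicE.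
  by case: (w \in A); rewrite ?mul1r ?mul0r.
by rewrite !e hZ// subrr.
Qed.

(** * Exponential supermartingales *)

Lemma measurable_hoeffding_exponent (dT : measure_display) (T : measurableType dT)
    (t : R) (N mu r : T -> R) :
  measurable_fun setT N -> measurable_fun setT mu -> measurable_fun setT r ->
  measurable_fun setT (fun w => t * (mu w - N w) - t ^+ 2 * r w ^+ 2 / 2).
Proof.
move=> mN mmu mr; apply: measurable_funB.
  apply: measurable_funM; first exact: measurable_cst.
  exact: measurable_funB.
apply: measurable_funM; last exact: measurable_cst.
by apply: measurable_funM; [exact: measurable_cst|exact: measurable_funX].
Qed.

Lemma measurable_chord_slope (dT : measure_display) (T : measurableType dT)
    (t : R) (r : T -> R) : (forall w, 0 <= r w) ->
  measurable_fun setT r -> measurable_fun setT (fun w => chord_slope t (r w)).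
Proof.
move=> r0 mr.
have mtr : measurable_fun setT (fun w => t * r w).
  by apply: measurable_funM => //; exact: measurable_cst.
apply: measurable_funM.
  apply: measurable_funB; first exact: measurableT_comp.
  by apply: measurableT_comp => //; exact: measurable_funN.
have -> : (fun w => (2 * r w)^-1) = (fun w => (2 * r w) `^ (-1)).
  by apply/funext => w; rewrite powR_inv1// mulr_ge0.
have m2r : measurable_fun setT (fun w => 2 * r w).
  by apply: measurable_funM => //; exact: measurable_cst.
by have := measurableT_comp (@measurable_powR R (-1)) m2r.
Qed.

Lemma hoeffding_exponent_le (t m n r r0 : R) : 0 < t -> `|m| <= r -> `|n| <= r ->
  r <= r0 -> t * (m - n) - t ^+ 2 * r ^+ 2 / 2 <= t * (2 * r0).
Proof.
move=> t0; rewrite !ler_norml => /andP[m1 m2] /andP[n1 n2] rr.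
have h1 : t * (m - n) <= t * (2 * r0) by rewrite ler_pM2l//; lra.
have h2 : 0 <= t ^+ 2 * r ^+ 2 by rewrite mulr_ge0 ?sqr_ge0.
by rewrite -[leRHS]subr0; apply: lerB => //; rewrite divr_ge0.
Qed.

(** By [exp_chord_le] the exponential is at most 1 plus a multiple of
    [mu - N] known from the past, and that multiple integrates to 0. *)
Lemma hoeffding_step G W (N : Omega -> R) mu r (M r0 t : R) : sub_measurable G ->
  measurable_fun [set: g_sigma_algebraType G] W ->
  measurable_fun [set: g_sigma_algebraType G] mu ->
  measurable_fun [set: g_sigma_algebraType G] r ->
  measurable_fun setT N -> cond_centred G (fun w => mu w - N w) ->
  0 < t -> (forall w, 0 <= W w <= M) ->
  (forall w, `|mu w| <= r w) -> (forall w, `|N w| <= r w) -> (forall w, r w <= r0) ->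
  \int[P]_w (W w * expR (t * (mu w - N w) - t ^+ 2 * r w ^+ 2 / 2)) <=
  \int[P]_w W w.
Proof.
move=> sG mW mmu mr mN cc t0 HW Hmu HN Hr.
pose B w := W w * (expR (t * mu w - t ^+ 2 * r w ^+ 2 / 2) * chord_slope t (r w)).
have rp w : 0 <= r w by exact: le_trans (normr_ge0 _) (Hmu w).
have mB : measurable_fun [set: g_sigma_algebraType G] B.
  apply: measurable_funM => //; apply: measurable_funM; last exact: measurable_chord_slope.
  apply: measurableT_comp => //.
  have := measurable_hoeffding_exponent t (@measurable_cst _ _ _ _ setT (0 : R)) mmu mr.
  by apply: eq_measurable_fun => w _ /=; rewrite subr0.
have HW0 w : 0 <= W w by have /andP[] := HW w.
have HWM w : W w <= M by have /andP[] := HW w.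
have HB w : `|B w| <= M * (expR (t * (2 * r0)) * (t * expR (t * r0))).
  have /andP[s0 s1] := chord_slope_bound t0 (rp w).
  rewrite ger0_norm; last first.
    by apply: mulr_ge0 => //; apply: mulr_ge0 => //; exact: expR_ge0.
  apply: ler_pM => //; first by apply: mulr_ge0 => //; exact: expR_ge0.
  apply: ler_pM => //.
    rewrite ler_expR; have := @hoeffding_exponent_le t (mu w) 0 (r w) r0 t0 (Hmu w).
    by rewrite subr0 normr0; apply.
  by apply: le_trans s1 _; rewrite ler_pM2l// ler_expR ler_pM2l.
have mW' := measurable_sub sG mW; have mmu' := measurable_sub sG mmu.
have mr' := measurable_sub sG mr; have mB' := measurable_sub sG mB.
have iW : P.-integrable setT (EFin \o W).
  by apply: (bounded_integrable (M := M)) => // w; rewrite ger0_norm.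
have iB : P.-integrable setT (EFin \o (fun w => B w * (mu w - N w))).
  by apply: integrable_boundedM mB' HB _; have [] := cc.
have hB : \int[P]_w (B w * (mu w - N w)) = 0.
  exact: cond_centred_bounded sG cc mB HB.
rewrite -[leRHS]addr0 -hB -RintegralD//; apply: le_Rintegral => //.
- apply: (bounded_integrable (M := M * expR (t * (2 * r0)))).
    apply: measurable_funM => //; apply: measurableT_comp => //.
    exact: measurable_hoeffding_exponent.
  move=> w; rewrite ger0_norm; last by rewrite mulr_ge0 ?expR_ge0.
  by apply: ler_pM => //; rewrite ?expR_ge0// ler_expR; apply: hoeffding_exponent_le.
- by have := integrableD measurableT iW iB; apply: eq_integrable.
move=> w _; have := ler_wpM2l (HW0 w) (exp_chord_le t0 (Hmu w) (HN w)).
by rewrite [W w * (1 + _)]mulrDr mulr1 /B !mulrA.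
Qed.

Lemma measurable_coarser (dT : measure_display) (T : measurableType dT)
    (G1 G2 : set (set Omega)) (X : Omega -> T) : <<s G1 >> `<=` <<s G2 >> ->
  measurable_fun [set: g_sigma_algebraType G1] X ->
  measurable_fun [set: g_sigma_algebraType G2] X.
Proof. by move=> sG mX _ A mA; apply: sG; exact: mX. Qed.

(** The exponentials of the partial sums form a supermartingale started at 1;
    conclude by Markov's inequality. *)
Lemma hoeffding_tail (G : nat -> set (set Omega)) (K : nat)
    (N mu r : nat -> Omega -> R) (r0 t delta : R) :
  (forall k, sub_measurable (G k)) ->
  (forall k, <<s G k >> `<=` <<s G k.+1 >>) ->
  (forall k, (k < K)%N ->
    [/\ measurable_fun [set: g_sigma_algebraType (G k.+1)] (N k),
        measurable_fun [set: g_sigma_algebraType (G k)] (mu k),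
        measurable_fun [set: g_sigma_algebraType (G k)] (r k) &
        cond_centred (G k) (fun w => mu k w - N k w)]) ->
  (forall k w, (k < K)%N ->
    [/\ `|mu k w| <= r k w, `|N k w| <= r k w & r k w <= r0]) ->
  0 < t -> 0 < delta ->
  let S w := \sum_(k < K) (t * (mu k w - N k w) - t ^+ 2 * r k w ^+ 2 / 2) in
  measurable [set w | ln (1 / delta) < S w] /\
  (P [set w | ln (1 / delta) < S w]%R <= delta%:E)%E.
Proof.
move=> sG incr mea bnd t0 delta0 S.
pose Y k w := t * (mu k w - N k w) - t ^+ 2 * r k w ^+ 2 / 2.
pose W n w := expR (\sum_(k < n) Y k w).
have mS n : (n <= K)%N ->
    measurable_fun [set: g_sigma_algebraType (G n)] (fun w => \sum_(k < n) Y k w).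
  elim: n => [|n IH] nK; first by under eq_fun do rewrite big_ord0; exact: measurable_cst.
  under eq_fun do rewrite big_ord_recr /=.
  have [m1 m2 m3 _] := mea n nK.
  apply: measurable_funD; first by apply: measurable_coarser (IH (ltnW nK)); exact: incr.
  by apply: measurable_hoeffding_exponent => //; apply: measurable_coarser (incr n) _.
have mW n : (n <= K)%N -> measurable_fun [set: g_sigma_algebraType (G n)] (W n).
  by move=> nK; apply: measurableT_comp => //; exact: mS.
have HW n w : (n <= K)%N -> 0 <= W n w <= expR (n%:R * (t * (2 * r0))).
  move=> nK; rewrite expR_ge0 /= ler_expR mulr_natl -[n in _ *+ n]card_ord -sumr_const.
  apply: ler_sum => k _; have [h1 h2 h3] := bnd k w (leq_trans (ltn_ord k) nK).
  exact: hoeffding_exponent_le.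
have E n : (n <= K)%N -> \int[P]_w W n w <= 1.
  elim: n => [|n IH] nK.
    rewrite /W; under eq_Rintegral do rewrite big_ord0 expR0.
    by rewrite Rintegral_cst// mul1r -lee_fin fineK ?fin_num_measure// probability_le1.
  apply: le_trans (IH (ltnW nK)).
  have [m1 m2 m3 cc] := mea n nK.
  have -> : \int[P]_w W n.+1 w = \int[P]_w (W n w * expR (Y n w)).
    by apply: eq_Rintegral => w _; rewrite /W big_ord_recr /= expRD.
  apply: (hoeffding_step (G := G n) (M := expR (n%:R * (t * (2 * r0)))) (r0 := r0)) => //.
  - by apply: mW; exact: ltnW.
  - exact: measurable_sub m1.
  - by move=> w; apply: HW; exact: ltnW.
  - by move=> w; have [] := bnd n w nK.
  - by move=> w; have [] := bnd n w nK.
  - by move=> w; have [] := bnd n w nK.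
set A := [set w | _].
have mSK : measurable_fun setT S := measurable_sub (sG K) (mS K (leqnn K)).
have mA : measurable A.
  rewrite (_ : A = S @^-1` `]ln (1 / delta), +oo[%classic); last first.
    by apply/seteqP; split=> w /=; rewrite in_itv /= andbT.
  by rewrite -[X in measurable X]setTI; apply: mSK => //; exact: measurable_itv.
split=> //.
have mWK : measurable_fun setT (W K) := measurable_sub (sG K) (mW K (leqnn K)).
have iW : P.-integrable setT (EFin \o W K).
  apply: (bounded_integrable (M := expR (K%:R * (t * (2 * r0))))) => // w.
  by have /andP[h1 h2] := HW K w (leqnn K); rewrite ger0_norm.
have iA : P.-integrable setT (EFin \o (fun w => delta^-1 * \1_A w)).
  have := integrableZl measurableT delta^-1 (integrable_indic P mA).
  by apply: eq_integrable.
have h : \int[P]_w (delta^-1 * \1_A w) <= 1.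
  apply: le_trans (E K (leqnn K)); apply: le_Rintegral => // w _.
  rewrite indicE; have [/set_mem Aw|_] := boolP (w \in A); last by rewrite mulr0 expR_ge0.
  rewrite mulr1 -[leLHS]lnK ?posrE ?invr_gt0// ler_expR -div1r.
  exact: ltW.
have eA : \int[P]_w (delta^-1 * \1_A w) = delta^-1 * fine (P A).
  rewrite RintegralZl//; last exact: integrable_indic.
  by rewrite /Rintegral integral_indic// setIT.
rewrite eA ler_pdivrMl// mulr1 in h.
by rewrite -[P A]fineK ?fin_num_measure// lee_fin.
Qed.

End CondCentred.

(** * Projected subgradient steps *)

Section Averages.
Context {R : realType} {d : nat}.
Implicit Types (x y z : 'rV[R]_d) (D : set 'rV[R]_d) (h : 'rV[R]_d -> R).

Let mean (x : nat -> 'rV[R]_d) n : 'rV[R]_d := n%:R^-1 *: \sum_(k < n) x k.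

Let meanS (x : nat -> 'rV[R]_d) n :
  mean x n.+2 = (n.+1%:R / n.+2%:R) *: mean x n.+1 + (1 - n.+1%:R / n.+2%:R) *: x n.+1.
Proof.
rewrite /mean big_ord_recr /= scalerDr scalerA -[n.+2%:R]natr1.
have : 0 < n.+1%:R :> R by rewrite ltr0n.
move: (n.+1%:R) => a a0; congr (_ *: _ + _ *: _).
  by field; apply/andP; split; apply: lt0r_neq0; lra.
by field; apply: lt0r_neq0; lra.
Qed.

Let weight_in01 (n : nat) : 0 <= (n.+1%:R / n.+2%:R : R) <= 1.
Proof. by rewrite divr_ge0//= ler_pdivrMr ?ltr0n// mul1r ler_nat. Qed.

(** The mean of [n.+2] points is a convex combination of the mean of the first
    [n.+1] and the last one; [convex_mean_le] uses the same decomposition. *)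
Lemma mean_in D (x : nat -> 'rV[R]_d) n : convex_set D -> (0 < n)%N ->
  (forall k, (k < n)%N -> D (x k)) -> D (n%:R^-1 *: \sum_(k < n) x k).
Proof.
move=> cD; case: n => // n _; rewrite -/(mean x n.+1); elim: n => [|n IH] Dx.
  by rewrite /mean big_ord_recr big_ord0 /= add0r invr1 scale1r; exact: Dx.
rewrite meanS; apply: ((convex_setP D).1 cD) => //; last exact: Dx.
by apply: IH => k kn; apply: Dx; exact: leqW.
Qed.

Lemma convex_mean_le D h (x : nat -> 'rV[R]_d) n : convex_set D ->
  convex_function D h -> (0 < n)%N -> (forall k, (k < n)%N -> D (x k)) ->
  h (n%:R^-1 *: \sum_(k < n) x k) <= n%:R^-1 * \sum_(k < n) h (x k).
Proof.
move=> cD ch; case: n => // n _; rewrite -/(mean x n.+1); elim: n => [|n IH] Dx.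
  by rewrite /mean !big_ord_recr !big_ord0 /= !add0r invr1 scale1r mul1r.
have Dx' k : (k < n.+1)%N -> D (x k) by move=> kn; apply: Dx; exact: ltnW.
rewrite meanS; apply: le_trans ((convex_functionP D h).1 ch _ _ _ (weight_in01 n) _ _) _.
- exact: mean_in cD (ltn0Sn n) Dx'.
- exact: Dx.
rewrite big_ord_recr /= mulrDr; apply: lerD.
  have := ler_wpM2l (proj1 (andP (weight_in01 n))) (IH Dx').
  rewrite mulrA; congr (_ <= _); congr (_ * _).
  rewrite -[n.+2%:R]natr1; have : 0 < n.+1%:R :> R by rewrite ltr0n.
  by move: (n.+1%:R) => a a0; field; apply/andP; split; apply: lt0r_neq0; lra.
rewrite le_eqVlt; apply/orP; left; apply/eqP; congr (_ * _).
rewrite -[n.+2%:R]natr1; have : 0 < n.+1%:R :> R by rewrite ltr0n.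
by move: (n.+1%:R) => a a0; field; apply: lt0r_neq0; lra.
Qed.

End Averages.

Section ProjectedSteps.
Context {R : realType} {d : nat}.
Implicit Types (x y : 'rV[R]_d).

Lemma projB_in x : unit_ball (projB x).
Proof.
rewrite projBE; apply: eproj_in; last by exists 0; rewrite /unit_ball /= enorm0.
exact: closed_sub_ball_compact (@unit_ball_closed _ _) _.
Qed.

Lemma projB_continuous : continuous (@projB R d).
Proof.
rewrite projBE; apply: eproj_continuous.
- exact: unit_ball_convex.
- exact: closed_sub_ball_compact (@unit_ball_closed _ _) _.
- by exists 0; rewrite /unit_ball /= enorm0.
Qed.

Lemma projB_id x : unit_ball x -> projB x = x.
Proof.
rewrite projBE; apply: eproj_id.
- exact: unit_ball_convex.
- exact: closed_sub_ball_compact (@unit_ball_closed _ _) _.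
- by exists 0; rewrite /unit_ball /= enorm0.
Qed.

Lemma projB_dist_le x y : unit_ball y -> enorm (projB x - y) ^+ 2 <= enorm (x - y) ^+ 2.
Proof.
move=> By; rewrite projBE (enormB _ y) (enormB x).
have := eproj_growth (@unit_ball_convex R d)
  (closed_sub_ball_compact (@unit_ball_closed R d) (@subset_refl _ _))
  (ex_intro _ y By) x By.
have := sqr_ge0 (enorm (eproj unit_ball x - x)).
by move: (enorm _ ^+ 2) (enorm _ ^+ 2) (enorm _ ^+ 2) => *; lra.
Qed.

(** Telescopes to the logarithmic bound on the sum of the step lengths. *)
Lemma ln_succ_ge (n : nat) : n.+2%:R^-1 <= ln n.+2%:R - ln n.+1%:R :> R.
Proof.
have n1 : 0 < n.+1%:R :> R by rewrite ltr0n.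
have n2 : 0 < n.+2%:R :> R by rewrite ltr0n.
have h : ln (n.+1%:R / n.+2%:R) <= - n.+2%:R^-1 :> R.
  have -> : n.+1%:R / n.+2%:R = 1 + (- n.+2%:R^-1) :> R.
    rewrite -[n.+2%:R]natr1; move: n1; move: (n.+1%:R) => a a0.
    by field; apply: lt0r_neq0; lra.
  apply: le_ln1Dx; rewrite ltrN2 invf_lt1// ltr1n//.
by rewrite -opprB lerNr -ln_div ?posrE.
Qed.

Lemma sqr_enormB x y : enorm (x - y) ^+ 2 = enorm x ^+ 2 - 2 * edot y x + enorm y ^+ 2.
Proof. rewrite !sqr_enorm !edotE (edotC x y); ring. Qed.

(** The steps [2 / (m * (k + 2))] make the squared distances to [y] telescope
    against half of the strong-convexity gain; the other half remains in the sum
    and will absorb the noise. *)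
Lemma psm_regret (m G : R) (K : nat) (z h : nat -> 'rV[R]_d) y :
  0 < m -> unit_ball (z 0%N) -> unit_ball y ->
  (forall k, (k < K)%N -> z k.+1 = projB (z k - (2 / (m * k.+2%:R)) *: h k)) ->
  (forall k, (k < K)%N -> enorm (h k) <= G) ->
  \sum_(k < K) (edot (h k) (z k - y) - m / 4 * enorm (z k - y) ^+ 2) <=
  m + G ^+ 2 / m * ln K.+1%:R.
Proof.
move=> m0 Bz By zS hG.
suff H : \sum_(k < K) (edot (h k) (z k - y) - m / 4 * enorm (z k - y) ^+ 2) <=
    m / 4 * enorm (z 0%N - y) ^+ 2 - m * K.+1%:R / 4 * enorm (z K - y) ^+ 2 +
    G ^+ 2 / m * ln K.+1%:R.
  apply: le_trans H _.
  have h1 : enorm (z 0%N - y) ^+ 2 <= 4.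
    have := unit_ball_dist Bz By; have := enorm_ge0 (z 0%N - y).
    by move: (enorm _) => a; nra.
  have h2 : 0 <= m * K.+1%:R / 4 * enorm (z K - y) ^+ 2.
    by rewrite mulr_ge0 ?sqr_ge0// divr_ge0// mulr_ge0// ltW.
  have h3 : m / 4 * enorm (z 0%N - y) ^+ 2 <= m.
    have := ler_wpM2l (ltW m0) h1; move: (enorm _ ^+ 2) => a; lra.
  by rewrite lerD2r; move: h2 h3; move: (_ * _) (_ * _) => *; lra.
elim: K zS hG => [|K IH] zS hG.
  by rewrite big_ord0 ln1 mulr0 mulr1 addr0 subrr.
rewrite big_ord_recr /=.
have {}IH := IH (fun k kK => zS k (ltnW kK)) (fun k kK => hG k (ltnW kK)).
have K2 : 0 < K.+2%:R :> R by rewrite ltr0n.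
set D := enorm (z K - y) ^+ 2; set D' := enorm (z K.+1 - y) ^+ 2.
have step : edot (h K) (z K - y) <= m * K.+2%:R / 4 * (D - D') + G ^+ 2 / m * K.+2%:R^-1.
  have eta0 : 0 < 2 / (m * K.+2%:R) by rewrite divr_gt0 ?mulr_gt0.
  have : D' <= enorm ((z K - (2 / (m * K.+2%:R)) *: h K) - y) ^+ 2.
    by rewrite /D' zS//; exact: projB_dist_le.
  rewrite addrAC sqr_enormB edotZl -/D enormZ exprMn real_normK ?num_real//.
  have : enorm (h K) ^+ 2 <= G ^+ 2.
    by rewrite lerXn2r ?nnegrE ?enorm_ge0 ?(le_trans (enorm_ge0 _) (hG K _)) ?hG.
  move: (edot _ _) (enorm (h K) ^+ 2) (G ^+ 2) => e N G2 hN hD.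
  set eta := 2 / (m * K.+2%:R) in eta0 hD.
  have -> : m * K.+2%:R / 4 = (2 * eta)^-1.
    by rewrite /eta; field; rewrite !gt_eqF ?mulr_gt0.
  have -> : G2 / m * K.+2%:R^-1 = eta * G2 / 2.
    by rewrite /eta; field; rewrite !gt_eqF ?mulr_gt0.
  clearbody eta; rewrite -(ler_pM2l (_ : 0 < 2 * eta)) ?mulr_gt0//.
  rewrite [leRHS]mulrDr mulVKf ?gt_eqF ?mulr_gt0//.
  have := ler_wpM2l (ltW eta0) (ler_wpM2l (ltW eta0) hN).
  have -> : 2 * eta * (eta * G2 / 2) = eta * (eta * G2) by field.
  rewrite -(mulrA 2 eta e); move: hD; rewrite expr2 -mulrA.
  move: (eta * e) (eta * (eta * G2)) (eta * (eta * N)) => p q r; lra.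
have hln := ler_wpM2l (_ : 0 <= G ^+ 2 / m) (ln_succ_ge K).
have {}hln := hln (divr_ge0 (sqr_ge0 G) (ltW m0)).
have e2 : m * K.+2%:R / 4 = m * K.+1%:R / 4 + m / 4 by rewrite -[K.+2%:R]natr1; field.
apply: le_trans (lerD IH (lerB step (lexx _))) _.
move: hln; rewrite mulrBr -/D e2.
move: (_ * ln _) (_ * ln _) (_ * K.+2%:R^-1) (m * _ / 4) (m / 4) (_ * enorm _ ^+ 2).
by move=> a b c p q s h1; rewrite mulrBr !mulrDl; lra.
Qed.

End ProjectedSteps.

(** * The penalized proximal step *)

(** The last step of [inexact_step], over scalars: [Fx] and [Fz] are the
    penalized values at the two iterates, [Hz] and [HQ] those of the proximal
    objective, [ph] its unpenalized minimum over [C]. *)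
Fact inexact_chain (R : realDomainType) (Fx Fz Hz HQ ph n u c : R) :
  HQ <= ph + c -> ph + n <= Fx -> Fz <= Hz -> Hz <= HQ + u ->
  Fz <= Fx - n + (u + c).
Proof. lra. Qed.

Section Problem.
Context {R : realType} {d : nat}.
Variables (f g : 'rV[R]_d -> R) (U : set 'rV[R]_d) (l Gf Gg sigma gam : R).
Let C : set 'rV[R]_d := [set x | g x <= 0].
Let B : set 'rV[R]_d := unit_ball.
Hypothesis closedC : closed C.
Hypothesis CB : C `<=` B.
Hypothesis C0 : C !=set0.
Hypothesis openU : open U.
Hypothesis BU : B `<=` U.
Hypothesis l0 : 0 < l.
Hypothesis Gf0 : 0 < Gf.
Hypothesis wcf : weakly_convex_on U l f.
Hypothesis lipf : euclidean_lipschitz U Gf f.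
Hypothesis sigma0 : 0 < sigma.
Hypothesis cvxg : convex_function U g.
Hypothesis C1g : C1_on U g.
Hypothesis grad_active : forall z, B z -> g z = 0 -> sigma <= enorm (grad g z).
Hypothesis gam0 : 0 < gam.
Implicit Types x y z : 'rV[R]_d.

Let lam := lambda0 l Gf sigma.
Let p := softplus gam lam.
Let GF := G_F l Gf.
Local Notation Q := (prox_point f C l).
Local Notation PC := (eproj C).
Local Notation H := (penalized_objective f g p (2 * l)).
Local Notation phi := (prox_objective f l).

Let GF0 : 0 < GF. Proof. by rewrite /GF /G_F addr_gt0// mulr_gt0. Qed.
Let lam0 : 0 < lam. Proof. by rewrite /lam /lambda0 divr_gt0// mulr_gt0. Qed.
Let CU : C `<=` U. Proof. by move=> x /CB/BU. Qed.
Let diffg x : U x -> differentiable g x. Proof. by move=> /C1g[]. Qed.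

Lemma feasible_convex : convex_set C.
Proof.
apply/convex_setP => t x y t01 Cx Cy; have /andP[t0 t1] := t01.
have := (convex_functionP U g).1 cvxg t x y t01 (CU Cx) (CU Cy).
move: Cx Cy; rewrite /C /= => gx gy h; apply: le_trans h _.
have h1 : 0 <= t * - g x by rewrite mulr_ge0// oppr_ge0.
have h2 : 0 <= (1 - t) * - g y by rewrite mulr_ge0 ?oppr_ge0// subr_ge0.
by move: h1 h2; rewrite !mulrN; move: (t * _) (_ * g y) => *; lra.
Qed.

Lemma feasible_compact : compact C.
Proof. exact: closed_sub_ball_compact. Qed.

Let wcfC : weakly_convex_on C l f.
Proof.
by apply/weakly_convexP => t x y t01 /CU Ux /CU Uy; exact: (weakly_convexP U l f).1.
Qed.

Let fcont x : C x -> {for x, continuous f}.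
Proof. by move=> /CU Ux; exact: euclidean_lipschitz_continuous openU Ux lipf. Qed.

Let l2 : l < 2 * l. Proof. by rewrite mulr_natl mulr2n ltrDr. Qed.

Lemma feasible_prox_argmin x : argmin C (phi x) (Q x).
Proof. by apply: prox_pointP; [exact: feasible_compact|exact: C0|exact: fcont]. Qed.

Lemma feasible_prox_in x : C (Q x). Proof. by have [] := feasible_prox_argmin x. Qed.

Lemma feasible_prox_unique x y : argmin C (phi x) y -> y = Q x.
Proof.
exact: (prox_point_unique l2 feasible_convex feasible_compact C0 fcont wcfC).
Qed.

Let l_half : l - l / 2 = l / 2. Proof. by field. Qed.

Lemma feasible_prox_growth x z : C z -> phi x (Q x) + l / 2 * enorm (z - Q x) ^+ 2 <= phi x z.
Proof.
move=> Cz; rewrite -l_half.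
exact: (prox_point_growth l feasible_convex feasible_compact C0 fcont wcfC).
Qed.

Lemma feasible_prox_lipschitz x y : enorm (Q x - Q y) <= 2 * enorm (x - y).
Proof.
have := prox_point_lipschitz l0 l2 feasible_convex feasible_compact C0 fcont wcfC x y.
by rewrite l_half (_ : l / (l / 2) = 2)//; field; rewrite gt_eqF.
Qed.

Lemma feasible_prox_continuous : continuous Q.
Proof. exact: lipschitz_continuous feasible_prox_lipschitz. Qed.

Lemma feasible_stationarityE x :
  differentiable (envelope f C l) x /\
  stationarity f C l x = 2 * l * enorm (x - Q x).
Proof.
exact: (stationarityE l0 l2 feasible_convex feasible_compact C0 fcont wcfC).
Qed.

Lemma feasible_proj_in x : C (PC x). Proof. exact: eproj_in feasible_compact C0 x. Qed.

Lemma feasible_proj_continuous : continuous PC.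
Proof. exact: eproj_continuous feasible_convex feasible_compact C0. Qed.

Lemma stationarity_continuous : continuous (stationarity f C l).
Proof.
have -> : stationarity f C l = fun x => 2 * l * enorm (x - Q x).
  by apply/funext => x; exact: (feasible_stationarityE x).2.
move=> x; have h : enorm (y - Q y) @[y --> x] --> enorm (x - Q x).
  apply: (enorm_cvg (nbhs_filter x)); apply: cvgB; first exact: cvg_id.
  exact: feasible_prox_continuous.
exact: (@cvgM _ _ _ (nbhs_filter x) (fun=> 2 * l) _ _ _ (cvg_cst _) h).
Qed.

Lemma penalty_convex : convex_function U (p \o g).
Proof. exact: softplus_comp_convex. Qed.

Lemma penalized_strongly_convex x : strongly_convex_on B l (H x).
Proof.
apply/convex_functionP => t y z t01 /BU Uy /BU Uz.
have h1 := (weakly_convexP U l f).1 wcf t y z t01 Uy Uz.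
have h2 := (convex_functionP U (p \o g)).1 penalty_convex t y z t01 Uy Uz.
rewrite /penalized_objective conv_dist !sqr_enorm_conv.
rewrite (_ : y - x - (z - x) = y - z); last by rewrite opprB addrA subrK.
move: h1 h2; rewrite /= (_ : 2 * l / 2 = l); last by field.
move: (f _) (f _) (f _) (p _) (p _) (p _) => a1 a2 a3 b1 b2 b3.
move: (enorm _ ^+ 2) (enorm _ ^+ 2) (enorm _ ^+ 2) (enorm _ ^+ 2) (enorm _ ^+ 2).
by move=> e1 e2 e3 e4 e5 h1 h2; lra.
Qed.

Lemma penalized_convex x : convex_function B (H x).
Proof.
have := penalized_strongly_convex x; rewrite /strongly_convex_on => /convex_functionP h.
apply/convex_functionP => t y z t01 By Bz; have := h t y z t01 By Bz.
rewrite sqr_enorm_conv; have /andP[t0 t1] := t01.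
have : 0 <= l / 2 * (t * (1 - t) * enorm (y - z) ^+ 2).
  rewrite mulr_ge0 ?divr_ge0 ?(ltW l0)//.
  by apply: mulr_ge0; [rewrite mulr_ge0 ?subr_ge0|exact: sqr_ge0].
move: (H x _) (H x _) (H x _) => a1 a2 a3.
move: (enorm _ ^+ 2) (enorm _ ^+ 2) (enorm _ ^+ 2) => e1 e2 e3.
by move=> h1 h2; lra.
Qed.

(** The proximal quadratic contributes [l * enorm (z - y) ^+ 2], of which weak
    convexity of [f] consumes one half. *)
Lemma penalized_subgrad x y z v : B y -> B z -> limiting_subdiff f z v ->
  H x z - H x y <=
  edot (v + (2 * l) *: (z - x) + grad (p \o g) z) (z - y)
    - l / 2 * enorm (z - y) ^+ 2.
Proof.
move=> /BU Uy /BU Uz hv.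
have h1 := limiting_subdiff_ineq (ltW l0) wcf openU Uz Uy hv.
have h2 := convex_grad_ineq penalty_convex (@softplus_comp_diff _ gam lam gam0 _ g z (diffg Uz)).1 Uz Uy.
move: h1 h2; rewrite /penalized_objective /= -/p (enormB y z) -(opprB z y) !edotNr !edotDl edotZl.
have -> : y - x = (z - x) - (z - y) by rewrite opprB [_ + (y - z)]addrC subrKA.
rewrite (sqr_enormB (z - x) (z - y)) (edotC (z - y) (z - x)) (_ : 2 * l / 2 = l); last by field.
move: (edot v _) (edot (z - x) _) (edot (grad _ _) _) (enorm _ ^+ 2) (enorm _ ^+ 2).
move: (f _) (f _) (p _) (p _) => a1 a2 b1 b2 e1 e2 e3 N1 N2; lra.
Qed.

Lemma penalty_feasible y : C y -> p (g y) <= gam * ln 2.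
Proof. exact: softplus_le. Qed.

(** [lambda0] is such that [error_bound] yields twice the Lipschitz constant [GF]
    of the proximal objective: one half pays for the move to [PC z] in
    [penalized_ge], the other half bounds the distance to [C]. *)
Lemma penalty_dist z : B z -> 2 * GF * enorm (z - PC z) <= p (g z).
Proof.
move=> Bz; have [gz|gz] := leP (g z) 0.
  rewrite (eproj_id feasible_convex feasible_compact C0 (gz : C z)).
  by rewrite subrr enorm0 mulr0 softplus_ge0.
apply: le_trans (_ : lam * g z <= _); last exact: softplus_ge.
have active y : C y -> g y = 0 -> sigma <= enorm (grad g y).
  by move=> /CB; exact: grad_active.
have h := error_bound feasible_convex feasible_compact C0 CU cvxg diffg sigma0 active (BU Bz) gz.
apply: le_trans (ler_wpM2l (ltW lam0) h).
rewrite /lam /lambda0 -/(G_F l Gf) -/GF le_eqVlt; apply/orP; left; apply/eqP.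
by field; rewrite gt_eqF.
Qed.

Lemma prox_objective_lipschitz x y z : B x -> B y -> B z ->
  phi x y <= phi x z + GF * enorm (z - y).
Proof.
move=> Bx By Bz; rewrite /prox_objective.
have h1 := lipf (BU By) (BU Bz); rewrite enormB ler_norml in h1.
have h2 : enorm (y - x) <= enorm (z - x) + enorm (z - y).
  by have := ler_enorm_dist z y x; rewrite (enormB y z); lra.
have h3 := unit_ball_dist By Bx; have h4 := unit_ball_dist Bz Bx.
have := enorm_ge0 (y - x); have := enorm_ge0 (z - x); have := enorm_ge0 (z - y).
move: h1 h2 h3 h4; rewrite /GF /G_F.
move: (enorm (y - x)) (enorm (z - x)) (enorm (z - y)) => a b c.
move=> /andP[_ h1] h2 h3 h4 c0 b0 a0.
have h5 : a ^+ 2 - b ^+ 2 <= 4 * c.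
  have [ab|ab] := leP a b.
    by rewrite (@le_trans _ _ 0) ?mulr_ge0// subr_le0 lerXn2r.
  rewrite subr_sqr mulrC; apply: (@le_trans _ _ (4 * (a - b))).
    by rewrite ler_wpM2r ?subr_ge0 1?ltW//; lra.
  by rewrite ler_pM2l//; lra.
have h6 : l * (a ^+ 2 - b ^+ 2) <= l * (4 * c) by rewrite ler_pM2l.
move: h1 h6; rewrite mulrBr (mulrDl Gf (4 * l) c) -(mulrA 4 l c) (mulrCA l 4 c).
by move: (f y) (f z) (l * c) (Gf * c) (l * _) (l * _) => *; lra.
Qed.

(** Exactness of the penalty, up to its small cost on [C]: what can be gained by
    leaving [C] is worth less than the penalty paid there. *)
Lemma penalized_ge x z : B x -> B z ->
  phi x (PC z) + GF * enorm (z - PC z) <= H x z.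
Proof.
move=> Bx Bz; have h1 := penalty_dist Bz.
have h2 := prox_objective_lipschitz Bx (CB (feasible_proj_in z)) Bz.
rewrite /penalized_objective (_ : 2 * l / 2 = l); last by field.
move: h1 h2; rewrite {2}/prox_objective.
by move: (p _) (enorm (z - PC z)) (phi x _) (l * _) => *; lra.
Qed.

Let F z : R := f z + p (g z).

Lemma penalized_self x : H x x = F x.
Proof. by rewrite /penalized_objective subrr enorm0 expr0n /= mulr0 addr0. Qed.

Lemma penalized_prox_le x : H x (Q x) <= phi x (Q x) + gam * ln 2.
Proof.
have := penalty_feasible (feasible_prox_in x).
rewrite /penalized_objective /prox_objective (_ : 2 * l / 2 = l); last by field.
by move: (p _) (l * _) => *; lra.
Qed.

(** The growth of the proximal objective at its minimizer, tested at the
    projection of [x]. This turns progress in [F] into stationarity. *)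
Lemma penalized_value_ge x : B x -> phi x (Q x) + l / 2 * enorm (PC x - Q x) ^+ 2 <= F x.
Proof.
move=> Bx; rewrite -penalized_self.
have h1 := penalized_ge Bx Bx; have h2 := feasible_prox_growth x (feasible_proj_in x).
have h3 : 0 <= GF * enorm (x - PC x) by rewrite mulr_ge0 ?enorm_ge0// ltW.
by move: h1 h2 h3; move: (GF * _) (H x x) (phi _ _) (phi _ _) (_ * _ ^+ 2) => *; lra.
Qed.

(** [Q x] is feasible, hence costs at most [gam * ln 2] in penalty. Comparing [z]
    with it in [penalized_ge] shows that [z] is almost feasible, and comparing both
    with [F x] by [penalized_value_ge] gives descent. *)
Lemma inexact_step x z u : B x -> B z -> H x z <= H x (Q x) + u ->
  GF * enorm (z - PC z) <= u + gam * ln 2 /\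
  F z <= F x - l / 2 * enorm (PC x - Q x) ^+ 2 + (u + gam * ln 2).
Proof.
move=> Bx Bz hz.
have h1 := penalized_ge Bx Bz; have h2 := penalized_prox_le x.
have [_ /(_ _ (feasible_proj_in z)) h3] := feasible_prox_argmin x; have h4 := penalized_value_ge Bx.
split.
  move: h1 h2 h3 hz.
  by move: (GF * _) (H x z) (H x _) (phi _ _) (phi _ _) => *; lra.
have h5 : F z <= H x z.
  rewrite /penalized_objective -/(F z) lerDl (_ : 2 * l / 2 = l); last by field.
  by rewrite mulr_ge0 ?sqr_ge0// ltW.
exact: inexact_chain h2 h4 h5 hz.
Qed.

(** [stationarity] measures the distance of [PC x] to its own proximal point,
    which is within twice [enorm (x - PC x)] of [Q x]. *)
Lemma stationarity_proj_le x :
  stationarity f C l (PC x) <=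
  2 * l * (enorm (PC x - Q x) + 2 * enorm (x - PC x)).
Proof.
rewrite (feasible_stationarityE _).2 ler_pM2l ?mulr_gt0//.
apply: le_trans (ler_enorm_dist (Q x) _ _) _; rewrite lerD2l.
exact: feasible_prox_lipschitz.
Qed.

Lemma minval_ball_le x : B x -> minval B f <= f x.
Proof.
move=> Bx; apply: ge_inf; last by exists x.
exists (f x - Gf * 2) => _ [y By <-].
have := lipf (BU Bx) (BU By); rewrite ler_norml => /andP[_ h].
have := ler_wpM2l (ltW Gf0) (unit_ball_dist Bx By).
by move: h; move: (_ * enorm _) => *; lra.
Qed.

(** Telescopes [inexact_step]. The starting point is feasible, so [F] exceeds [f]
    there by [gam * ln 2] at most; the term of the last iterate is not covered by a
    descent step and comes from [penalized_value_ge]. *)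
Lemma descent_sum (x : nat -> 'rV[R]_d) (T : nat) (u : R) :
  (0 < T)%N -> (forall t, (t <= T)%N -> B (x t)) -> C (x 0%N) -> 0 <= u ->
  (forall t, (t < T)%N -> H (x t) (x t.+1) <= H (x t) (Q (x t)) + u) ->
  l / 2 * \sum_(t < T) enorm (PC (x t.+1) - Q (x t.+1)) ^+ 2 <=
  f (x 0%N) - minval B f + T.+1%:R * (u + gam * ln 2).
Proof.
move=> T0 Bx Cx u0 hx; set e := u + _.
have e0 : gam * ln 2 <= e by rewrite /e lerDr.
pose b t := l / 2 * enorm (PC (x t) - Q (x t)) ^+ 2.
have b0 t : 0 <= b t by rewrite mulr_ge0 ?sqr_ge0// divr_ge0// ltW.
have step t : (t < T)%N -> F (x t.+1) <= F (x t) - b t + e.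
  by move=> tT; have [] := inexact_step (Bx _ (ltnW tT)) (Bx _ tT) (hx _ tT).
have key n : (n < T)%N ->
    F (x n.+1) + \sum_(t < n) b t.+1 <= f (x 0%N) + n.+2%:R * e.
  elim: n => [_|n IH nT].
    rewrite big_ord0 addr0; have := step 0%N T0; have := penalty_feasible Cx.
    by have := b0 0%N; rewrite /F; move: (p _) (p _) (f _) (f _) (b 0%N) => *; lra.
  have e3 : n.+3%:R * e = n.+2%:R * e + e by rewrite -[in LHS]natr1 mulrDl mul1r.
  have := step _ nT; have := IH (ltnW nT); rewrite big_ord_recr /= e3.
  by move: (F _) (F _) (b _) (\sum_(t < n) _) (_ * e) => *; lra.
case: T T0 Bx hx step key => // T _ Bx hx step key.
have h1 : phi (x T.+1) (Q (x T.+1)) + b T.+1 <= F (x T.+1) by exact: penalized_value_ge (Bx T.+1 (leqnn _)).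
have h2 : minval B f <= phi (x T.+1) (Q (x T.+1)).
  apply: le_trans (minval_ball_le (CB (feasible_prox_in (x T.+1)))) _.
  by rewrite /prox_objective lerDl mulr_ge0 ?sqr_ge0// ltW.
have -> : l / 2 * \sum_(t < T.+1) enorm (PC (x t.+1) - Q (x t.+1)) ^+ 2 =
    \sum_(t < T.+1) b t.+1 by rewrite mulr_sumr.
rewrite big_ord_recr /=; have := key T (ltnSn T); move: h1 h2.
by move: (F _) (b _) (phi _ _) (\sum_(i < T) _) (_ * e) => *; lra.
Qed.

(** Markov's inequality for the sum in [descent_sum]. The two bounds in [e_star]
    have different roles: the second makes the distance to [C] at most
    [eps / (60 * l)], so that an iterate whose projection is not [eps]-stationary
    has [l * enorm (PC x - Q x)] at least [7 / 15 * eps]; the first keeps the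
    accumulated errors below the descent that [T / 6] such iterates would cause. *)
Lemma few_nonstationary (x : nat -> 'rV[R]_d) (T : nat) (u eps : R) :
  0 < eps -> (1 < T)%N -> (forall t, (t <= T)%N -> B (x t)) -> C (x 0%N) -> 0 <= u ->
  1000 * l * (f (x 0%N) - minval B f) / eps ^+ 2 <= T%:R ->
  u + gam * ln 2 <= e_star l Gf eps ->
  (forall t, (t < T)%N -> H (x t) (x t.+1) <= H (x t) (Q (x t)) + u) ->
  \sum_(t < T) ((eps < stationarity f C l (PC (x t.+1)))%R)%:R <= T%:R / 6 :> R.
Proof.
move=> eps0 T1 Bx Cx u0 hT he hx.
have T0 : (0 < T)%N by exact: ltnW.
have hsum := descent_sum T0 Bx Cx u0 hx.
move: he; rewrite /e_star le_min => /andP[e1 e2].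
set e := u + _ in e1 e2 hsum; have ee : u + gam * ln 2 = e by [].
clearbody e; set Del := f _ - _ in hT hsum.
have eps2 : 0 < eps ^+ 2 by rewrite exprn_gt0.
have l20 : 0 < l ^+ 2 by rewrite exprn_gt0.
have bad t : (t < T)%N ->
    ((eps < stationarity f C l (PC (x t.+1)))%R)%:R <=
    5 * l ^+ 2 / eps ^+ 2 * enorm (PC (x t.+1) - Q (x t.+1)) ^+ 2 :> R.
  move=> tT; case: (ltP eps _) => /= hS; last first.
    by rewrite mulr_ge0 ?sqr_ge0// divr_ge0 ?mulr_ge0// ltW.
  have := stationarity_proj_le (x t.+1).
  have [hr _] := inexact_step (Bx _ (ltnW tT)) (Bx _ tT) (hx _ tT).
  rewrite ee in hr.
  have {hS} hS' := lt_le_trans hS.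
  move=> /hS' {hS'}; set b := enorm (PC _ - _); set r := enorm (_ - PC _) in hr *.
  move=> hS.
  have hr2 : r <= eps / (60 * l).
    rewrite -(ler_pM2l GF0); apply: le_trans hr _; apply: le_trans e2 _.
    by rewrite -/GF mulrA.
  have lr : l * r <= eps / 60.
    apply: le_trans (ler_wpM2l (ltW l0) hr2) _.
    by rewrite le_eqVlt; apply/orP; left; apply/eqP; field; rewrite gt_eqF.
  (* eps <= 2 * l * b + 4 * l * r, and 4 * l * r <= eps / 15 *)
  have lb : 7 / 15 * eps <= l * b.
    by move: hS; rewrite -mulrA mulrDr (mulrCA l 2); lra.
  have h1 : (7 / 15 * eps) ^+ 2 <= (l * b) ^+ 2.
    rewrite lerXn2r ?nnegrE//; first by rewrite mulr_ge0 ?divr_ge0// ltW.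
    by rewrite mulr_ge0 ?enorm_ge0// ltW.
  rewrite mulrAC ler_pdivlMr// mul1r -mulrA -exprMn.
  have e49 : (7 / 15 * eps) ^+ 2 = 49 / 225 * eps ^+ 2 by field.
  by move: h1; rewrite e49; move: ((l * b) ^+ 2) (eps ^+ 2) eps2 => *; lra.
apply: le_trans (ler_sum _ (fun (t : 'I_T) _ => bad t (ltn_ord t))) _.
rewrite -mulr_sumr; move: hsum; move: (\sum_(t < T) _) => S hsum.
have hD : 1000 * (l * Del) <= T%:R * eps ^+ 2 by rewrite -ler_pdivrMr// mulrA.
have hl : l * e <= eps ^+ 2 / 4000.
  apply: le_trans (ler_wpM2l (ltW l0) e1) _.
  by rewrite le_eqVlt; apply/orP; left; apply/eqP; field; rewrite gt_eqF.
have hT1 : T.+1%:R <= 3 / 2 * T%:R :> R.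
  have : 2 <= T%:R :> R by rewrite ler_nat.
  by rewrite -[T.+1%:R]natr1; move: (T%:R) => *; lra.
have hTe' : T.+1%:R * (l * e) <= 3 / 2 * T%:R * (eps ^+ 2 / 4000).
  apply: le_trans (ler_wpM2l (ler0n _ _) hl) _.
  apply: ler_wpM2r; last exact: hT1.
  by move: eps2; move: (eps ^+ 2) => E E0; lra.
have hS : l ^+ 2 * S <= 2 * (l * Del) + 2 * (T.+1%:R * (l * e)).
  have := ler_wpM2l (ltW l0) hsum.
  have -> : l * (l / 2 * S) = l ^+ 2 * S / 2 by field.
  have -> : l * (Del + T.+1%:R * e) = l * Del + T.+1%:R * (l * e).
    by rewrite (mulrDr l) (mulrCA l).
  by move: (l ^+ 2 * S) (l * Del) (T.+1%:R * (l * e)) => *; lra.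
rewrite mulrAC ler_pdivrMr// -mulrA.
have e5 : 3 / 2 * T%:R * (eps ^+ 2 / 4000) = 3 / 8000 * (T%:R * eps ^+ 2) by field.
have e6 : T%:R / 6 * eps ^+ 2 = (T%:R * eps ^+ 2) / 6 by field.
rewrite e5 in hTe'; rewrite e6.
have TE0 : 0 <= T%:R * eps ^+ 2 by rewrite mulr_ge0 ?sqr_ge0.
move: hD hTe' hS TE0.
move: (l ^+ 2 * S) (l * Del) (T.+1%:R * (l * e)) (T%:R * eps ^+ 2) => *; lra.
Qed.

Hypothesis Gg0 : 0 < Gg.
Hypothesis grad_le : forall z, B z -> enorm (grad g z) <= Gg.
Let GH := G_H l Gf Gg sigma.

Let oracle_dir (x w z : 'rV[R]_d) : 'rV[R]_d :=
  w + (2 * l) *: (z - x) + grad (p \o g) z.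

Lemma oracle_dir_le x w z : B x -> B z -> enorm w <= Gf ->
  enorm (oracle_dir x w z) <= GH.
Proof.
move=> Bx Bz hw.
have h1 : enorm ((2 * l) *: (z - x)) <= 4 * l.
  have := unit_ball_dist Bz Bx; rewrite enormZ gtr0_norm ?mulr_gt0//.
  move=> /(ler_wpM2l (ltW l0)); move: (enorm _) => a h; lra.
have h2 : enorm (grad (p \o g) z) <= lam * Gg.
  by apply: softplus_comp_grad_le => //; [exact: diffg (BU Bz)|exact: grad_le].
apply: le_trans (ler_enormD _ _) _; rewrite /GH /G_H; apply: lerD => //.
by apply: le_trans (ler_enormD _ _) _; exact: lerD.
Qed.

(** [v k - vt k] is the noise of the oracle. Half of the strong-convexity gain of
    each step has paid for the telescoping in [psm_regret]; the other half enters
    the hypothesis on the noise. *)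
Lemma psm_accuracy x y (z vt v : nat -> 'rV[R]_d) (K : nat) (delta : R) :
  (0 < K)%N -> B x -> B y -> z 0%N = x ->
  (forall k, z k.+1 =
     projB (z k - (2 / (l * k.+2%:R)) *: oracle_dir x (vt k) (z k))) ->
  (forall k, (k < K)%N -> enorm (vt k) <= Gf) ->
  (forall k, (k < K)%N -> limiting_subdiff f (z k) (v k)) ->
  0 < delta <= 1 ->
  \sum_(k < K) (edot (v k - vt k) (z k - y) - l / 4 * enorm (z k - y) ^+ 2) <=
    2 * Gf ^+ 2 / l * ln (1 / delta) ->
  H x (K%:R^-1 *: \sum_(k < K) z k) <= H x y + U_ K l GH delta.
Proof.
move=> K0 Bx By z0 zS hvt hv /andP[d0 d1] hnoise.
have Bz k : B (z k) by case: k => [|k]; [rewrite z0|rewrite zS; exact: projB_in].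
have KR : 0 < K%:R :> R by rewrite ltr0n.
have reg := psm_regret l0 (Bz 0%N) By (fun k _ => zS k)
  (fun k kK => oracle_dir_le Bx (Bz k) (hvt k kK)).
have jensen := convex_mean_le (@unit_ball_convex R d) (penalized_convex x) K0 (fun k _ => Bz k).
apply: le_trans jensen _; rewrite ler_pdivrMl// mulrDr.
have -> : K%:R * U_ K l GH delta = l + GH ^+ 2 / l * (ln K.+1%:R + 2 * ln (1 / delta)).
  by rewrite /U_ mulrCA mulfV ?gt_eqF// mulr1.
have hsum : \sum_(k < K) (H x (z k) - H x y) <=
    \sum_(k < K) (edot (oracle_dir x (vt k) (z k)) (z k - y) - l / 4 * enorm (z k - y) ^+ 2) +
    \sum_(k < K) (edot (v k - vt k) (z k - y) - l / 4 * enorm (z k - y) ^+ 2).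
  rewrite -big_split /=; apply: ler_sum => k _.
  apply: le_trans (penalized_subgrad x By (Bz k) (hv k (ltn_ord k))) _.
  rewrite /oracle_dir !edotDl edotNl.
  by move: (edot _ _) (edot _ _) (edot _ _) (edot _ _) (enorm _ ^+ 2) => *; lra.
have L0 : 0 <= ln (1 / delta) by rewrite ln_ge0// div1r invf_ge1.
have GfGH : Gf <= GH.
  have := mulr_gt0 lam0 Gg0; have := l0; rewrite /GH /G_H /G_F -/lam.
  by move: (lam * Gg) => a; lra.
have GfH : Gf ^+ 2 <= GH ^+ 2.
  by rewrite lerXn2r ?nnegrE ?(ltW Gf0)// (le_trans (ltW Gf0)).
have h4 : 2 * Gf ^+ 2 / l * ln (1 / delta) <= GH ^+ 2 / l * (2 * ln (1 / delta)).
  rewrite mulrA; apply: ler_wpM2r => //; rewrite [leRHS]mulrC -[leLHS]mulrA.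
  by rewrite ler_pM2l// ler_pM2r ?invr_gt0.
move: hsum; rewrite sumrB sumr_const card_ord -[H x y *+ K]mulr_natl.
rewrite (mulrDr (GH ^+ 2 / l)).
move: hnoise reg h4; move: (\sum_(k < K) _) (\sum_(k < K) _) (\sum_(k < K) _).
set a1 := GH ^+ 2 / l * ln K.+1%:R; set a2 := GH ^+ 2 / l * (2 * ln (1 / delta)).
clearbody a1 a2; move: (2 * Gf ^+ 2 / l * _) (K%:R * H x y).
by move=> *; lra.
Qed.

End Problem.

(** * Orders of magnitude of the parameters *)

Section Orders.
Context {R : realType}.
Implicit Types l Gf Gg sigma Delta eps : R.

Lemma outer_steps_ge l Delta eps : 0 <= 1000 * l * Delta / eps ^+ 2 ->
  1000 * l * Delta / eps ^+ 2 <= (outer_steps l Delta eps)%:R.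
Proof.
rewrite /outer_steps; move: (1000 * l * Delta / eps ^+ 2) => x x0.
have c0 : (0 <= Num.ceil x) by rewrite -(ler_int R) (le_trans x0)// ceil_ge.
apply: (@le_trans _ _ (`|Num.ceil x|%N%:R)); last by rewrite ler_nat leq_maxr.
by rewrite natr_absz ger0_norm// ceil_ge.
Qed.

Lemma outer_steps_le l Delta eps : 0 <= 1000 * l * Delta / eps ^+ 2 ->
  (outer_steps l Delta eps)%:R <= 3 + 1000 * l * Delta / eps ^+ 2.
Proof.
rewrite /outer_steps; move: (1000 * l * Delta / eps ^+ 2) => x x0.
have c0 : (0 <= Num.ceil x) by rewrite -(ler_int R) (le_trans x0)// ceil_ge.
have h : `|Num.ceil x|%N%:R <= x + 1.
  rewrite natr_absz ger0_norm//; have /andP[h _] := ceil_itv x.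
  by move: h; rewrite intrD => h; lra.
have : (maxn 2 `|Num.ceil x|)%:R <= 2 + `|Num.ceil x|%N%:R :> R.
  by rewrite -natrD ler_nat geq_max leq_addr leq_addl.
move: h; lra.
Qed.

Lemma outer_steps_order :
  exists A : R, forall l Delta eps, 0 < l -> 0 <= Delta -> 0 < eps <= 1 ->
    (outer_steps l Delta eps)%:R <= A * (1 + l * Delta / eps ^+ 2).
Proof.
exists 1000 => l Delta eps l0 D0 /andP[e0 e1].
have x0 : 0 <= l * Delta / eps ^+ 2.
  by rewrite divr_ge0 ?sqr_ge0// mulr_ge0// ltW.
have x1 : 1000 * l * Delta / eps ^+ 2 = 1000 * (l * Delta / eps ^+ 2) by rewrite !mulrA.
apply: le_trans (outer_steps_le _) _; rewrite x1; first by apply: mulr_ge0; [exact: ler0n|exact: x0].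
move: x0; move: (_ / _) => x x0; lra.
Qed.

(** The number of steps has to exceed a linear function of its own logarithm; the
    logarithm being sublinear, every large constant [N] does. *)
Lemma ln_affine_bound (c C0 C1 : R) : 0 < c -> 0 <= C0 -> 0 < C1 ->
  exists2 N : R, 2 <= N & C0 + C1 * ln (3 * N) <= c * N.
Proof.
move=> c0 C00 C10; set a := 6 * C1 / c.
have a0 : 0 < a by rewrite divr_gt0// mulr_gt0.
have x0 : 0 <= 2 * (C0 + C1 * `|ln a|) / c.
  by rewrite divr_ge0 ?(ltW c0)// mulr_ge0// addr_ge0// mulr_ge0// ltW.
exists (2 + 2 * (C0 + C1 * `|ln a|) / c); first by rewrite lerDl.
set N := 2 + _; have N0 : 0 < N by rewrite ltr_wpDr.
have h1 : ln (3 * N) <= 3 * N / a + `|ln a|.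
  have -> : 3 * N = (3 * N / a) * a by rewrite divfK// gt_eqF.
  have y0 : 0 < 3 * N / a by rewrite divr_gt0// mulr_gt0.
  rewrite lnM ?posrE// mulfK ?gt_eqF//; apply: lerD; last exact: ler_norm.
  exact: ltW (ln_sublinear y0).
apply: le_trans (lerD (lexx C0) (ler_wpM2l (ltW C10) h1)) _.
have e1 : C1 * (3 * N / a) = c * N / 2.
  by rewrite /a; field; rewrite !gt_eqF.
have e2 : c * N = 2 * c + 2 * (C0 + C1 * `|ln a|).
  by rewrite /N; field; rewrite gt_eqF.
rewrite mulrDr e1 e2; move: (C1 * _) c0 C00 => *; lra.
Qed.

Section Choice.
Variables (l Gf Gg sigma Delta : R).
Hypotheses (l0 : 0 < l) (Gf0 : 0 < Gf) (Gg0 : 0 < Gg) (sigma0 : 0 < sigma).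
Hypothesis Delta0 : 0 <= Delta.

Let a0 : R := 3 + 1000 * l * Delta.
Let c : R := Num.min (1 / (4000 * l)) (G_F l Gf / (60 * l)).
Let C1 : R := G_H l Gf Gg sigma ^+ 2 / l.
Let C0 : R := l + ln 2 + C1 * (2 * ln (6 * a0) + 7).

Let GF0 : 0 < G_F l Gf. Proof. by rewrite /G_F addr_gt0// mulr_gt0. Qed.
Let GH0 : 0 < G_H l Gf Gg sigma.
Proof.
by rewrite /G_H addr_gt0// mulr_gt0// /lambda0 divr_gt0// mulr_gt0.
Qed.
Let C10 : 0 < C1. Proof. by rewrite divr_gt0// exprn_gt0. Qed.
Let c0 : 0 < c.
Proof.
rewrite lt_min; apply/andP; split; apply: divr_gt0.
- exact: ltr01.
- by apply: mulr_gt0; [rewrite ltr0n|exact: l0].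
- exact: GF0.
- by apply: mulr_gt0; [rewrite ltr0n|exact: l0].
Qed.
Let lD0 : 0 <= 1000 * l * Delta.
Proof. by rewrite -mulrA; apply: mulr_ge0; [exact: ler0n|apply: mulr_ge0 => //; exact: ltW]. Qed.
Let a03 : 3 <= a0. Proof. by rewrite lerDl lD0. Qed.

Lemma e_star_ge eps : 0 < eps <= 1 -> c * eps ^+ 2 <= e_star l Gf eps.
Proof.
move=> /andP[e0 e1]; rewrite /e_star le_min; apply/andP; split.
  apply: (@le_trans _ _ (1 / (4000 * l) * eps ^+ 2)).
    by rewrite ler_wpM2r ?sqr_ge0// ge_min lexx.
  by rewrite div1r mulrC.
apply: (@le_trans _ _ (G_F l Gf / (60 * l) * eps ^+ 2)).
  by rewrite ler_wpM2r ?sqr_ge0// ge_min lexx orbT.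
rewrite [leRHS]mulrAC; apply: ler_wpM2l; last by rewrite expr2 ger_pMl.
by apply: divr_ge0; [exact: ltW|apply: mulr_ge0; [exact: ler0n|exact: ltW]].
Qed.

Lemma outer_steps_le_inv eps : 0 < eps <= 1 ->
  (outer_steps l Delta eps)%:R <= a0 * eps ^- 2.
Proof.
move=> /andP[e0 e1]; have x0 := lD0.
apply: le_trans (outer_steps_le _) _; first by rewrite divr_ge0 ?sqr_ge0.
rewrite /a0 [leRHS]mulrDl lerD2r -[leLHS]mulr1 ler_pM2l// invf_ge1 ?exprn_gt0//.
by rewrite exprn_ile1// ltW.
Qed.

(** The number of inner steps: the logarithm of [K + 1] in the bound is absorbed
    by the factor [1 + ln (1 / eps)] once [N] dominates the logarithm of itself. *)
Lemma inner_steps_order : exists K : R -> nat,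
  [/\ forall eps, 0 < eps <= 1 -> admissible l Gf Gg sigma Delta eps (K eps),
      soft_O (fun eps => (K eps)%:R) (fun eps => eps ^- 2)
    & soft_O (fun eps => (outer_steps l Delta eps * K eps)%:R)
        (fun eps => eps ^- 4)].
Proof.
have ln2 : 0 <= ln (2 : R) by rewrite ln_ge0// ler1n.
have lna : 0 <= ln (6 * a0) by rewrite ln_ge0//; move: a03; lra.
have C00 : 0 <= C0.
  rewrite /C0 addr_ge0 ?addr_ge0 ?(ltW l0)// mulr_ge0 ?(ltW C10)//.
  by rewrite addr_ge0// mulr_ge0.
have [N N2 hN] := ln_affine_bound c0 C00 C10.
pose X eps : R := N * eps ^- 2 * (1 + ln (1 / eps)).
pose K eps : nat := `|Num.ceil (X eps)|%N.
have facts eps : 0 < eps <= 1 ->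
    [/\ 1 <= eps^-1, 0 <= ln (1 / eps), 1 + ln (1 / eps) <= eps^-1,
        X eps <= (K eps)%:R & (K eps)%:R <= X eps + 1].
  move=> /andP[e0 e1].
  have y1 : 1 <= eps^-1 by rewrite invf_ge1.
  have L0 : 0 <= ln (1 / eps) by rewrite div1r ln_ge0.
  have X0 : 0 <= X eps.
    by rewrite !mulr_ge0 ?addr_ge0 ?invr_ge0 ?exprn_ge0 ?(ltW e0)//; move: N2; lra.
  have cX0 : 0 <= Num.ceil (X eps) by rewrite -(ler_int R) (le_trans X0)// ceil_ge.
  split=> //.
  - have := @le_ln1Dx R (eps^-1 - 1); rewrite [1 + _]addrC subrK div1r => h.
    have : -1 < eps^-1 - 1 by move: y1; lra.
    by move=> /h; lra.
  - by rewrite /K natr_absz ger0_norm// ceil_ge.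
  - rewrite /K natr_absz ger0_norm//; have /andP[h _] := ceil_itv (X eps).
    by move: h; rewrite intrD => h; lra.
have XK eps : 0 < eps <= 1 -> (K eps)%:R <= 2 * N * (1 + ln (1 / eps)) * eps ^- 2.
  move=> he; have [y1 L0 _ _ h] := facts _ he; apply: le_trans h _.
  have : 1 <= X eps.
    rewrite /X -exprVn; move: y1 L0 N2; move: (eps^-1) (ln _) => y L y1 L0 N2.
    have : 1 <= y ^+ 2 by rewrite expr_ge1// (le_trans ler01).
    move: (y ^+ 2) => Y Y1; have : 2 <= N * Y by nra.
    move: (N * Y) => Z; nra.
  have -> : 2 * N * (1 + ln (1 / eps)) * eps ^- 2 = X eps + X eps by rewrite /X; ring.
  lra.
exists K; split.
- move=> eps he; have [y1 L0 Ly h1 h2] := facts _ he; have /andP[e0 e1] := he.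
  have Y1 : 1 <= eps ^- 2 by rewrite -exprVn expr_ge1// (le_trans ler01).
  have X2 : 2 <= X eps.
    rewrite /X; move: Y1 L0 N2; move: (eps ^- 2) (ln _) => Y L Y1 L0 N2.
    have : 2 <= N * Y by nra.
    by move: (N * Y) => Z; nra.
  have K2 : (2 <= K eps)%N by rewrite -(ler_nat R) (le_trans X2).
  split=> //; have K0 : 0 < (K eps)%:R :> R by rewrite ltr0n (leq_trans _ K2).
  apply: le_trans (e_star_ge he).
  rewrite /e_ /U_ -mulrDl ler_pdivrMr//.
  set T := outer_steps l Delta eps.
  have T0 : 0 < T%:R :> R by rewrite ltr0n (leq_trans _ (leq_maxl 2 _)).
  (* the three logarithms below grow like ln (1 / eps), with total weight 7 *)
  have lnT : ln (6 * T%:R) <= ln (6 * a0) + 2 * ln (1 / eps).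
    have hT := outer_steps_le_inv he.
    have a00 : 0 < a0 by move: a03; lra.
    have -> : 2 * ln (1 / eps) = ln (eps ^- 2).
      by rewrite div1r -exprVn lnXn ?invr_gt0// mulr_natl.
    rewrite -lnM ?posrE ?mulr_gt0 ?invr_gt0 ?exprn_gt0// ler_ln ?posrE ?mulr_gt0 ?invr_gt0 ?exprn_gt0//.
    by rewrite -mulrA ler_pM2l.
  have lnK : ln (K eps).+1%:R <= ln (3 * N) + 3 * ln (1 / eps).
    have -> : 3 * ln (1 / eps) = ln (eps ^- 3).
      by rewrite div1r -exprVn lnXn ?invr_gt0// mulr_natl.
    have N0 : 0 < N by move: N2; lra.
    rewrite -lnM ?posrE ?mulr_gt0 ?invr_gt0 ?exprn_gt0// ler_ln ?posrE ?ltr0n ?mulr_gt0 ?invr_gt0 ?exprn_gt0//.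
    rewrite -natr1.
    have hX : X eps <= N * eps ^- 3.
      rewrite /X -mulrA ler_pM2l// -!exprVn (exprSr _ 2) ler_pM2l//.
      by rewrite exprn_gt0// invr_gt0.
    by rewrite -mulrA; move: h2 X2 hX; move: (X eps) (K eps)%:R (N * _) => *; lra.
  have -> : 1 / (1 / (6 * T%:R)) = 6 * T%:R :> R by rewrite !div1r invrK.
  have key : l + G_H l Gf Gg sigma ^+ 2 / l * (ln (K eps).+1%:R + 2 * ln (6 * T%:R)) + ln 2 <=
      c * N * (1 + ln (1 / eps)).
    rewrite -/C1; have h3 : C1 * (ln (K eps).+1%:R + 2 * ln (6 * T%:R)) <=
        C1 * (ln (3 * N) + 2 * ln (6 * a0) + 7 * ln (1 / eps)).
      by rewrite ler_pM2l//; move: lnT lnK; move: (ln _) (ln _) (ln _) (ln _) (ln _) => *; lra.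
    have h4 := ler_wpM2r (_ : 0 <= 1 + ln (1 / eps)) hN.
    have {}h4 := h4 (addr_ge0 ler01 L0).
    apply: le_trans h4; apply: le_trans (lerD (lerD (lexx l) h3) (lexx (ln 2))) _.
    have ln3N : 0 <= ln (3 * N) by rewrite ln_ge0//; move: N2; lra.
    rewrite /C0; move: C10 ln2 lna L0 ln3N l0 {h3 lnT lnK Ly}.
    move: C1 (ln 2) (ln (6 * a0)) (ln (1 / eps)) (ln (3 * N)) l.
    move=> A u v L w m A0 u0 v0 L0 w0 m0.
    have h5 : 0 <= m * L by rewrite mulr_ge0// ltW.
    have h6 : 0 <= u * L by rewrite mulr_ge0.
    have h7 : 0 <= A * (v * L) by rewrite mulr_ge0 ?mulr_ge0// ltW.
    have h8 : 0 <= A * (w * L) by rewrite mulr_ge0 ?mulr_ge0// ltW.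
    rewrite -subr_ge0.
    have -> : (m + u + A * (2 * v + 7) + A * w) * (1 + L) - (m + A * (w + 2 * v + 7 * L) + u) =
      m * L + u * L + 2 * (A * (v * L)) + A * (w * L) + 7 * A by ring.
    by move: h5 h6 h7 h8 A0; move: (m * L) (u * L) (A * (v * L)) (A * (w * L)) => *; lra.
  apply: le_trans key _; have -> : c * N * (1 + ln (1 / eps)) = c * eps ^+ 2 * X eps.
    by rewrite /X; field; rewrite gt_eqF.
  by rewrite ler_wpM2l// mulr_ge0 ?sqr_ge0// ltW.
- exists (2 * N), 1%N => eps he; rewrite expr1 ger0_norm//; exact: XK.
exists (2 * N * a0), 1%N => eps he; rewrite expr1 ger0_norm// natrM.
have h1 := outer_steps_le_inv he; have h2 := XK _ he.
apply: le_trans (ler_pM _ _ h1 h2) _ => //.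
have /andP[e0 e1] := he.
by rewrite le_eqVlt; apply/orP; left; apply/eqP; field; rewrite gt_eqF.
Qed.

End Choice.

End Orders.

(** * The iterates as functions of the random tape *)

Section Iterates.
Context {R : realType} {d : nat} {Xi : Type}.
Variables (g : 'rV[R]_d -> R) (p : R -> R) (beta m : R) (K : nat).
Variables (vt : 'rV[R]_d -> Xi -> 'rV[R]_d) (tape : nat -> Xi).
Implicit Types x z : 'rV[R]_d.

Definition psm_step x s z w : 'rV[R]_d :=
  projB (z - (2 / (m * s.+1%:R)) *: (w + beta *: (z - x) + grad (p \o g) z)).

(** The [k]-th point of the inner loop started at [x], whose first oracle call
    has number [c]. *)
Fixpoint psm_point x (c k : nat) : 'rV[R]_d :=
  if k is k'.+1 then
    psm_step x k (psm_point x c k') (vt (psm_point x c k') (tape (c + k')))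
  else x.

Fixpoint outer_point x0 (t : nat) : 'rV[R]_d :=
  if t is t'.+1 then
    K%:R^-1 *: \sum_(k < K) psm_point (outer_point x0 t') (t' * K) k
  else x0.

Lemma psm_loopE x c n k q :
  psm_loop g p beta m vt tape x n k.+1 (psm_point x c k) (Usage (c + k) q) =
  ([seq psm_point x c i | i <- iota k n], Usage (c + (k + n)) q).
Proof.
elim: n k => [|n IH] k; first by rewrite addn0.
have /= := IH k.+1; rewrite /bind /query /ret addnS /= => ->.
by rewrite addSnnS.
Qed.

Lemma psmE x c q : psm g p beta m K vt tape x (Usage c q) =
  (K%:R^-1 *: \sum_(k < K) psm_point x c k, Usage (c + K) q).
Proof.
have := psm_loopE x c K 0 q; rewrite /psm /bind /= addn0 => ->.
by rewrite /ret big_map add0n -(big_mkord xpredT (psm_point x c)) /index_iota subn0.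
Qed.

Lemma outer_loopE x0 n t q :
  outer_loop g p beta m K vt tape n (outer_point x0 t) (Usage (t * K) q) =
  ([seq outer_point x0 i | i <- iota t.+1 n], Usage ((t + n) * K) q).
Proof.
elim: n t => [|n IH] t; first by rewrite addn0.
rewrite /= /bind psmE /=.
have := IH t.+1; rewrite mulSn addnC /= => ->.
by rewrite /ret addSnnS.
Qed.

Lemma penalized_psmE (projC : 'rV[R]_d -> 'rV[R]_d) x0 T j :
  penalized_psm g p beta m T K vt tape projC x0 j (Usage 0 0) =
  (projC (if (j <= T)%N then outer_point x0 j else x0), Usage (T * K) 1).
Proof.
rewrite /penalized_psm /bind; have := outer_loopE x0 T 0 0.
rewrite /= mul0n add0n => ->; rewrite /projectC /=; congr (projC _, _).
case: j => [|j] //=; case: ltnP => jT.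
  by rewrite (nth_map 0%N) ?size_iota// nth_iota.
by rewrite nth_default// size_map size_iota.
Qed.

Lemma psm_point_in x c k : unit_ball x -> unit_ball (psm_point x c k).
Proof. by case: k => [//|k] _; exact: projB_in. Qed.

Lemma outer_point_in x0 t : (0 < K)%N -> unit_ball x0 -> unit_ball (outer_point x0 t).
Proof.
move=> K0 B0; elim: t => [//|t IH] /=.
apply: (@mean_in _ _ _ (psm_point (outer_point x0 t) (t * K))) => //.
  exact: unit_ball_convex.
by move=> k _; exact: psm_point_in.
Qed.

End Iterates.

Section Histories.
Context {R : realType} {d : nat} {dO dX : measure_display}
  {Omega : measurableType dO} {Xi : measurableType dX}.
Variable xi : nat -> Omega -> Xi.
Hypothesis mxi : forall n, measurable_fun setT (xi n).
Local Notation borel := (g_sigma_algebraType (@open 'rV[R]_d)).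

Lemma past_sub n : sub_measurable (past xi n).
Proof.
apply: smallest_sub; first exact: sigma_algebra_measurable.
by move=> A [i [_ [E mE <-]]]; exact: mxi.
Qed.

Lemma past_mono n n' : (n <= n')%N -> <<s past xi n >> `<=` <<s past xi n' >>.
Proof.
move=> nn'; apply: sub_sigma_algebra2 => A [i [ni h]].
by exists i; split=> //; exact: leq_trans ni nn'.
Qed.

Lemma past_whole n : <<s past xi n >> `<=` <<s whole_history xi >>.
Proof. by apply: sub_sigma_algebra2 => A [i [ni h]]; exists i. Qed.

Lemma whole_sub : sub_measurable (whole_history xi).
Proof.
apply: smallest_sub; first exact: sigma_algebra_measurable.
by move=> A [i [E mE <-]]; exact: mxi.
Qed.

Lemma measurable_past_xi n :
  measurable_fun [set: g_sigma_algebraType (past xi n.+1)] (xi n).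
Proof.
move=> _ A mA; apply: sub_sigma_algebra; exists n; split=> //.
by exists A.
Qed.

End Histories.

(** * The noise of one oracle call *)

Section Noise.
Context {R : realType} {d : nat} {dO dX : measure_display}
  {Omega : measurableType dO} {Xi : measurableType dX}.
Variables (P : probability Omega R) (xi : nat -> Omega -> Xi).
Variables (D : set 'rV[R]_d) (f : 'rV[R]_d -> R) (Gf : R).
Variables (vt : 'rV[R]_d -> Xi -> 'rV[R]_d) (v : 'rV[R]_d -> 'rV[R]_d).
Hypothesis oracle : stochastic_oracle P D f Gf vt v xi.
Hypothesis Gf0 : 0 < Gf.
Hypothesis v_le : forall z, D z -> enorm (v z) <= Gf.
Local Notation borel := (g_sigma_algebraType (@open 'rV[R]_d)).

Let mxi n : measurable_fun setT (xi n). Proof. by have [_ h _ _] := oracle. Qed.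

(** The answer depends on the past through the query point and on the fresh
    randomness, which is known one call later. *)
Lemma measurable_answer n (X : Omega -> 'rV[R]_d) :
  measurable_fun [set: g_sigma_algebraType (past xi n)]
    (X : g_sigma_algebraType (past xi n) -> borel) ->
  measurable_fun [set: g_sigma_algebraType (past xi n.+1)]
    ((fun w => vt (X w) (xi n w)) : g_sigma_algebraType (past xi n.+1) -> borel).
Proof.
move=> mX; have [mvt _ _ _] := oracle.
have mX' := measurable_coarser (@past_mono _ _ _ _ xi n n.+1 (leqnSn n)) mX.
have mxi' := @measurable_past_xi _ _ _ _ xi n.
have := measurableT_comp mvt (measurable_fun_pair mX' mxi').
exact.
Qed.

Definition clip (r x : R) : R := Num.max (- r) (Num.min r x).

Lemma clip_le r x : 0 <= r -> `|clip r x| <= r.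
Proof.
move=> r0; rewrite /clip ler_norml le_max lexx /= ge_max ge_min lexx /= andbT.
lra.
Qed.

Lemma clip_id r x : `|x| <= r -> clip r x = x.
Proof.
rewrite ler_norml => /andP[h1 h2].
by rewrite /clip min_r// max_r.
Qed.

Lemma measurable_clip (dT : measure_display) (T : measurableType dT) (r X : T -> R) :
  measurable_fun setT r -> measurable_fun setT X ->
  measurable_fun setT (fun w => clip (r w) (X w)).
Proof.
move=> mr mX; apply: measurable_maxr; first exact: measurable_funN.
exact: measurable_minr.
Qed.

(** The oracle bounds its answer and its conditional mean only up to null sets,
    whereas [hoeffding_tail] asks for bounds at every point. Truncation at
    [Gf * enorm c] provides them, and almost surely it changes neither of the two
    variables. *)
Lemma noise_versions n (X c : Omega -> 'rV[R]_d) :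
  measurable_fun [set: g_sigma_algebraType (past xi n)]
    (X : g_sigma_algebraType (past xi n) -> borel) ->
  measurable_fun [set: g_sigma_algebraType (past xi n)]
    (c : g_sigma_algebraType (past xi n) -> borel) ->
  (forall w, D (X w)) -> (forall w, enorm (c w) <= 2) ->
  exists N mu : Omega -> R,
    [/\ measurable_fun [set: g_sigma_algebraType (past xi n.+1)] N,
        measurable_fun [set: g_sigma_algebraType (past xi n)] mu,
        cond_centred P (past xi n) (fun w => mu w - N w),
        (forall w, `|mu w| <= Gf * enorm (c w) /\ `|N w| <= Gf * enorm (c w)) &
        {ae P, forall w, enorm (vt (X w) (xi n w)) <= Gf /\
           mu w - N w = edot (v (X w) - vt (X w) (xi n w)) (c w)}].
Proof.
move=> mX mc DX c2; have [_ _ _ orc] := oracle.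
have sG : sub_measurable (past xi n) by exact: past_sub.
have [hce aevt] := orc n X mX DX.
have /choice[Z hZ] := fun i => cond_exp_centred sG (hce i).
pose mu0 w := \sum_(i < d) c w 0 i * Z i w.
pose N0 w := edot (c w) (vt (X w) (xi n w)).
pose r w := Gf * enorm (c w).
have r0 w : 0 <= r w by rewrite mulr_ge0 ?enorm_ge0// ltW.
have mcS := measurable_coarser (@past_mono _ _ _ _ xi n n.+1 (leqnSn n)) mc.
have mr : measurable_fun [set: g_sigma_algebraType (past xi n)] r.
  by apply: measurable_funM; [exact: measurable_cst|exact: measurable_enorm].
have mrS : measurable_fun [set: g_sigma_algebraType (past xi n.+1)] r.
  by apply: measurable_funM; [exact: measurable_cst|exact: measurable_enorm].
have mmu0 : measurable_fun [set: g_sigma_algebraType (past xi n)] mu0.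
  apply: measurable_sum => i; apply: measurable_funM; first exact: measurable_coord.
  by have [] := hZ i.
have mN0 : measurable_fun [set: g_sigma_algebraType (past xi n.+1)] N0.
  by apply: measurable_edot => //; exact: measurable_answer.
exists (fun w => clip (r w) (N0 w)), (fun w => clip (r w) (mu0 w)).
have mN : measurable_fun [set: g_sigma_algebraType (past xi n.+1)] (fun w => clip (r w) (N0 w)).
  exact: measurable_clip.
have mmu : measurable_fun [set: g_sigma_algebraType (past xi n)] (fun w => clip (r w) (mu0 w)).
  exact: measurable_clip.
have aeZ : {ae P, forall w, forall i, v (X w) 0 i = Z i w}.
  have h n' : {ae P, forall w, forall h : (n' < d)%N,
      v (X w) 0 (Ordinal h) = Z (Ordinal h) w}.
    have [nd|nd] := pselect (n' < d)%N; last by apply: aeW => w h; case: (nd h).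
    have [_ e _] := hZ (Ordinal nd); apply: filterS e => w e h.
    by rewrite (bool_irrelevance h nd).
  by apply: filterS (ae_foralln h) => w hw [i id]; exact: hw.
have ae_mu : {ae P, forall w, clip (r w) (mu0 w) = edot (c w) (v (X w)) /\ mu0 w = edot (c w) (v (X w))}.
  apply: filterS aeZ => w hw.
  have e : mu0 w = edot (c w) (v (X w)).
    by rewrite edot_sumE; apply: eq_bigr => i _; rewrite hw.
  split=> //; rewrite e clip_id//; apply: le_trans (normr_edot_le _ _) _.
  by rewrite mulrC ler_wpM2r ?enorm_ge0// v_le.
have ae_N : {ae P, forall w, clip (r w) (N0 w) = N0 w /\ enorm (vt (X w) (xi n w)) <= Gf}.
  apply: filterS aevt => w hw; split=> //; apply: clip_id.
  apply: le_trans (normr_edot_le _ _) _.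
  by rewrite mulrC ler_wpM2r ?enorm_ge0.
split=> //.
- have cc : cond_centred P (past xi n) (fun w => \sum_(i < d) c w 0 i * (Z i w - vt (X w) (xi n w) 0 i)).
    apply: cond_centred_sum => // i; have [_ _ ci] := hZ i.
    apply: (cond_centredM (M := 2)) => //; first exact: measurable_coord.
    by move=> w; apply: le_trans (coord_le_enorm _ _) (c2 w).
  apply: cond_centred_ae cc _ _ => //.
    apply: measurable_funB; first exact: measurable_sub mmu.
    exact: measurable_sub (past_sub mxi (n := n.+1)) mN.
  apply: filterS2 ae_mu ae_N => w [-> e] [-> _].
  rewrite -e /N0 edot_sumE -sumrB; apply: eq_bigr => i _.
  by rewrite mulrBr.
- by move=> w; split; exact: clip_le.
apply: filterS2 ae_mu ae_N => w [-> e] [-> h]; split=> //.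
by rewrite /N0 edotC (edotC (c w)) edotDl edotNl.
Qed.

End Noise.

(** * Counting in expectation *)

Section Counting.
Context {R : realType} {dO : measure_display} {Omega : measurableType dO}.
Variable P : probability Omega R.
Implicit Types (A : nat -> set Omega).

Lemma expected_count n A (b c : R) : 0 <= b -> 0 <= c ->
  (forall t, (t < n)%N -> measurable (A t)) ->
  (\int[P]_w (\sum_(t < n) (b + c * \1_(A t) w))%:E =
   (\sum_(t < n) (b + c * fine (P (A t))))%:E)%E.
Proof.
move=> b0 c0 mA; under eq_integral do rewrite -sumEFin.
have m1 (t : 'I_n) : measurable_fun setT (fun w => (\1_(A t) w)%:E : \bar R).
  by apply/measurable_EFinP; apply: measurable_indic; exact: mA.
have p1 (t : 'I_n) w : 0 <= \1_(A t) w :> R by rewrite indicE ler0n.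
rewrite ge0_integral_sum//.
- rewrite -sumEFin; apply: eq_bigr => t _.
  under eq_integral do rewrite EFinD EFinM.
  rewrite ge0_integralD//.
  + rewrite (integral_cst P measurableT b%:E) [X in (_ * X)%E]probability_setT mule1 ge0_integralZl_EFin//.
    by rewrite integral_indic ?setIT ?EFinD ?EFinM ?fineK ?fin_num_measure//; exact: mA.
  + by move=> w _; rewrite mule_ge0// lee_fin.
  + by apply: measurable_funeM; exact: m1.
- move=> t; under eq_fun do rewrite EFinD EFinM.
  by apply: emeasurable_funD; [exact: measurable_cst|exact: measurable_funeM].
- by move=> t w _; rewrite lee_fin addr_ge0// mulr_ge0.
Qed.

Lemma ae_count_le n A E (b c : R) : 0 <= b -> 0 <= c ->
  (forall t, (t < n)%N -> measurable (A t)) ->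
  (forall t, (t < n)%N -> measurable (E t)) ->
  {ae P, forall w, \sum_(t < n) \1_(A t) w <= \sum_(t < n) (b + c * \1_(E t) w)} ->
  \sum_(t < n) fine (P (A t)) <= \sum_(t < n) (b + c * fine (P (E t))).
Proof.
move=> b0 c0 mA mE ae.
have mS (F : nat -> set Omega) (b' c' : R) : (forall t, (t < n)%N -> measurable (F t)) ->
    measurable_fun setT (fun w => (\sum_(t < n) (b' + c' * \1_(F t) w))%:E : \bar R).
  move=> mF; apply/measurable_EFinP; apply: measurable_sum => t.
  apply: measurable_funD => //; apply: measurable_funM => //.
  by apply: measurable_indic; exact: mF.
have pS (F : nat -> set Omega) (b' c' : R) w : 0 <= b' -> 0 <= c' ->
    (0 <= (\sum_(t < n) (b' + c' * \1_(F t) w))%:E)%E.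
  move=> b'0 c'0; rewrite lee_fin sumr_ge0// => t _.
  by rewrite addr_ge0// mulr_ge0// indicE ler0n.
have e : \sum_(t < n) fine (P (A t)) = \sum_(t < n) (0 + 1 * fine (P (A t))).
  by apply: eq_bigr => t _; rewrite add0r mul1r.
rewrite e -lee_fin -!expected_count//.
apply: ae_ge0_le_integral => //; [by move=> w _; exact: pS|exact: mS|by move=> w _; exact: pS|exact: mS|].
apply: filterS ae => w h _; rewrite lee_fin; apply: le_trans h.
by rewrite le_eqVlt; apply/orP; left; apply/eqP; apply: eq_bigr => t _; rewrite add0r mul1r.
Qed.

(** Conditionally on [J = j] the event [F j] keeps its probability, so that a
    uniform index averages these probabilities. *)
Lemma sampled_index_ge n (F : nat -> set Omega) (J : Omega -> nat) (Good : set Omega) (q : R) :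
  measurable Good -> measurable_fun setT J ->
  (forall t, (t < n)%N -> measurable (F t.+1)) ->
  (forall t, (t < n)%N ->
     (P (F t.+1 `&` J @^-1` [set t.+1]) = P (F t.+1) * q%:E)%E) ->
  (forall t, (t < n)%N -> F t.+1 `&` J @^-1` [set t.+1] `<=` Good) ->
  q * \sum_(t < n) fine (P (F t.+1)) <= fine (P Good).
Proof.
move=> mG mJ mF hF sG; pose S t := F t.+1 `&` J @^-1` [set t.+1].
have mS t : (t < n)%N -> measurable (S t).
  move=> tn; apply: measurableI; first exact: mF.
  by rewrite -[X in measurable X]setTI; exact: mJ.
have mU : measurable (\big[setU/set0]_(t < n) S t).
  by apply: bigsetU_measurable => t _; exact: mS.
have tS : trivIset `I_n S.
  by move=> i j _ _ [w [[_ /= h1] [_ /= h2]]]; move: h2; rewrite h1 => -[].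
have h : (P (\big[setU/set0]_(t < n) S t) <= P Good)%E.
  apply: le_measure; rewrite ?inE//.
  by rewrite -bigcup_mkord => w [t /= tn]; exact: sG.
rewrite measure_semi_additive_ord_I// in h.
rewrite -lee_fin fineK ?fin_num_measure//; apply: le_trans h.
rewrite mulr_sumr -sumEFin; apply: lee_sum => t _.
have fF : P (F t.+1) \is a fin_num by apply: fin_num_measure; exact: mF.
have -> : (q * fine (P (F t.+1)))%:E = (P (F t.+1) * q%:E)%E.
  by rewrite mulrC EFinM (fineK fF).
by have := hF t (ltn_ord t); rewrite -/(S t) => <-.
Qed.

End Counting.

(** * One run of the method *)

Section Run.
Context {R : realType} {d : nat} {dO dX : measure_display}
  {Omega : measurableType dO} {Xi : measurableType dX}.
Variables (P : probability Omega R) (xi : nat -> Omega -> Xi).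
Variables (f g : 'rV[R]_d -> R) (U : set 'rV[R]_d) (x0 : 'rV[R]_d).
Variables (l Gf Gg sigma gam : R) (K : nat).
Variables (vt : 'rV[R]_d -> Xi -> 'rV[R]_d) (v : 'rV[R]_d -> 'rV[R]_d).
Let C : set 'rV[R]_d := [set x | g x <= 0].
Let B : set 'rV[R]_d := unit_ball.
Hypothesis closedC : closed C.
Hypothesis CB : C `<=` B.
Hypothesis Cx0 : C x0.
Hypothesis openU : open U.
Hypothesis BU : B `<=` U.
Hypothesis l0 : 0 < l.
Hypothesis Gf0 : 0 < Gf.
Hypothesis wcf : weakly_convex_on U l f.
Hypothesis lipf : euclidean_lipschitz U Gf f.
Hypothesis oracle : stochastic_oracle P B f Gf vt v xi.
Hypothesis Gg0 : 0 < Gg.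
Hypothesis sigma0 : 0 < sigma.
Hypothesis cvxg : convex_function U g.
Hypothesis C1g : C1_on U g.
Hypothesis grad_le : forall z, B z -> enorm (grad g z) <= Gg.
Hypothesis grad_active : forall z, B z -> g z = 0 -> sigma <= enorm (grad g z).
Hypothesis gam0 : 0 < gam.
Hypothesis K0 : (0 < K)%N.

Local Notation borel := (g_sigma_algebraType (@open 'rV[R]_d)).
Local Notation lam := (lambda0 l Gf sigma).
Local Notation p := (softplus gam lam).
Local Notation Q := (prox_point f C l).
Local Notation PC := (eproj C).
Local Notation H := (penalized_objective f g p (2 * l)).
Local Notation inner n k X w := (psm_point g p (2 * l) l vt (xi ^~ w) X n k).
Local Notation outer t w := (outer_point g p (2 * l) l K vt (xi ^~ w) x0 t).

Let C0 : C !=set0. Proof. by exists x0. Qed.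
Let Bx0 : B x0. Proof. exact: CB. Qed.
Let mxi n : measurable_fun setT (xi n). Proof. by have [_ h _ _] := oracle. Qed.
Let v_le z : B z -> enorm (v z) <= Gf.
Proof.
move=> Bz; have [_ _ h _] := oracle.
exact: limiting_subdiff_le (ltW Gf0) openU (BU Bz) lipf (h z Bz).
Qed.

Let gradp_continuous : continuous (grad (p \o g) \o projB).
Proof.
move=> x; apply: continuous_comp; first exact: projB_continuous.
have Ux : U (projB x) by apply: BU; exact: projB_in.
exact: (@softplus_comp_grad_continuous _ _ _ gam0 _ _ _ _ openU C1g Ux).
Qed.

Let outer_in t w : B (outer t w).
Proof. exact: outer_point_in. Qed.

(** The gradient of the penalty is continuous on [U] only. The iterates lie in
    the ball, so precomposing it with [projB] changes nothing and makes it
    continuous everywhere. *)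
Lemma psm_point_measurable n k (X : Omega -> 'rV[R]_d) :
  measurable_fun [set: g_sigma_algebraType (past xi n)]
    (X : g_sigma_algebraType (past xi n) -> borel) ->
  (forall w, B (X w)) ->
  measurable_fun [set: g_sigma_algebraType (past xi (n + k))]
    ((fun w => inner n k (X w) w) : g_sigma_algebraType (past xi (n + k)) -> borel).
Proof.
move=> mX BX; elim: k => [|k IH]; first by rewrite addn0.
rewrite addnS; pose Z w := inner n k (X w) w.
have BZ w : B (Z w) by apply: psm_point_in; exact: BX.
have mZ := measurable_coarser (@past_mono _ _ _ _ xi _ _ (leqnSn (n + k))) IH.
have mXS : measurable_fun [set: g_sigma_algebraType (past xi (n + k).+1)]
    (X : g_sigma_algebraType (past xi (n + k).+1) -> borel).
  by apply: measurable_coarser mX; apply: past_mono; rewrite -addnS leq_addr.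
have mA := measurable_answer oracle IH.
have -> : (fun w => inner n k.+1 (X w) w) =
    projB \o (fun w => Z w - (2 / (l * k.+2%:R)) *:
      (vt (Z w) (xi (n + k)%N w) + (2 * l) *: (Z w - X w) +
       (grad (p \o g) \o projB) (Z w))).
  by apply/funext => w /=; rewrite /psm_step (projB_id (BZ w)).
apply: (measurable_vec_cont projB_continuous).
apply: measurable_vecB => //; apply: measurable_vecZ; apply: measurable_vecD.
  by apply: measurable_vecD => //; apply: measurable_vecZ; exact: measurable_vecB.
exact: (measurable_vec_cont gradp_continuous mZ).
Qed.

Lemma outer_point_measurable t :
  measurable_fun [set: g_sigma_algebraType (past xi (t * K))]
    ((fun w => outer t w) : g_sigma_algebraType (past xi (t * K)) -> borel).
Proof.
elim: t => [|t IH]; first exact: measurable_cst.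
have e : (t * K + K = t.+1 * K)%N by rewrite mulSn addnC.
pose F k w := inner (t * K)%N k (outer t w) w.
have mF k : (k < K)%N -> measurable_fun [set: g_sigma_algebraType (past xi (t.+1 * K))]
    (F k : g_sigma_algebraType (past xi (t.+1 * K)) -> borel).
  move=> kK; have sk : <<s past xi (t * K + k) >> `<=` <<s past xi (t.+1 * K) >>.
    by apply: past_mono; rewrite -e leq_add2l ltnW.
  exact: (measurable_coarser sk (psm_point_measurable (k := k) IH (outer_in t))).
exact: (measurable_vecZ K%:R^-1 (measurable_vec_sum mF)).
Qed.

(** Azuma's inequality for the noise of one inner loop, seen from the point
    [Q x]: the variance proxy is absorbed by the strong convexity. *)
Lemma psm_tail t delta : 0 < delta <= 1 ->
  exists E : set Omega, [/\ measurable E, (P E <= delta%:E)%E &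
    {ae P, forall w, ~ E w -> H (outer t w) (outer t.+1 w) <=
       H (outer t w) (Q (outer t w)) + U_ K l (G_H l Gf Gg sigma) delta}].
Proof.
move=> /andP[delta0 delta1].
pose z k w := inner (t * K)%N k (outer t w) w.
pose y w := Q (outer t w).
have By w : B (y w) by apply: CB; exact: (feasible_prox_in l closedC CB C0 openU BU lipf).
have Bz k w : B (z k w) by apply: psm_point_in; exact: outer_in.
pose G k := past xi (t * K + k).
have sG k k' : (k <= k')%N -> <<s G k >> `<=` <<s G k' >>.
  by move=> kk; apply: past_mono; rewrite leq_add2l.
have mx : measurable_fun [set: g_sigma_algebraType (past xi (t * K))]
    ((fun w => outer t w) : g_sigma_algebraType (past xi (t * K)) -> borel).
  exact: outer_point_measurable.
have my : measurable_fun [set: g_sigma_algebraType (past xi (t * K))]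
    (y : g_sigma_algebraType (past xi (t * K)) -> borel).
  apply: (measurable_vec_cont _ mx).
  exact: (feasible_prox_continuous closedC CB C0 openU BU l0 wcf lipf cvxg).
have mz k : measurable_fun [set: g_sigma_algebraType (G k)]
    (z k : g_sigma_algebraType (G k) -> borel).
  exact: psm_point_measurable.
pose c k w := z k w - y w.
have mc k : measurable_fun [set: g_sigma_algebraType (G k)]
    (c k : g_sigma_algebraType (G k) -> borel).
  apply: measurable_vecB => //; apply: measurable_coarser my.
  by apply: past_mono; rewrite leq_addr.
have c2 k w : enorm (c k w) <= 2 by apply: unit_ball_dist; [exact: Bz|exact: By].
have nv k := noise_versions oracle Gf0 v_le (mz k) (mc k) (Bz k) (c2 k).
have /choice[N hN] := nv; have /choice[mu hmu] := hN.
pose r k w := Gf * enorm (c k w).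
(* with this exponent the variance proxy t ^+ 2 * r ^+ 2 / 2 of the direction c
   equals t * (l / 4 * enorm c ^+ 2), the gain kept aside in psm_regret *)
have th0 : 0 < l / (2 * Gf ^+ 2) by rewrite divr_gt0// mulr_gt0// exprn_gt0.
have [||||//|//|mE PE] := @hoeffding_tail _ _ _ P G K N mu r (Gf * 2) (l / (2 * Gf ^+ 2)) delta.
- by move=> k; exact: past_sub.
- by move=> k; apply: sG.
- move=> k _; have [mN mmu cc _ _] := hmu k; split => //.
  + by rewrite /G addnS.
  + by apply: measurable_funM; [exact: measurable_cst|exact: measurable_enorm].
- move=> k w _; have [_ _ _ h _] := hmu k; have [h1 h2] := h w; split=> //.
  by rewrite /r ler_wpM2l// ltW.
exists [set w | ln (1 / delta) < \sum_(k < K) (l / (2 * Gf ^+ 2) * (mu k w - N k w) - (l / (2 * Gf ^+ 2)) ^+ 2 * r k w ^+ 2 / 2)].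
split; [exact: mE|exact: PE|].
have := ae_foralln (fun k => let: And5 _ _ _ _ h := hmu k in h).
apply: filterS => w hw /negP; rewrite -leNgt => hS.
apply: (psm_accuracy openU BU l0 Gf0 wcf sigma0 cvxg C1g gam0 Gg0 grad_le
  (z := z ^~ w) (vt := fun k => vt (z k w) (xi (t * K + k)%N w)) (v := fun k => v (z k w))) => //.
- exact: outer_in.
- exact: By.
- by move=> k _; have [] := hw k.
- by move=> k _; have [_ _ h _] := oracle; exact: (h _ (Bz k w)).
- by rewrite delta0.
have e k : l / (2 * Gf ^+ 2) * (mu k w - N k w) - (l / (2 * Gf ^+ 2)) ^+ 2 * r k w ^+ 2 / 2 =
    l / (2 * Gf ^+ 2) * (edot (v (z k w) - vt (z k w) (xi (t * K + k)%N w)) (z k w - y w)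
      - l / 4 * enorm (z k w - y w) ^+ 2).
  have [_ ->] := hw k; rewrite /r /c; move: (edot _ _) (enorm _) => a b.
  by field; rewrite (gt_eqF Gf0).
move: hS; under eq_bigr do rewrite e; rewrite -mulr_sumr => hS.
have -> : 2 * Gf ^+ 2 / l = (l / (2 * Gf ^+ 2))^-1 by rewrite invf_div.
rewrite [leRHS]mulrC ler_pdivlMr// [leLHS]mulrC; exact: hS.
Qed.

Local Notation stationary eps t :=
  [set w | stationarity f C l (PC (outer t w)) <= eps].

Lemma stationary_measurable eps t : <<s whole_history xi >> (stationary eps t).
Proof.
have m := measurable_coarser (@past_whole _ _ _ _ xi (t * K)) (outer_point_measurable (t := t)).
have cS := stationarity_continuous closedC CB C0 openU BU l0 wcf lipf cvxg.
have cP := feasible_proj_continuous closedC CB C0 BU cvxg.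
have mS : measurable_fun [set: g_sigma_algebraType (whole_history xi)]
    (fun w => stationarity f C l (PC (outer t w))).
  exact: (measurable_comp_cont cS (measurable_vec_cont cP m)).
have := mS measurableT _ (@measurable_itv _ `]-oo, eps]).
by rewrite setTI; congr (<<s _ >> _); apply/seteqP; split=> w /=; rewrite in_itv.
Qed.

Let stationary_measurableT eps t : measurable (stationary eps t).
Proof. exact: (whole_sub mxi) (stationary_measurable eps t). Qed.

(** Where every inner loop is accurate, [few_nonstationary] bounds the count by
    [T / 6]. Elsewhere the count is at most [T], and this event has probability at
    most [T * (1 / (6 * T))]. *)
Lemma expected_nonstationary eps T : 0 < eps -> (1 < T)%N ->
  1000 * l * (f x0 - minval B f) / eps ^+ 2 <= T%:R ->
  U_ K l (G_H l Gf Gg sigma) (1 / (6 * T%:R)) + gam * ln 2 <= e_star l Gf eps ->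
  \sum_(t < T) fine (P (~` stationary eps t.+1)) <= T%:R / 3.
Proof.
move=> eps0 T1 TD hu; have T0 : 1 <= T%:R :> R by rewrite ler1n ltnW.
pose delta : R := 1 / (6 * T%:R); rewrite -/delta in hu.
have delta0 : 0 < delta by rewrite divr_gt0// mulr_gt0// (lt_le_trans _ T0).
have delta1 : delta <= 1 by rewrite /delta ler_pdivrMr; lra.
have u0 : 0 <= U_ K l (G_H l Gf Gg sigma) delta.
  have lnd : 0 <= ln (1 / delta) by rewrite ln_ge0// ler_pdivlMr// mul1r.
  have lnK : 0 <= ln K.+1%:R :> R by rewrite ln_ge0// ler1n.
  rewrite /U_ divr_ge0 ?ler0n// addr_ge0 ?(ltW l0)//.
  by rewrite mulr_ge0// ?divr_ge0 ?sqr_ge0 ?(ltW l0)// addr_ge0// mulr_ge0.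
have /choice[E hE] : forall t, exists E : set Omega, [/\ measurable E, (P E <= delta%:E)%E &
    {ae P, forall w, ~ E w -> H (outer t w) (outer t.+1 w) <=
       H (outer t w) (Q (outer t w)) + U_ K l (G_H l Gf Gg sigma) delta}].
  by move=> t; apply: psm_tail; rewrite delta0.
have PE t : fine (P (E t)) <= delta.
  have [mE hP _] := hE t; rewrite -lee_fin fineK//; exact: fin_num_measure.
have mE t : measurable (E t) by have [] := hE t.
have h : \sum_(t < T) fine (P (~` stationary eps t.+1)) <=
    \sum_(t < T) (1 / 6 + T%:R * fine (P (E t))).
  apply: (ae_count_le (A := fun t => ~` stationary eps t.+1)) => //.
  - by move=> t _; apply: measurableC.
  have := ae_foralln (fun t => let: And3 _ _ h := hE t in h).
  apply: filterS => w hw.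
  have le1 (A : set Omega) : \1_A w <= 1 :> R by rewrite indicE lern1 leq_b1.
  have ge0 (A : set Omega) : 0 <= \1_A w :> R by rewrite indicE ler0n.
  have [[t [tT Etw]]|noE] := pselect (exists t, (t < T)%N /\ E t w).
    apply: (@le_trans _ _ (\sum_(t < T) 1)); first by apply: ler_sum.
    rewrite sumr_const card_ord (bigD1 (Ordinal tT)) //=.
    rewrite indicE mem_set// mulr1 -addrA addrCA lerDl addr_ge0 ?divr_ge0 ?ler0n//.
    by apply: sumr_ge0 => i _; rewrite addr_ge0 ?divr_ge0 ?mulr_ge0 ?ler0n.
  have good t : (t < T)%N -> H (outer t w) (outer t.+1 w) <=
       H (outer t w) (Q (outer t w)) + U_ K l (G_H l Gf Gg sigma) delta.
    by move=> tT; apply: hw => Etw; apply: noE; exists t.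
  have few := few_nonstationary closedC CB C0 openU BU l0 Gf0 wcf lipf sigma0 cvxg C1g
    grad_active gam0 eps0 T1 (fun t _ => outer_in t w) Cx0 u0 TD hu good.
  apply: (@le_trans _ _ (T%:R / 6)).
    apply: le_trans few; apply: ler_sum => t _.
    rewrite indicE ler_nat; case: (boolP (w \in _)) => //= /set_mem /= /negP.
    by rewrite -ltNge => ->.
  apply: (@le_trans _ _ (\sum_(t < T) (1 / 6))).
    by rewrite sumr_const card_ord -[leRHS]mulr_natl mul1r.
  by apply: ler_sum => t _; rewrite lerDl mulr_ge0 ?ler0n.
apply: le_trans h _; apply: (@le_trans _ _ (\sum_(t < T) (1 / 3))); last first.
  by rewrite sumr_const card_ord -[leLHS]mulr_natl mul1r.
apply: ler_sum => t _.
have : T%:R * fine (P (E t)) <= T%:R * delta by rewrite ler_wpM2l.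
have -> : T%:R * delta = 1 / 6.
  by rewrite /delta; move: (T%:R) T0 => a a1; field; rewrite (gt_eqF (lt_le_trans ltr01 a1)).
move: (T%:R * _) => a; lra.
Qed.

(** Split according to the countably many values of the index. *)
Lemma sampled_measurable eps T (J : Omega -> nat) : measurable_fun setT J ->
  measurable [set w | stationarity f C l
    (PC (if (J w <= T)%N then outer (J w) w else x0)) <= eps].
Proof.
move=> mJ.
have -> : [set w | stationarity f C l
      (PC (if (J w <= T)%N then outer (J w) w else x0)) <= eps] =
    \bigcup_j (J @^-1` [set j] `&`
      if (j <= T)%N then stationary eps j else stationary eps 0%N).
  apply/seteqP; split=> [w Sw|w [j _ [/= <-]]]; last by case: leqP.
  by exists (J w) => //; split=> //; move: Sw => /=; case: leqP.
apply: bigcup_measurable => j _; apply: measurableI.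
  by rewrite -[X in measurable X]setTI; exact: mJ.
by case: leqP.
Qed.

(** The chance of a nonstationary output is the mean over the index of the
    probabilities in [expected_nonstationary], since the index is independent of
    the run. *)
Lemma sampled_stationary eps T (J : Omega -> nat) (Good : set Omega) :
  0 < eps -> (1 < T)%N ->
  1000 * l * (f x0 - minval B f) / eps ^+ 2 <= T%:R ->
  U_ K l (G_H l Gf Gg sigma) (1 / (6 * T%:R)) + gam * ln 2 <= e_star l Gf eps ->
  uniform_index P (iota 1 T) J -> independent_index P xi J ->
  measurable Good ->
  (forall t w, (t < T)%N -> J w = t.+1 ->
     stationarity f C l (PC (outer t.+1 w)) <= eps -> Good w) ->
  ((2 / 3)%:E <= P Good)%E.
Proof.
move=> eps0 T1 TD hu [mJ uJ] iJ mG hG.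
have T0 : 0 < T%:R :> R by rewrite ltr0n ltnW.
have h1 := expected_nonstationary eps0 T1 TD hu.
have h2 : T%:R^-1 * \sum_(t < T) fine (P (stationary eps t.+1)) <= fine (P Good).
  apply: (sampled_index_ge (F := fun t => stationary eps t) mG mJ) => //.
  - move=> t tT; rewrite (iJ _ _ (stationary_measurable eps t.+1)) uJ ?size_iota//.
    by rewrite mem_iota /= add1n ltnS.
  - by move=> t tT w [/= Sw Jw]; exact: hG Jw Sw.
have e t : fine (P (~` stationary eps t)) = 1 - fine (P (stationary eps t)).
  rewrite probability_setC// fineB//; exact: fin_num_measure.
move: h1; under eq_bigr do rewrite e.
rewrite sumrB sumr_const card_ord => h1.
have h3 : T%:R * (2 / 3) <= \sum_(t < T) fine (P (stationary eps t.+1)).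
  by move: h1; move: (\sum_(t < T) _) => a; move: (T%:R) => b; lra.
rewrite -[P Good]fineK ?fin_num_measure// lee_fin; apply: le_trans h2.
by rewrite [leRHS]mulrC ler_pdivlMr// [leLHS]mulrC.
Qed.

End Run.

Theorem theorem2 (R : realType) :
  (* T = O(1 + l Delta_f / eps^2), with an absolute constant *)
  (exists A : R, forall l Delta eps : R,
     0 < l -> 0 <= Delta -> 0 < eps <= 1 ->
     (outer_steps l Delta eps)%:R <= A * (1 + l * Delta / eps ^+ 2)) /\
  (* K, hence T K, can be chosen of the claimed order for fixed parameters *)
  (forall l Gf Gg sigma Delta : R,
     0 < l -> 0 < Gf -> 0 < Gg -> 0 < sigma -> 0 <= Delta ->
     exists K : R -> nat,
       [/\ forall eps, 0 < eps <= 1 -> admissible l Gf Gg sigma Delta eps (K eps),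
           soft_O (fun eps => (K eps)%:R) (fun eps => eps ^- 2)
         & soft_O (fun eps => (outer_steps l Delta eps * K eps)%:R)
             (fun eps => eps ^- 4)]) /\
  (* the guarantee *)
  (forall (d : nat) (f g : 'rV[R]_d -> R) (U : set 'rV[R]_d) (x0 : 'rV[R]_d)
     (l Gf Gg sigma eps : R)
     (dO dX : measure_display) (Omega : measurableType dO)
     (Xi : measurableType dX) (P : probability Omega R)
     (vt : 'rV[R]_d -> Xi -> 'rV[R]_d) (v : 'rV[R]_d -> 'rV[R]_d)
     (xi : nat -> Omega -> Xi) (J : Omega -> nat)
     (projC : Omega -> 'rV[R]_d -> 'rV[R]_d) (K : nat),
   let C := [set x | g x <= 0] in
   let B := unit_ball in
   let Delta := f x0 - minval B f in
   let T := outer_steps l Delta eps in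
   let p := softplus (K%:R^-1) (lambda0 l Gf sigma) in
   let run w :=
     penalized_psm g p (2 * l) l T K vt (xi ^~ w) (projC w) x0 (J w)
       (Usage 0 0) in
   let xhat w := (run w).1 in
   (* (i) *)
   closed C -> C `<=` B -> C x0 ->
   open U -> convex_set U -> B `<=` U ->
   (* (ii) *)
   0 < l -> 0 < Gf ->
   weakly_convex_on U l f -> euclidean_lipschitz U Gf f ->
   stochastic_oracle P B f Gf vt v xi ->
   (* (iii) *)
   0 < Gg -> 0 < sigma ->
   convex_function U g -> C1_on U g ->
   (forall x, B x -> enorm (grad g x) <= Gg) ->
   (forall z, B z -> g z = 0 -> sigma <= enorm (grad g z)) ->
   0 < eps <= 1 ->
   (* the index and the answers of the projection onto C *)
   uniform_index P (iota 1 T) J -> independent_index P xi J ->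
   (forall w x, projection_set C x (projC w x)) ->
   admissible l Gf Gg sigma Delta eps K ->
   [/\ (* the objectives satisfy the requirement on the input m *)
       forall x, strongly_convex_on B l (penalized_objective f g p (2 * l) x),
       (* the expressions for S_l *)
       forall x, [/\ exists! y, argmin C (prox_objective f l x) y,
                     differentiable (envelope f C l) x
                   & stationarity f C l x =
                       2 * l * enorm (x - prox_point f C l x)],
       forall w, C (xhat w),
       measurable [set w | stationarity f C l (xhat w) <= eps] /\
       ((2 / 3)%:E <= P [set w | (stationarity f C l (xhat w) <= eps)%R])%E
     & forall w, (run w).2 = Usage (T * K) 1]).
Proof.
split; first exact: outer_steps_order.
split=> [l Gf Gg sigma Delta l0 Gf0 Gg0 s0 D0|]; first exact: inner_steps_order.
move=> d f g U x0 l Gf Gg sigma eps dO dX Omega Xi P vt v xi J projC K.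
move=> C B Delta T p run xhat closedC CB Cx0 openU _ BU l0 Gf0 wcf lipf oracle Gg0 s0
  cvxg C1g grad_le grad_active /andP[eps0 eps1] uJ iJ hprojC [K2 hK].
have C0 : C !=set0 by exists x0.
have K0 : (0 < K)%N by exact: leq_trans K2.
have gam0 : 0 < K%:R^-1 :> R by rewrite invr_gt0 ltr0n.
have [mJ _] := uJ.
have convexC := feasible_convex CB BU cvxg.
have compactC := feasible_compact closedC CB.
have projCE w x : projC w x = eproj C x by exact: (eproj_unique convexC compactC C0).
have runE w : run w = (eproj C (if (J w <= T)%N then
    outer_point g p (2 * l) l K vt (xi ^~ w) x0 (J w) else x0), Usage (T * K) 1).
  by rewrite /run penalized_psmE projCE.
have T1 : (1 < T)%N by rewrite /T /outer_steps leq_maxl.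
have Delta0 : 0 <= Delta.
  by rewrite subr_ge0; apply: (minval_ball_le BU Gf0 lipf); exact: CB.
have TD : 1000 * l * Delta / eps ^+ 2 <= T%:R.
  have h := mulr_ge0 (mulr_ge0 (ler0n R 1000) (ltW l0)) Delta0.
  exact: outer_steps_ge (divr_ge0 h (sqr_ge0 eps)).
have hu : U_ K l (G_H l Gf Gg sigma) (1 / (6 * T%:R)) + K%:R^-1 * ln 2 <= e_star l Gf eps.
  by move: hK; rewrite /e_ [ln 2 / _]mulrC.
split.
- exact: (penalized_strongly_convex BU l0 Gf0 wcf s0 cvxg gam0).
- move=> x; have [dS eS] := feasible_stationarityE closedC CB C0 openU BU l0 wcf lipf cvxg x.
  split=> //; exists (prox_point f C l x); split.
    exact: (feasible_prox_argmin l closedC CB C0 openU BU lipf).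
  by move=> y hy; rewrite (feasible_prox_unique closedC CB C0 openU BU l0 wcf lipf cvxg hy).
- by move=> w; rewrite /xhat runE; exact: (feasible_proj_in closedC CB C0).
- have mG := sampled_measurable sigma closedC CB Cx0 openU BU l0 wcf lipf oracle cvxg C1g gam0 K0 eps T mJ.
  have e : [set w | stationarity f C l (xhat w) <= eps] = [set w | stationarity f C l
      (eproj C (if (J w <= T)%N then
        outer_point g p (2 * l) l K vt (xi ^~ w) x0 (J w) else x0)) <= eps].
    by apply/seteqP; split=> w /=; rewrite /xhat runE.
  rewrite e; split; first exact: mG.
  apply: (sampled_stationary closedC CB Cx0 openU BU l0 Gf0 wcf lipf oracle Gg0 s0 cvxg C1g
    grad_le grad_active gam0 K0 eps0 T1 TD hu uJ iJ mG) => t w tT Jw Sw.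
  by rewrite /= Jw tT.
- by move=> w; rewrite runE.
Qed.
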